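(* (1) Let $d=2$. For any $\beta_0>0$ there exist positive constants $c_1,c_2$ depending only on $\beta_0$ such that for all $\beta>\beta_0$, $$\mu_t\left( c_1\left(\frac{t}{\beta}\right)^{1/3}\le \operatorname{diam}(R_t)\le c_2\left(\frac{t}{\beta}\right)^{1/3}\right)\to 1\quad\text{as } t\to\infty.$$ (2) Let $d\ge 3$. For any $\beta_0>0$ there exist positive constants $c_1,c_2$ depending only on $d$ and $\beta_0$ such that for all $\beta>\beta_0$, $$\mu_t\left( \operatorname{diam}(R_t)\ge c_1\left(\frac{t}{\beta}\right)^{1/(d+1)}\ \text{ and }\ |R_t|\le c_2\left(\frac{t}{\beta}\right)^{d/(d+1)}\right)\to 1\quad\text{as } t\to\infty.$$
   Context: Let $d\ge 2$ and let $(X_s)_{s\ge 0}$ be the continuous-time simple random walk on $\mathbb{Z}^d$ started from $0$ in which each edge has rate one (so the walk jumps from its current site to each of its $2d$ neighbours at rate $1$), with law $\mathbb{P}$ on the space of right-continuous nearest-neighbour paths, equipped with the $\sigma$-field generated by $X$. Let $R_t=\{v\in\mathbb{Z}^d: X_s=v\text{ for some } s\le t\}$ be the range at time $t$. For $G\subset\mathbb{Z}^d$, $\partial G=\{x\in G: x\sim y\text{ for some } y\notin G\}$ is the inner vertex boundary ($x\sim y$ means nearest neighbours), and $\operatorname{diam} G=\sup\{|z-w|: z,w\in G\}$ is the Euclidean diameter. For $\beta>0$, $t>0$, the Gibbs measure $\mu_t$ (depending on $\beta$) is defined by $$\frac{d\mu_t}{d\mathbb{P}}=\frac{1}{Z(t,\beta)}\exp(-\beta|\partial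 R_t|),\qquad Z(t,\beta)=\mathbb{E}[\exp(-\beta|\partial R_t|)].$$ *)

(* Defs.v *)
From HB Require Import structures.
From mathcomp Require Import all_boot all_order all_algebra finmap.
From mathcomp Require Import all_classical all_reals all_analysis.
Set Implicit Arguments.
Unset Strict Implicit.
Unset Printing Implicit Defensive.
Import Order.TTheory GRing.Theory Num.Theory.
Import numFieldNormedType.Exports.
Local Open Scope classical_set_scope.
Local Open Scope ring_scope.

(* Z^d is 'rV[int]_d; two sites are adjacent when their l^1 distance is 1. *)
Definition adjacent (d : nat) (x y : 'rV[int]_d) : bool :=
  \sum_(i < d) `|x 0 i - y 0 i| == 1.

Definition inner_boundary (d : nat) (G : set 'rV[int]_d) : set 'rV[int]_d :=
  [set x | G x /\ exists2 y, adjacent x y & ~ G y].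

(* Real-valued cardinality; it is only meaningful on finite sets (fset_set
   sends infinite sets to fset0), and is only used on subsets of the range of
   a path, which is finite by [finite_walk_range] below. *)
Definition card_set (R : realType) (d : nat) (G : set 'rV[int]_d) : R :=
  (#|` fset_set G|)%:R.

Definition euclidean_dist (R : realType) (d : nat) (x y : 'rV[int]_d) : R :=
  Num.sqrt (\sum_(i < d) ((x 0 i - y 0 i)%:~R) ^+ 2).

Definition diam (R : realType) (d : nat) (G : set 'rV[int]_d) : R :=
  sup [set euclidean_dist R p.1 p.2 | p in G `*` G].

(* Right-continuous nearest-neighbour paths on [0, +oo). As Z^d is discrete,
   one-sided continuity is local constancy on that side. The existence of left
   limits is part of being a nearest-neighbour path: each jump goes from the
   left limit to a neighbour of it. *)
Definition nn_path (R : realType) (d : nat) (w : {nonneg R} -> 'rV[int]_d) :=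
  (forall s : {nonneg R}, exists2 e : R, 0 < e &
     forall u : {nonneg R}, s%:num <= u%:num < s%:num + e -> w u = w s) /\
  (forall s : {nonneg R}, 0 < s%:num -> exists2 e : R, 0 < e &
     exists2 x, x = w s \/ adjacent x (w s) &
     forall u : {nonneg R}, s%:num - e < u%:num < s%:num -> w u = x).

Record walk_path (R : realType) (d : nat) := WalkPath {
  path_fun :> {nonneg R} -> 'rV[int]_d ;
  path_nn : nn_path path_fun }.

Lemma nn_path_cst (R : realType) (d : nat) (x : 'rV[int]_d) :
  nn_path (fun _ : {nonneg R} => x).
Proof.
split=> [s|s _]; exists 1 => //.
by exists x => //; left.
Qed.

HB.instance Definition _ (R : realType) (d : nat) := gen_eqMixin (walk_path R d).
HB.instance Definition _ (R : realType) (d : nat) := gen_choiceMixin (walk_path R d).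
HB.instance Definition _ (R : realType) (d : nat) :=
  isPointed.Build (walk_path R d) (WalkPath (@nn_path_cst R d 0)).

(* The sigma-field generated by the coordinates X_s. *)
Definition coordinate_events (R : realType) (d : nat) : set (set (walk_path R d)) :=
  [set A | exists s x, A = [set w : walk_path R d | w s = x]].

Definition path_space (R : realType) (d : nat) :=
  g_sigma_algebraType (@coordinate_events R d).

Definition walk_range (R : realType) (d : nat) (w : walk_path R d) (t : R) :
    set 'rV[int]_d :=
  [set v | exists2 s : {nonneg R}, s%:num <= t & w s = v].

(* k-step transition probabilities of discrete-time simple random walk. *)
Fixpoint srw_step (R : realType) (d k : nat) (x y : 'rV[int]_d) : R :=
  if k is k'.+1 then
    (2 * d)%:R^-1 * \sum_(i < d) (srw_step R k' (x + delta_mx 0 i) y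
                                + srw_step R k' (x - delta_mx 0 i) y)
  else (x == y)%:R.

(* Transition function exp(h Q) of the Markov chain whose rate matrix Q has
   Q(x,y) = 1 for adjacent x, y and Q(x,x) = - 2d: during time h there is a
   Poisson(2dh) number of jumps, each of them to a uniform neighbour. *)
Definition heat_kernel (R : realType) (d : nat) (h : R) (x y : 'rV[int]_d) : R :=
  limn [series expR (- ((2 * d)%:R * h)) * ((2 * d)%:R * h) ^+ k / k`!%:R
               * srw_step R k x y]_k.

(* The finite-dimensional distributions determine the law on path_space; the
   case n = 0 says that the walk starts at the origin almost surely. *)
Definition is_srw_law (R : realType) (d : nat)
    (P : probability (path_space R d) R) : Prop :=
  forall (n : nat) (t : nat -> {nonneg R}) (x : nat -> 'rV[int]_d),
    t 0%N = 0%:nng -> (forall i, (t i)%:num <= (t i.+1)%:num) -> x 0%N = 0 ->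
    P [set w | forall i, (i <= n)%N -> path_fun w (t i) = x i] =
    (\prod_(i < n) heat_kernel ((t i.+1)%:num - (t i)%:num) (x i) (x i.+1))%:E.

Definition gibbs_weight (R : realType) (d : nat) (beta t : R)
    (w : path_space R d) : R :=
  expR (- beta * card_set R (inner_boundary (walk_range w t))).

Definition partition_function (R : realType) (d : nat)
    (P : probability (path_space R d) R) (beta t : R) : R :=
  fine ('E_P[gibbs_weight beta t])%E.

Definition gibbs (R : realType) (d : nat)
    (P : probability (path_space R d) R) (beta t : R)
    (A : set (path_space R d)) : \bar R :=
  (\int[P]_(w in A)
     ((partition_function P beta t)^-1 * gibbs_weight beta t w)%:E)%E.

Lemma finite_walk_range (R : realType) (d : nat) (w : walk_path R d) (t : R) :
  finite_set (walk_range w t).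
Proof.
have [rc ll] := path_nn w.
have [t0|t0] := ltP t 0.
  apply: (@sub_finite_set _ _ set0) => // v [s st _].
  by have := le_lt_trans st t0; rewrite ltNge ge0.
pose A := [set a | 0 <= a <= t /\ finite_set (walk_range w a)].
have A0 : A 0.
  split; first by rewrite lexx.
  apply: (@sub_finite_set _ _ [set w 0%:nng]) => // v [s s0 <-] /=.
  by congr (w _); apply/val_inj/le_anti; rewrite /= s0 ge0.
have hA : has_sup A.
  by split; [exists 0|exists t => a [/andP[]]].
have s0 : 0 <= sup A by exact: ub_le_sup hA.2 _ A0.
have st : sup A <= t by apply: ge_sup; [exact: hA.1|move=> a [/andP[]]].
pose s : {nonneg R} := NngNum s0.
have [e e0 we] := rc s.
suff key (u : R) : u < sup A + e -> finite_set (walk_range w u).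
  have [tA|At] := ltP t (sup A + e); first exact: key.
  have e2 : sup A + e / 2 < sup A + e by rewrite ltrD2l ltr_pdivrMr// ltr_pMr// ltr1n.
  have /(ub_le_sup hA.2) : A (sup A + e / 2).
    split; last exact: key.
    by rewrite addr_ge0 ?divr_ge0 ?(ltW e0)// (le_trans (ltW e2)).
  by rewrite leNgt ltrDl divr_gt0.
move=> ue.
have [a Aa [x xa]] : exists2 a, A a & exists x, forall v : {nonneg R},
    a < v%:num < sup A -> w v = x.
  have [sA0|sA0] := leP (sup A) 0.
    exists 0 => //; exists 0 => v /andP[v0 vA].
    by have := lt_le_trans (lt_trans v0 vA) sA0; rewrite ltxx.
  have [e' e'0 [x _ wx]] := ll s sA0.
  have [a Aa ae] := sup_adherent e'0 hA.
  exists a => //; exists x => v /andP[av vA]; apply: wx => /=.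
  by rewrite vA andbT (lt_trans ae).
apply: (@sub_finite_set _ _ (walk_range w a `|` [set x] `|` [set w s])).
  move=> v [r ru <-].
  have [ra|ar] := leP r%:num a; first by left; left; exists r.
  have [rA|Ar] := ltP r%:num (sup A).
    by left; right => /=; apply: xa; rewrite ar.
  by right => /=; apply: we; rewrite /= Ar (le_lt_trans ru).
by rewrite !finite_setU; split => //; split => //; case: Aa.
Qed.

(* Main.v *)
(** Let L = t / r^2 with r = (t / beta)^(1/(d+1)), so that L = beta r^(d-1).
    The partition function is at least exp(-C L): a walk confined to a cube of
    side of order r covers it completely with probability at least
    exp(-C r^(d-1) - C t / r^2).  To see this, the cube is decomposed
    dyadically around its faces.  A sub-cube of side w is covered by brute force,
    with many independent attempts to hit each of its sites, and the cost of
    the sub-cubes, weighted by their distance to the faces, sums to a surface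
    term.  Probabilities of the walk on a fine time grid are handled through
    supersolutions of the discrete heat equation, and the continuous-time
    range is recovered as the mesh tends to zero.

    Conversely, the walk stays in a ball of radius c r with probability at most
    exp(-(C + 1) L) when c is small, and the weight is at most exp(-(C + 1) L)
    when the boundary of the range exceeds (C + 1) r^(d-1).  Discarding both
    events, the diameter is at least c r while the boundary is of order
    r^(d-1), which bounds the volume by isoperimetry, and in dimension two the
    diameter, since every line crossing the range meets its boundary. *)
Require Import Defs.
From mathcomp Require Import all_boot all_order all_algebra finmap.
From mathcomp Require Import all_classical all_reals all_analysis.
From mathcomp Require Import measurable_realfun.
From mathcomp Require Import ring lra zify.
Import Order.TTheory GRing.Theory Num.Theory.
Import numFieldNormedType.Exports.
Local Open Scope classical_set_scope.
Local Open Scope ring_scope.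
Set Implicit Arguments.
Unset Strict Implicit.
Unset Printing Implicit Defensive.

(** * Hitting estimates *)

(** Call cost the logarithm of an inverse probability. A given site of a cube of side w is hit with
    probability at least of order w^(3/2-d): not sharp, but of one form for all d >= 2. Collecting
    the sites of the cube one after another then costs at most of order w^(d-3/2) (log w)^2, which
    is o(w^(d-1)). A Whitney decomposition of a cube of side N has of order (N/w)^(d-1) sub-cubes of
    side w, so each scale contributes N^(d-1) times a factor that decays geometrically in log w.

    Supersolutions stand in for the strong Markov property. The set of sites still to be visited is
    part of the state, and two strategies are chained by taking the bound for the second as terminal
    value of the first. The law of the walk enters only through its finite-dimensional
    distributions.

    Uniformity in beta > beta0 comes from writing t = beta r^(d+1) and measuring every cost in units
    of L: a pure surface term r^(d-1) is at most L / beta0. *)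

Lemma le_expr_of_derive (R : realType) (f df : R -> R) (C : R) (k : nat) :
  0 <= C -> f 0 = 0 ->
  (forall x : R, `|x| <= 2^-1 -> is_derive x (1 : R) f (df x)) ->
  (forall x : R, `|x| <= 2^-1 -> `|df x| <= C * `|x| ^+ k) ->
  forall x : R, `|x| <= 2^-1 -> `|f x| <= C * `|x| ^+ k.+1.
Proof.
move=> C0 f0 fd dfC x x2.
have cont a b : (forall c : R, c \in `[a, b]%R -> `|c| <= 2^-1) ->
    {within `[a, b], continuous f}.
  move=> ab; apply: derivable_within_continuous => c /ab/fd H.
  exact: ex_derive.
have [c cx cE] : exists2 c : R, `|c| <= `|x| & `|f x| = `|df c * x|.
  have [x0|x0] := leP 0 x.
  - have sub c : c \in `[0, x]%R -> `|c| <= `|x|.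
      by rewrite in_itv/= => /andP[c0 cx]; rewrite !ger0_norm.
    have [| |c /sub cx] := @MVT_segment R f df 0 x x0 _ (cont _ _ _).
      move=> c cx; apply: fd; apply: le_trans x2; apply: sub.
      exact: subset_itv_oo_cc.
    - by move=> c /sub cx; apply: le_trans x2.
    by rewrite f0 !subr0 => ->; exists c.
  - have sub c : c \in `[x, 0]%R -> `|c| <= `|x|.
      by rewrite in_itv/= => /andP[c0 cx]; rewrite !ler0_norm ?lerN2// ltW.
    have [| |c /sub cx] := @MVT_segment R f df x 0 (ltW x0) _ (cont _ _ _).
      move=> c cx; apply: fd; apply: le_trans x2; apply: sub.
      exact: subset_itv_oo_cc.
    - by move=> c /sub cx; apply: le_trans x2.
    by rewrite f0 !sub0r mulrN => /oppr_inj ->; exists c.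
rewrite cE normrM exprSr mulrA ler_wpM2r//.
apply: le_trans (dfC _ (le_trans cx x2)) _.
by rewrite ler_wpM2l// lerXn2r// nnegrE.
Qed.

(** [C] bounds the third derivative on [|s| <= 1/2], where [|ln (1 + s)| <= ln 2]. Integrating from
    0 three times, through [f2] and [f1], gives the remainder. *)
Lemma powR_taylor (R : realType) (a : R) : exists2 C : R, 0 <= C &
  forall s : R, `|s| <= 2^-1 ->
    `|(1 + s) `^ a - (1 + a * s + a * (a - 1) / 2 * s ^+ 2)| <= C * `|s| ^+ 3.
Proof.
pose C := `|a * (a - 1) * (a - 2)| * 2 `^ `|a - 3|.
have C0 : 0 <= C by rewrite mulr_ge0// powR_ge0.
exists C => //.
have pd (b s : R) : `|s| <= 2^-1 ->
    is_derive s (1 : R) (fun s => (1 + s) `^ b) (b * (1 + s) `^ (b - 1)).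
  move=> s2; have s0 : 0 < 1 + s by move: s2; rewrite ler_norml; lra.
  rewrite -[X in is_derive _ _ _ X]mulr1.
  apply: (@is_derive1_comp _ (fun x => x `^ b) (fun s : R => 1 + s)).
    exact: is_derive1_powR.
  by rewrite -[X in is_derive _ _ _ X]add0r; apply: is_deriveD.
pose f2 s := a * (a - 1) * ((1 + s) `^ (a - 2) - 1).
have f2d (s : R) : `|s| <= 2^-1 ->
    is_derive s (1 : R) f2 (a * (a - 1) * (a - 2) * (1 + s) `^ (a - 3)).
  move=> s2; have := pd (a - 2) s s2; rewrite (_ : a - 2 - 1 = a - 3); last by ring.
  by move=> H; apply: is_derive_eq; rewrite /GRing.scale/= subr0 mulrA.
have f2C (s : R) : `|s| <= 2^-1 -> `|f2 s| <= C * `|s| ^+ 1.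
  apply: (le_expr_of_derive (k := 0) C0 _ f2d).
    by rewrite /f2 addr0 powR1 subrr mulr0.
  move=> {}s s2; rewrite expr0 mulr1 normrM ler_wpM2l//.
  have s0 : 0 < 1 + s by move: s2; rewrite ler_norml; lra.
  rewrite ger0_norm ?powR_ge0// /powR !gt_eqF// ler_expR.
  apply: le_trans (ler_norm _) _; rewrite normrM ler_wpM2l//.
  rewrite ler_norml; apply/andP; split.
    rewrite -lnV ?posrE// ler_ln ?posrE//; move: s2; rewrite ler_norml; lra.
  rewrite ler_ln ?posrE//; move: s2; rewrite ler_norml; lra.
pose f1 s := a * ((1 + s) `^ (a - 1) - 1 - (a - 1) * s).
have f1d (s : R) : `|s| <= 2^-1 -> is_derive s (1 : R) f1 (f2 s).
  move=> s2; have := pd (a - 1) s s2; rewrite (_ : a - 1 - 1 = a - 2); last by ring.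
  move=> H; apply: is_derive_eq; rewrite /GRing.scale/= /f2; ring.
have f1C (s : R) : `|s| <= 2^-1 -> `|f1 s| <= C * `|s| ^+ 2.
  apply: (le_expr_of_derive (k := 1) C0 _ f1d f2C).
  by rewrite /f1 addr0 powR1 subrr mulr0 subrr mulr0.
apply: (le_expr_of_derive (k := 2) C0 _ _ f1C).
  by rewrite addr0 powR1; ring.
move=> s s2; have := pd a s s2.
move=> H; apply: is_derive_eq; rewrite /GRing.scale/= /f1/=; by field.
Qed.

Definition nrm2 (R : realType) (d : nat) (x : 'rV[int]_d) : R :=
  \sum_(i < d) (x 0 i)%:~R ^+ 2.

Lemma nrm2_ge0 (R : realType) d (x : 'rV[int]_d) : 0 <= nrm2 R x.
Proof. by apply: sumr_ge0 => i _; rewrite sqr_ge0. Qed.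

Lemma coord_le_nrm2 (R : realType) d (x : 'rV[int]_d) i :
  (x 0 i)%:~R ^+ 2 <= nrm2 R x.
Proof.
by rewrite /nrm2 (bigD1 i)//= lerDl sumr_ge0// => j _; rewrite sqr_ge0.
Qed.

Lemma nrm2N (R : realType) d (x : 'rV[int]_d) : nrm2 R (- x) = nrm2 R x.
Proof. by apply: eq_bigr => i _; rewrite mxE rmorphN sqrrN. Qed.

Lemma nrm2D_delta (R : realType) d (x : 'rV[int]_d) i :
  nrm2 R (x + delta_mx 0 i) = nrm2 R x + (1 + 2 * (x 0 i)%:~R).
Proof.
rewrite /nrm2 (bigD1 i)//= [in RHS](bigD1 i)//= !mxE !eqxx/= intrD.
rewrite (eq_bigr (fun j => (x 0 j)%:~R ^+ 2)); first by ring.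
by move=> j ji; rewrite !mxE (negbTE ji) addr0.
Qed.

Lemma nrm2B_delta (R : realType) d (x : 'rV[int]_d) i :
  nrm2 R (x - delta_mx 0 i) = nrm2 R x + (1 - 2 * (x 0 i)%:~R).
Proof.
by rewrite -nrm2N opprB addrC nrm2D_delta nrm2N !mxE rmorphN/= mulrN.
Qed.

(** In the continuum the Laplacian of [|x|^(2a)] is [2a (2a + d - 2) |x|^(2a-2)], the term
    subtracted here. A unit step changes [|x|^2] by a relative amount of order [1/|x|], so the
    Taylor remainder has relative order [|x|^(-3)] against [|x|^(-2)] for the main term. *)
Lemma laplacian_powR (R : realType) (d : nat) (a eps : R) : 0 < eps ->
  exists2 r0 : R, 1 <= r0 & forall x : 'rV[int]_d, r0 <= nrm2 R x ->
    `|\sum_(i < d) (nrm2 R (x + delta_mx 0 i) `^ a + nrm2 R (x - delta_mx 0 i) `^ a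
          - 2 * nrm2 R x `^ a)
       - 4 * a * (a - 1 + d%:R / 2) * nrm2 R x `^ (a - 1)|
      <= eps * nrm2 R x `^ (a - 1).
Proof.
move=> eps0; have [C C0 HC] := powR_taylor a.
pose K := 54 * d%:R * C + `|a * (a - 1)| * d%:R.
have K0 : 0 <= K by rewrite addr_ge0// !mulr_ge0.
have Ke : 0 <= K / eps by rewrite divr_ge0// ltW.
exists ((6 + K / eps) ^+ 2); first by rewrite exprn_ege1//; lra.
move=> x; set r := nrm2 R x => rx.
pose s := Num.sqrt r.
have s6 : 6 + K / eps <= s.
  by rewrite -(ler_pXn2r (ltn0Sn 1)) ?nnegrE ?sqrtr_ge0 ?sqr_sqrtr ?nrm2_ge0//; lra.
have s0 : 0 < s by lra.
have rE : r = s ^+ 2 by rewrite sqr_sqrtr// nrm2_ge0.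
have r0 : 0 < r by rewrite rE exprn_gt0.
have xs i : `|(x 0 i)%:~R : R| <= s.
  by rewrite -sqrtr_sqr ler_wsqrtr// coord_le_nrm2.
pose P (t : R) := 1 + a * t + a * (a - 1) / 2 * t ^+ 2.
have key (t : R) : `|t| <= 3 * s -> `|(r + t) `^ a - r `^ a * P (t / r)| <=
    r `^ a * (27 * C / s ^+ 3).
  move=> ts.
  have tr : `|t / r| <= 3 / s.
    rewrite normrM normfV (gtr0_norm r0) ler_pdivrMr// rE.
    by rewrite (_ : 3 / s * s ^+ 2 = 3 * s)//; field; rewrite gt_eqF.
  have tr2 : `|t / r| <= 2^-1.
    by apply: le_trans tr _; rewrite ler_pdivrMr//; lra.
  have t1 : 0 <= 1 + t / r by move: tr2; rewrite ler_norml; lra.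
  rewrite (_ : r + t = r * (1 + t / r)); last by field; rewrite gt_eqF.
  rewrite powRM// ?(ltW r0)// -mulrBr normrM ger0_norm ?powR_ge0//.
  rewrite ler_wpM2l ?powR_ge0//; apply: le_trans (HC _ tr2) _.
  rewrite (_ : 27 * C / s ^+ 3 = C * (3 / s) ^+ 3); last by field; rewrite gt_eqF.
  by rewrite ler_wpM2l// lerXn2r// nnegrE ?divr_ge0 ?(ltW s0).
pose X i : R := (x 0 i)%:~R.
have Xs i : `|1 + 2 * X i| <= 3 * s /\ `|1 - 2 * X i| <= 3 * s.
  by have := xs i; rewrite -/(X i) !ler_norml => xi; split; lra.
have ra : r `^ (a - 1) = r `^ a / r.
  by rewrite powRB ?powRr1 ?(ltW r0)//; apply/implyP => _; rewrite gt_eqF.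
(* Opposite steps cancel what is odd in [X i], and the squares sum to [r], so the second-order part
   depends on [r] only. *)
have sumE : \sum_(i < d) r `^ a * (P ((1 + 2 * X i) / r) + P ((1 - 2 * X i) / r) - 2)
   = r `^ a * ((2 * a * d%:R + 4 * a * (a - 1)) / r + a * (a - 1) * d%:R / r ^+ 2).
  rewrite -mulr_sumr; congr (_ * _).
  rewrite (eq_bigr (fun i => (2 * a / r + a * (a - 1) / r ^+ 2)
      + (4 * a * (a - 1) / r ^+ 2) * X i ^+ 2)); last first.
    by move=> i _; rewrite /P; field; rewrite gt_eqF.
  rewrite big_split/= sumr_const card_ord -mulr_sumr.
  rewrite (_ : \sum_(i < d) X i ^+ 2 = r)// -mulr_natr.
  by field; rewrite gt_eqF.
rewrite (_ : (\sum_(i < d) _ - _) =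
  \sum_(i < d) (((r + (1 + 2 * X i)) `^ a - r `^ a * P ((1 + 2 * X i) / r)) +
     ((r + (1 - 2 * X i)) `^ a - r `^ a * P ((1 - 2 * X i) / r)))
  + r `^ a * (a * (a - 1) * d%:R / r ^+ 2)); last first.
  apply/eqP; rewrite subr_eq; apply/eqP.
  rewrite (eq_bigr (fun i => ((r + (1 + 2 * X i)) `^ a - r `^ a * P ((1 + 2 * X i) / r) +
     ((r + (1 - 2 * X i)) `^ a - r `^ a * P ((1 - 2 * X i) / r))) +
     r `^ a * (P ((1 + 2 * X i) / r) + P ((1 - 2 * X i) / r) - 2))); last first.
    by move=> i _; rewrite nrm2D_delta nrm2B_delta -/r -/(X i); ring.
  rewrite big_split/= sumE ra -!addrA; congr (_ + _).
  by field; rewrite gt_eqF.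
apply: le_trans (ler_normD _ _) _.
have -> : eps * r `^ (a - 1) = r `^ a * (eps / r) by rewrite ra; ring.
apply: (@le_trans _ _ (r `^ a * (54 * d%:R * C / s ^+ 3) +
   r `^ a * (`|a * (a - 1)| * d%:R / r ^+ 2))).
  apply: lerD.
    apply: le_trans (ler_norm_sum _ _ _) _.
    rewrite (_ : r `^ a * _ = \sum_(i < d) (r `^ a * (27 * C / s ^+ 3) *+ 2)).
      apply: ler_sum => i _; apply: le_trans (ler_normD _ _) _.
      by rewrite mulr2n lerD// key//; case: (Xs i).
    rewrite sumr_const card_ord -mulr_natr -[in RHS]mulr_natr.
    by field; rewrite gt_eqF.
  rewrite normrM (ger0_norm (powR_ge0 _ _)) ler_wpM2l ?powR_ge0//.
  by rewrite !normrM !normfV normrX (gtr0_norm r0) normr_nat.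
rewrite -mulrDr ler_wpM2l ?powR_ge0//.
apply: (@le_trans _ _ (K / s ^+ 3)).
  rewrite /K [leRHS]mulrDl lerD2l ler_wpM2l ?mulr_ge0//.
  rewrite rE -exprM lef_pV2 ?posrE ?exprn_gt0// ler_eXn2l//; lra.
rewrite rE ler_pdivrMr ?exprn_gt0// (_ : eps / s ^+ 2 * s ^+ 3 = eps * s).
  by rewrite mulrC -ler_pdivrMr//; lra.
by field; rewrite gt_eqF.
Qed.

(** * Supersolutions of the lazy nearest-neighbour walk *)

Definition nnstep (R : realType) (d : nat) (eta : R) (f : 'rV[int]_d -> R) x :=
  (1 - 2 * d%:R * eta) * f x
  + eta * \sum_(i < d) (f (x + delta_mx 0 i) + f (x - delta_mx 0 i)).

Lemma le_nnstep (R : realType) (d : nat) (eta : R) (f g : 'rV[int]_d -> R) x :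
  0 <= eta -> 2 * d%:R * eta <= 1 ->
  f x <= g x ->
  (forall i, f (x + delta_mx 0 i) <= g (x + delta_mx 0 i)) ->
  (forall i, f (x - delta_mx 0 i) <= g (x - delta_mx 0 i)) ->
  nnstep eta f x <= nnstep eta g x.
Proof.
move=> e0 e1 fg fgD fgB; rewrite lerD// ler_wpM2l ?subr_ge0//.
by apply: ler_sum => i _; rewrite lerD.
Qed.

Lemma nnstepE (R : realType) (d : nat) (eta : R) (f : 'rV[int]_d -> R) x :
  nnstep eta f x = f x + eta *
    \sum_(i < d) (f (x + delta_mx 0 i) + f (x - delta_mx 0 i) - 2 * f x).
Proof.
rewrite /nnstep [in RHS]big_split/= sumr_const card_ord -mulr_natr.
by ring.
Qed.

(* [u n x Y] is thought of as the probability that a walk at [x], with the set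
   [Y] still to be visited, succeeds within [n] steps. *)
Definition supersolution (R : realType) (d : nat) (G : set 'rV[int]_d) (eta : R)
    (u : nat -> 'rV[int]_d -> set 'rV[int]_d -> R) :=
  [/\ forall n x Y, 0 <= u n x Y,
      forall n x Y, u n x (Y `\ x) <= u n x Y &
      forall n x Y, G x -> nnstep eta (fun z => u n z (Y `\ x)) x <= u n.+1 x Y].

Lemma supersolutionS (R : realType) (d : nat) (G G' : set 'rV[int]_d) (eta : R) u :
  G' `<=` G -> supersolution G eta u -> supersolution G' eta u.
Proof. by move=> GG [u0 u1 u2]; split => // n x Y /GG; exact: u2. Qed.

(** The lazy walk waits at [x] until its first jump, which goes to [x'] with probability 1/(2d).
    Within unit time the jump has occurred with probability at least 1/2, as [exp (- 2d) <= 1/2].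
    Waiting is harmless because the bound at [x'] is uniform over subsets of [Y] and over all
    [n >= n2]. *)
Lemma hit_neighbour (R : realType) (d : nat) (G : set 'rV[int]_d) (eta : R) u
    (Y : set 'rV[int]_d) (a : R) (n2 n1 : nat) (x x' : 'rV[int]_d) :
  (0 < d)%N -> 0 <= eta -> 2 * d%:R * eta <= 1 -> supersolution G eta u ->
  0 <= a -> G x ->
  (exists i, x' = x + delta_mx 0 i \/ x' = x - delta_mx 0 i) ->
  (forall Y' n, Y' `<=` Y -> (n2 <= n)%N -> a <= u n x' Y') ->
  1 <= n1%:R * eta ->
  forall Y' n, Y' `<=` Y -> (n2 + n1 <= n)%N -> a / (4 * d%:R) <= u n x Y'.
Proof.
move=> d0 e0 e1 [u0 _ u2] a0 Gx [i xx'] H n1e.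
have d0R : 1 <= d%:R :> R by rewrite ler1n.
pose b := 1 - 2 * d%:R * eta.
have b0 : 0 <= b by rewrite subr_ge0.
have claim k n Y' : (n2 <= n)%N -> Y' `<=` Y ->
    a * (1 - b ^+ k) / (2 * d%:R) <= u (n + k)%N x Y'.
  elim: k n Y' => [|k IH] n Y' n2n Y'Y; first by rewrite expr0 subrr mulr0 mul0r.
  have Y'xY : Y' `\ x `<=` Y by apply: subset_trans Y'Y; exact: subDsetl.
  rewrite addnS; apply: le_trans (u2 (n + k)%N x Y' Gx).
  have IHk := IH n (Y' `\ x) n2n Y'xY.
  have Hx' := H (Y' `\ x) (n + k)%N Y'xY (leq_trans n2n (leq_addr _ _)).
  apply: (@le_trans _ _ (b * (a * (1 - b ^+ k) / (2 * d%:R)) + eta * a)).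
    have -> : eta * a = (1 - b) / (2 * d%:R) * a.
      by rewrite /b; field; rewrite gt_eqF//; lra.
    rewrite exprS le_eqVlt; apply/orP; left; apply/eqP.
    by field; rewrite gt_eqF//; lra.
  rewrite lerD ?ler_wpM2l//.
  have sum0 : 0 <= \sum_(j < d | j != i)
     (u (n + k)%N (x + delta_mx 0 j) (Y' `\ x) + u (n + k)%N (x - delta_mx 0 j) (Y' `\ x)).
    by apply: sumr_ge0 => j _; rewrite addr_ge0.
  rewrite (bigD1 i)//=; apply: le_trans Hx' _.
  have := u0 (n + k)%N (x + delta_mx 0 i) (Y' `\ x).
  have := u0 (n + k)%N (x - delta_mx 0 i) (Y' `\ x).
  by case: xx' => ->; lra.
move=> Y' n Y'Y nn.
have nn2 : (n2 <= n - n1)%N by rewrite leq_subRL ?(leq_trans (leq_addl _ _) nn)// addnC.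
have := claim n1 (n - n1)%N Y' nn2 Y'Y.
rewrite subnK ?(leq_trans (leq_addl _ _) nn)//; apply: le_trans.
have bn : b ^+ n1 <= 2^-1.
  apply: (@le_trans _ _ (expR (- (2 * d%:R * eta)) ^+ n1)).
    by rewrite lerXn2r// ?nnegrE ?expR_ge0// /b; exact: expR_ge1Dx.
  rewrite -expRM_natl mulrN expRN lef_pV2 ?posrE ?expR_gt0//.
  apply: le_trans (expR_ge1Dx _); rewrite (_ : n1%:R * _ = 2 * d%:R * (n1%:R * eta)).
    by nra.
  by ring.
rewrite -mulrA ler_wpM2l// (_ : (4 * d%:R)^-1 = 2^-1 / (2 * d%:R)).
  by rewrite ler_wpM2r ?invr_ge0//; lra.
by field; rewrite gt_eqF//; lra.
Qed.

Lemma nrm2_natr (R : realType) d (x : 'rV[int]_d) :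
  nrm2 R x = (\sum_(i < d) absz (x 0%R i) ^ 2)%N%:R.
Proof.
rewrite natr_sum; apply: eq_bigr => i _.
by rewrite natrX; case: (x 0 i) => n //; rewrite NegzE abszN rmorphN sqrrN.
Qed.

Definition nrm1 d (x : 'rV[int]_d) : nat := (\sum_(i < d) absz (x 0%R i))%N.

Lemma nrm1_le_nrm2 (R : realType) d (x : 'rV[int]_d) : (nrm1 x)%:R <= nrm2 R x.
Proof.
rewrite nrm2_natr ler_nat leq_sum// => i _.
by case: (absz (x 0 i)) => // k; rewrite -mulnn leq_pmulr.
Qed.

Lemma nrm1_gt0_step (R : realType) d (x : 'rV[int]_d) k : nrm1 x = k.+1 ->
  exists x', [/\ exists i, x' = x + delta_mx 0 i \/ x' = x - delta_mx 0 i,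
    nrm1 x' = k, nrm2 R x' <= nrm2 R x &
    forall j, (0 <= x' 0 j <= x 0 j) || (x 0 j <= x' 0 j <= 0)].
Proof.
move=> xk.
have [i xi] : exists i, x 0 i != 0.
  apply/existsP; apply: contraPT (xk) => /existsPn xi.
  by rewrite /nrm1 big1// => i _; have := xi i; rewrite negbK => /eqP ->.
have nrm1S (y : 'rV[int]_d) : (forall j, j != i -> y 0 j = x 0 j) ->
    absz (x 0 i) = (absz (y 0 i)).+1 -> nrm1 y = k.
  move=> yx yi; apply: succn_inj; rewrite -xk /nrm1 [in RHS](bigD1 i)//= (bigD1 i)//=.
  by rewrite yi addSn; congr (_ + _).+1; apply: eq_bigr => j /yx ->.
case: (ltgtP (x 0 i) 0) => [xi0|xi0|xi0]; last by rewrite xi0 eqxx in xi.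
- exists (x + delta_mx 0 i); split; first by exists i; left.
  + apply: nrm1S => [j ji|]; first by rewrite !mxE (negbTE ji) addr0.
    by rewrite !mxE !eqxx/=; lia.
  + rewrite nrm2D_delta gerDl.
    have : (x 0 i)%:~R <= (-1)%:~R :> R by rewrite ler_int; lia.
    by rewrite rmorphN1; lra.
  + move=> j; rewrite !mxE eqxx/=; have [->|ji] := eqVneq j i; last first.
      by rewrite addr0 !lexx !andbT /=; exact: le_total.
    by rewrite mulr1n lerDl ler01; apply/orP; right; lia.
- exists (x - delta_mx 0 i); split; first by exists i; right.
  + apply: nrm1S => [j ji|]; first by rewrite !mxE (negbTE ji) subr0.
    by rewrite !mxE !eqxx/=; lia.
  + rewrite nrm2B_delta gerDl.
    have : 1%:~R <= (x 0 i)%:~R :> R by rewrite ler_int; lia.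
    by rewrite rmorph1; lra.
  + move=> j; rewrite !mxE eqxx/=; have [->|ji] := eqVneq j i; last first.
      by rewrite subr0 !lexx !andbT /=; exact: le_total.
    by rewrite mulr1n gerBl ler01 andbT subr_ge0; apply/orP; left; lia.
Qed.

Lemma hit_path (R : realType) (d : nat) (G : set 'rV[int]_d) (eta : R) u
    (Y : set 'rV[int]_d) (a : R) (n2 n1 : nat) (y : 'rV[int]_d) :
  (0 < d)%N -> 0 <= eta -> 2 * d%:R * eta <= 1 -> supersolution G eta u ->
  0 <= a -> 1 <= n1%:R * eta ->
  (forall Y' n, Y' `<=` Y `\ y -> (n2 <= n)%N -> a <= u n y Y') ->
  forall k z, nrm1 z = k -> (forall z', nrm2 R z' <= nrm2 R z -> G (y + z')) ->
  forall Y' n, Y' `<=` Y -> (n2 + k * n1 <= n)%N -> a / (4 * d%:R) ^+ k <= u n (y + z) Y'.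
Proof.
move=> d0 e0 e1 su a0 n1e H; elim=> [|k IH] z zk Gz Y' n Y'Y nn.
  have [u0 u1 _] := su.
  have -> : z = 0.
    apply/rowP => i; move/eqP: zk; rewrite /nrm1 sum_nat_eq0 => /forallP/(_ i).
    by rewrite mxE /= absz_eq0 => /eqP.
  rewrite addr0 expr0 divr1; apply: le_trans (u1 _ _ _); apply: H.
    by apply: setSD.
  by rewrite addn0 in nn.
have [z' [zz' z'k z'z _]] := nrm1_gt0_step R zk.
have := @hit_neighbour R d G eta u Y (a / (4 * d%:R) ^+ k) (n2 + k * n1) n1 (y + z) (y + z')
  d0 e0 e1 su _ _ _ _ n1e Y' n Y'Y.
rewrite (_ : a / (4 * d%:R) ^+ k.+1 = a / (4 * d%:R) ^+ k / (4 * d%:R)); last first.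
  by rewrite exprSr [X in a * X]invfM mulrA.
apply.
- by rewrite divr_ge0// exprn_ge0// mulr_ge0.
- exact: Gz.
- by have [i zi] := zz'; exists i; rewrite -!addrA; case: zi => ->; [left|right].
- by move=> Y'' m Y''Y mm; apply: IH => // z'' z''z'; apply: Gz; apply: le_trans z'z.
- by rewrite -addnA -mulSnr.
Qed.

(** Division by [a] makes the gap nonnegative for either sign of [a]; the exponent used below is 7/4
    - d/2, whose sign depends on the dimension. *)
Lemma powR_concave_gap (R : realType) (a r M : R) : a != 0 -> a <= 1 -> 0 < r <= M ->
  0 <= (M `^ a - r `^ a) / a <= M * r `^ (a - 1).
Proof.
move=> a0 a1 /andP[r0 rM].
have [||c + ->] := @MVT_segment R (fun x => x `^ a) (fun x => a * x `^ (a - 1)) r M rM.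
- move=> x; rewrite in_itv/= => /andP[rx _]; apply: is_derive1_powR.
  exact: lt_trans rx.
- apply: derivable_within_continuous => x; rewrite in_itv/= => /andP[rx _].
  have := is_derive1_powR a (lt_le_trans r0 rx) => H; exact: ex_derive.
rewrite in_itv/= => /andP[rc cM].
rewrite (_ : a * c `^ (a - 1) * (M - r) / a = c `^ (a - 1) * (M - r)); last by field.
rewrite mulr_ge0 ?powR_ge0 ?subr_ge0//= mulrC ler_pM ?powR_ge0 ?subr_ge0//.
  by rewrite gerBl ltW.
rewrite -opprB !powRN lef_pV2 ?posrE ?powR_gt0//; last exact: lt_le_trans rc.
by rewrite ge0_ler_powR ?subr_ge0// nnegrE ltW// (lt_le_trans r0).
Qed.

Lemma nat_ceil_div (R : realType) (eta T : R) : 0 < eta -> 0 <= T ->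
  exists n : nat, T <= n%:R * eta <= T + eta.
Proof.
move=> e0 T0; have Te : 0 <= T / eta by rewrite divr_ge0// ltW.
exists (Num.truncn (T / eta)).+1; have /andP[h1 h2] := truncn_itv Te.
rewrite -ler_pdivrMr// ltW//= -natr1 mulrDl mul1r lerD2r.
by rewrite -ler_pdivlMr.
Qed.

(* With [p = d/2 - 3/4], the function [|z|^(-2p)] is subharmonic away from the
   origin and still decays more slowly than [|z|^(1-d)]; the subsolution
   [(s v - k) / T], with [Delta v >= 0] and [- Delta k >= v], is the Markov
   bound [P(tau <= s) >= P(tau < oo) - E[tau; tau < oo] / s] in disguise. *)
Definition hit_exponent (R : realType) (d : nat) : R := d%:R / 2 - 3 / 4.

Lemma hit_estimate (R : realType) (d : nat) : (2 <= d)%N ->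
  exists q0 K : R, [/\ 0 < q0 <= 1, 0 < K &
  forall (G : set 'rV[int]_d) (eta : R) u Y (a : R) (n2 n0 : nat) (y x : 'rV[int]_d) (l : R),
    0 < eta -> 2 * d%:R * eta <= 1 -> 1 <= l ->
    (forall z, nrm2 R (z - y) < 4 * l ^+ 2 -> G z) -> nrm2 R (x - y) <= l ^+ 2 ->
    supersolution G eta u -> 0 <= a ->
    (forall Y' n, Y' `<=` Y `\ y -> (n2 <= n)%N -> a <= u n y Y') ->
    K * l ^+ 2 <= n0%:R * eta ->
    forall Y' n, Y' `<=` Y -> (n2 + n0 <= n)%N ->
      a * (q0 * (l ^+ 2) `^ (- hit_exponent R d)) <= u n x Y'].
Proof.
move=> d2; pose p := hit_exponent R d; pose b := 1 - p.
have d2R : 2 <= d%:R :> R by rewrite (ler_nat _ 2).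
have p0 : 0 < p by rewrite /p /hit_exponent; lra.
have b0 : b != 0.
  apply/negP => /eqP; rewrite /b /p /hit_exponent => bE.
  have : (2 * d)%:R = 7%:R :> R by rewrite natrM; lra.
  by move/eqP; rewrite eqr_nat => /eqP; lia.
(* The leading coefficients are [4 (-p) (-p - 1 + d/2) = p] and [4 b (b - 1 + d/2) = 3 b].
   Tolerances [p] and [|b|] therefore keep the first Laplacian nonnegative and the second one,
   divided by [b], at least [|z|^(-2p)]. *)
have [r1 r1_ge1 H1] := @laplacian_powR R d (- p) p p0.
have b0' : 0 < `|b| by rewrite normr_gt0.
have [r2 r2_ge1 H2] := @laplacian_powR R d b _ b0'.
pose r0 := Num.max 4 (Num.max r1 r2).
have r0_4 : 4 <= r0 by rewrite le_max lexx.
have r0_1 : r1 <= r0 by rewrite !le_max lexx orbT.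
have r0_2 : r2 <= r0 by rewrite !le_max lexx !orbT.
pose M0 := (Num.truncn r0).+1.
have rM0 : r0 <= M0%:R by apply/ltW; have /andP[] := truncn_itv (le_trans (ler0n _ 4) r0_4).
(* For [|z| <= l], subtracting [(4 l^2)^(-p)] from [|z|^(-2p)] leaves at least the fraction [g4] of
   it; [T0] is chosen so that the time correction [kk / T] removes at most half of what is left. *)
pose g4 := 1 - 4 `^ (- p) : R.
have g40 : 0 < g4.
  rewrite subr_gt0 powRN invf_lt1 ?powR_gt0// -[ltLHS](powRr0 4).
  by rewrite /powR gt_eqF// ltr_expR ltr_pM2r// ln_gt0//; lra.
have g41 : g4 <= 1 by rewrite gerBl powR_ge0.
pose T0 := 32 / g4.
have T00 : 0 < T0 by rewrite divr_gt0.
have D4 : 1 <= (4 * d%:R : R) by lra.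
have D40 : 0 < (4 * d%:R : R) ^+ M0 by rewrite exprn_gt0//; lra.
exists (g4 / 2 / (4 * d%:R) ^+ M0), (2 * M0%:R + T0); split.
- rewrite divr_gt0 ?divr_gt0//= ler_pdivrMr// mul1r.
  by apply: le_trans (exprn_ege1 M0 D4); lra.
- by rewrite addr_gt0// mulr_gt0// ltr0n.
move=> G eta u Y a n2 n0 y x l e0 e1 l1 Gy xl su a0 Hy n0K Y' n Y'Y nn.
have [u0 u1 u2] := su.
have e1' : eta <= 1 by move: d2R e1 e0; clear; nra.
have l21 : 1 <= l ^+ 2 by rewrite exprn_ege1.
have [n1 /andP[n1e n1e2]] := nat_ceil_div e0 (ler01 : 0 <= (1 : R)).
have n1M : (M0 * n1)%:R * eta <= 2 * M0%:R.
  by rewrite natrM -mulrA mulrC ler_wpM2r//; lra.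
have Kl : (2 * M0%:R + T0) * l ^+ 2 <= n0%:R * eta := n0K.
have M00 : 0 <= M0%:R :> R by [].
have kn0 : (M0 * n1 <= n0)%N.
  rewrite -(ler_nat R) -(ler_pM2r e0); apply: le_trans n0K; move: Kl n1M M00 l21 T00; clear; nra.
pose k0 := (n0 - M0 * n1)%N.
have k0T : T0 * l ^+ 2 <= k0%:R * eta.
  rewrite natrB// mulrBl; move: Kl n1M M00 l21; clear; nra.
pose a' := a / (4 * d%:R) ^+ M0.
have a'0 : 0 <= a' by rewrite divr_ge0// ltW.
(* The Laplacian estimates fail near the origin; there the walk is forced along a path of at most
   [M0] steps, at the price of a constant factor. *)
have near z : nrm2 R z <= r0 -> nrm2 R z < 4 * l ^+ 2 ->
    forall Z m, Z `<=` Y -> (n2 + M0 * n1 <= m)%N -> a' <= u m (y + z) Z.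
  move=> zr zl Z m ZY mm.
  have zM : (nrm1 z <= M0)%N.
    by rewrite -(ler_nat R); apply: le_trans (nrm1_le_nrm2 R z) (le_trans zr rM0).
  apply: (@le_trans _ _ (a / (4 * d%:R) ^+ nrm1 z)).
    have D0 : 0 < (4 * d%:R : R) by exact: lt_le_trans D4.
    by apply: ler_wpM2l => //; rewrite lef_pV2 ?posrE ?exprn_gt0// ler_weXn2l.
  apply: (@hit_path R d G eta u Y a n2 n1 y _ _ e1 su a0 n1e Hy _ z) => //.
  - exact: leq_trans d2.
  - exact: ltW.
  - by move=> z' z'z; apply: Gy; rewrite addrAC subrr add0r; apply: le_lt_trans zl.
  - apply: leq_trans mm; rewrite leq_add2l leq_mul2r zM orbT//.
pose z0 := x - y; have xE : x = y + z0 by rewrite /z0 addrC subrK.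
have lp1 : (l ^+ 2) `^ (- p) <= 1.
  by rewrite powRN invf_le1 ?powR_gt0 ?(lt_le_trans ltr01)// -(powRr0 (l ^+ 2)) ler_powR// ltW.
have [z0r|z0r] := leP (nrm2 R z0) r0.
  have z0l : nrm2 R z0 < 4 * l ^+ 2 by apply: le_lt_trans xl _; move: l21; clear; lra.
  have := near _ z0r z0l Y' n Y'Y; rewrite -xE => /(_ _) H.
  apply: le_trans (H _); last first.
    by apply: leq_trans nn; rewrite leq_add2l.
  rewrite -/p /a' [g4 / 2 / _]mulrC !mulrA -[leRHS]mulr1 -!mulrA ler_wpM2l//.
  rewrite ler_wpM2l ?invr_ge0 ?(ltW D40)//.
  move: (powR_ge0 (l ^+ 2) (- p)) lp1 g40 g41; clear; nra.
pose Rr := 4 * l ^+ 2; pose MM := 4 * Rr.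
have lr : r0 < l ^+ 2 by apply: lt_le_trans xl.
pose v (z : 'rV[int]_d) := nrm2 R z `^ (- p) - Rr `^ (- p).
pose kk (z : 'rV[int]_d) := (MM `^ b - nrm2 R z `^ b) / b.
pose T := k0%:R * eta.
have Tl : T0 * l ^+ 2 <= T by [].
have T_gt0 : 0 < T by apply: lt_le_trans Tl; rewrite mulr_gt0// (lt_le_trans ltr01 l21).
pose f k z := (k%:R * eta * v z - kk z) / T.
have bp : b - 1 = - p by rewrite /b; ring.
have b1 : b <= 1 by rewrite /b gerBl ltW.
have kk_bound z : 1 <= nrm2 R z <= MM -> 0 <= kk z <= MM * nrm2 R z `^ (- p).
  move=> /andP[z1 zM]; rewrite -bp; apply: powR_concave_gap => //.
  by rewrite zM andbT (lt_le_trans ltr01 z1).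
have Rr1 : 4 <= Rr by rewrite /Rr -[leLHS]mulr1 ler_wpM2l.
have mono s t : 0 < s -> s <= t -> t `^ (- p) <= s `^ (- p).
  move=> s0 st; have t0 : 0 < t := lt_le_trans s0 st.
  rewrite !powRN lef_pV2 ?posrE ?powR_gt0//.
  by apply: ge0_ler_powR; rewrite ?nnegrE// ltW.
have claim k : (k <= k0)%N -> forall z, 1 <= nrm2 R z <= MM ->
    forall Z m, Z `<=` Y -> (n2 + M0 * n1 <= m)%N -> a' * f k z <= u (m + k)%N (y + z) Z.
  elim: k => [|k IH] kk0 z zb Z m ZY mm.
    have /andP[kz _] := kk_bound _ zb.
    apply: le_trans (u0 _ _ _); rewrite mulr_ge0_le0// /f mul0r mul0r sub0r.
    by rewrite mulNr oppr_le0 divr_ge0// ltW.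
  have /andP[kz _] := kk_bound _ zb; have /andP[z1 zM] := zb.
  have [zR|zR] := leP Rr (nrm2 R z).
    apply: le_trans (u0 _ _ _); rewrite mulr_ge0_le0// /f ler_pdivrMr// mul0r.
    rewrite subr_le0; apply: le_trans kz; rewrite mulr_ge0_le0//.
      by rewrite mulr_ge0// ltW.
    by rewrite subr_le0; apply: mono => //; apply: lt_le_trans Rr1.
  have [zr|zr] := leP (nrm2 R z) r0.
    apply: le_trans (near z zr zR Z (m + k.+1)%N ZY (leq_trans mm (leq_addr _ _))).
    rewrite -[leRHS]mulr1 ler_wpM2l// ler_pdivrMr// mul1r lerBlDr.
    have v1 : v z <= 1.
      have : nrm2 R z `^ (- p) <= 1 `^ (- p) by exact: mono.
      rewrite powR1 /v => zp; rewrite lerBlDr (le_trans zp)// lerDl.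
      exact: powR_ge0.
    have kT : k.+1%:R * eta <= T by rewrite ler_wpM2r ?ler_nat// ltW.
    have [v0|v0] := leP 0 (v z); last first.
      apply: (@le_trans _ _ 0); last by rewrite addr_ge0// ltW.
      by rewrite mulr_ge0_le0 ?(ltW v0)// mulr_ge0// ltW.
    apply: (@le_trans _ _ (T * 1)); last by rewrite mulr1 lerDl.
    by rewrite ler_pM// mulr_ge0// ltW.
  have Gyz : G (y + z) by apply: Gy; rewrite addrAC subrr add0r.
  rewrite addnS; apply: le_trans (u2 (m + k)%N (y + z) Z Gyz).
  have s0 : 2 <= Num.sqrt (nrm2 R z).
    rewrite -(ler_pXn2r (ltn0Sn 1)) ?nnegrE ?sqrtr_ge0 ?sqr_sqrtr ?nrm2_ge0//.
    by move: zr r0_4; clear; lra.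
  have nb (t : int) : t%:~R ^+ 2 <= nrm2 R z ->
      1 <= nrm2 R z + (1 + 2 * t%:~R) <= MM.
    have := sqr_sqrtr (nrm2_ge0 R z); move: s0; set s := Num.sqrt _ => s2 sE.
    rewrite -sE => ts; have : `|t%:~R| <= s.
      by rewrite -(ler_pXn2r (ltn0Sn 1)) ?nnegrE ?real_normK ?num_real// (le_trans _ s2).
    by move: zR; rewrite -sE /MM ler_norml; clear -s2 Rr1; nra.
  have nbD i : 1 <= nrm2 R (z + delta_mx 0 i) <= MM.
    by rewrite nrm2D_delta; apply: nb; exact: coord_le_nrm2.
  have nbB i : 1 <= nrm2 R (z - delta_mx 0 i) <= MM.
    have := nb (- z 0 i); rewrite rmorphN/= mulrN sqrrN -nrm2B_delta; apply.
    exact: coord_le_nrm2.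
  have ZxY : Z `\ (y + z) `<=` Y by apply: subset_trans ZY; exact: subDsetl.
  have := @le_nnstep R d eta (fun w => a' * f k (w - y))
    (fun w => u (m + k)%N w (Z `\ (y + z))) (y + z) (ltW e0) e1.
  have zE w : y + z + w - y = z + w by rewrite addrAC (addrC y) addrK.
  rewrite addrAC subrr add0r => step; apply: le_trans (step _ _ _); last 3 first.
  - exact: (IH (ltnW kk0)).
  - by move=> i; rewrite zE -addrA; exact: (IH (ltnW kk0)).
  - by move=> i; rewrite zE -addrA; exact: (IH (ltnW kk0)).
  (* What remains is the heat inequality for [f]: its time derivative [v / T] is at most its
     Laplacian, which is at least [|z|^(-2p) / T]. *)
  pose S1 := \sum_(i < d) (nrm2 R (z + delta_mx 0 i) `^ (- p)
    + nrm2 R (z - delta_mx 0 i) `^ (- p) - 2 * nrm2 R z `^ (- p)).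
  pose S2 := \sum_(i < d) (nrm2 R (z + delta_mx 0 i) `^ b
    + nrm2 R (z - delta_mx 0 i) `^ b - 2 * nrm2 R z `^ b).
  have -> : nnstep eta (fun w => a' * f k (w - y)) (y + z) =
      a' * (f k z + eta * ((k%:R * eta * S1 + S2 / b) / T)).
    rewrite nnstepE addrAC subrr add0r mulrDr; congr (_ + _).
    rewrite [RHS]mulrCA; congr (_ * _).
    rewrite /S1 /S2 [k%:R * eta * _]mulr_sumr [_ / b]mulr_suml -big_split/= mulr_suml mulr_sumr.
    apply: eq_bigr => i _; rewrite !zE /f /v /kk.
    have T1 : T != 0 by rewrite gt_eqF.
    move: (nrm2 R (z + delta_mx 0 i) `^ (- p)) (nrm2 R (z - delta_mx 0 i) `^ (- p)) (nrm2 R z `^ (- p))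
      (nrm2 R (z + delta_mx 0 i) `^ b) (nrm2 R (z - delta_mx 0 i) `^ b) (nrm2 R z `^ b)
      (Rr `^ (- p)) (MM `^ b) (T) (a') (k%:R : R) T1.
    by move: (b) b0; clear => {}b b0 ? ? ? ? ? ? ? ? {}T ? ? T0; field; rewrite ?b0 ?T0.
  rewrite ler_wpM2l//.
  have -> : f k.+1 z = f k z + eta * (v z / T).
    by rewrite /f -natr1; field; rewrite gt_eqF.
  rewrite lerD2l ler_wpM2l ?(ltW e0)// ler_wpM2r ?invr_ge0 ?(ltW T_gt0)//.
  have S1_ge0 : 0 <= S1.
    have := H1 z (le_trans r0_1 (ltW zr)); rewrite -/S1 ler_norml => /andP[+ _].
    rewrite (_ : 4 * - p * (- p - 1 + d%:R / 2) = p).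
      by rewrite lerBrDr addNr.
    by rewrite /p /hit_exponent; field.
  have S2_ge : nrm2 R z `^ (- p) <= S2 / b.
    have := H2 z (le_trans r0_2 (ltW zr)); rewrite -/S2 bp.
    rewrite (_ : 4 * b * (- p + d%:R / 2) = 3 * b); last first.
      by rewrite /p /hit_exponent; field.
    move: (nrm2 R z `^ (- p)) (powR_ge0 (nrm2 R z) (- p)) => w w0 H.
    have : `|S2 / b - 3 * w| <= w.
      rewrite -(ler_pM2l (_ : 0 < `|b|)) ?normr_gt0// -normrM mulrBr mulrCA mulfV// mulr1.
      by rewrite mulrA (mulrC b).
    rewrite ler_norml; suff aux (A B : R) : - B <= A - 3 * B <= B -> B <= A by exact: aux.
    by clear; lra.
  have kS : 0 <= k%:R * eta * S1 by rewrite !mulr_ge0// ltW.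
  apply: (@le_trans _ _ (nrm2 R z `^ (- p))); last by rewrite (le_trans S2_ge)// lerDr.
  by rewrite gerBl powR_ge0.
have nk0 : (n2 + M0 * n1 <= n - k0)%N.
  by move: nn; rewrite /k0; move: kn0; clear; lia.
have z01 : 1 <= nrm2 R z0 by move: z0r r0_4; clear; lra.
have z0M : nrm2 R z0 <= MM by move: xl l21; rewrite -/z0 /MM /Rr; clear; lra.
have := claim k0 (leqnn _) z0 _ Y' (n - k0)%N Y'Y nk0.
rewrite z01 z0M => /(_ isT).
rewrite subnK; last by move: nn; rewrite /k0; clear; lia.
rewrite -xE; apply: le_trans.
rewrite -/p /a' (_ : a * _ = a / (4 * d%:R) ^+ M0 * (g4 / 2 * (l ^+ 2) `^ (- p))); last first.
  by field; rewrite gt_eqF//; lra.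
rewrite ler_wpM2l//.
have lz : (l ^+ 2) `^ (- p) <= nrm2 R z0 `^ (- p).
  by apply: mono => //; exact: lt_le_trans z01.
have vz : g4 * nrm2 R z0 `^ (- p) <= v z0.
  rewrite /g4 /v mulrBl mul1r lerD2l lerN2 /Rr powRM//; last by lra.
  by rewrite ler_wpM2l ?powR_ge0.
have /andP[_ kz] := kk_bound z0 (introT andP (conj z01 z0M)).
have fE : f k0 z0 = v z0 - kk z0 / T.
  by rewrite /f -/T; field; rewrite gt_eqF.
have kT : kk z0 / T <= g4 / 2 * nrm2 R z0 `^ (- p).
  rewrite ler_pdivrMr//; apply: le_trans kz _.
  rewrite [leRHS]mulrAC; apply: ler_wpM2r; first exact: powR_ge0.
  rewrite /MM /Rr; apply: le_trans (_ : g4 / 2 * (T0 * l ^+ 2) <= _); last first.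
    by rewrite ler_wpM2l// divr_ge0// ltW.
  by rewrite /T0 le_eqVlt; apply/orP; left; apply/eqP; field; rewrite gt_eqF.
rewrite fE; have g40' := ltW g40.
have : g4 / 2 * (l ^+ 2) `^ (- p) <= g4 / 2 * nrm2 R z0 `^ (- p).
  by rewrite ler_wpM2l// divr_ge0.
lra.
Qed.

(** * Runs confined to a box *)

Definition box (d : nat) (c : 'rV[int]_d) (w : nat) : set 'rV[int]_d :=
  [set z | forall i, `|z 0 i - c 0 i| < w%:Z].

(* The weight [(1 - k^2/w^2)^2] is an approximate Dirichlet eigenfunction:
   its second difference is at least [- 9/w^2] times itself on [|k| < w]. *)
Definition bump (R : realType) (w : nat) (k : int) : R :=
  if `|k| <= w%:Z then (1 - (k%:~R / w%:R) ^+ 2) ^+ 2 else 0.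

Lemma bump_ge0 (R : realType) w k : 0 <= bump R w k.
Proof. by rewrite /bump; case: ifP => // _; exact: sqr_ge0. Qed.

Lemma bump_edge (R : realType) w k : (0 < w)%N -> ~~ (`|k| < w%:Z) -> bump R w k = 0.
Proof.
move=> w0 kw; rewrite /bump; case: ifPn => // kw'.
have kE : `|k| = w%:Z by apply/eqP; rewrite eq_le kw' leNgt.
have -> : (k%:~R / w%:R) ^+ 2 = 1 :> R.
  rewrite expr_div_n -[k%:~R ^+ 2]real_normK ?num_real// -intr_norm kE -pmulrn.
  by rewrite divff// expf_neq0// pnatr_eq0 -lt0n.
by rewrite subrr expr0n.
Qed.

Lemma bump_le1 (R : realType) w k : (0 < w)%N -> bump R w k <= 1.
Proof.
move=> w0; rewrite /bump; case: ifP => // kw.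
have w0R : 0 < w%:R :> R by rewrite ltr0n.
have kR : (k%:~R / w%:R) ^+ 2 <= 1 :> R.
  rewrite expr_div_n ler_pdivrMr ?exprn_gt0// mul1r -[k%:~R ^+ 2]real_normK ?num_real// -intr_norm.
  by rewrite lerXn2r ?nnegrE ?ler0z// -[leRHS]/(w%:Z%:~R) ler_int.
by have := sqr_ge0 (k%:~R / w%:R : R); nra.
Qed.

Lemma bump_second_difference (R : realType) w k : `|k| < w%:Z ->
  - (9 / w%:R ^+ 2) * bump R w k <= bump R w (k + 1) + bump R w (k - 1) - 2 * bump R w k.
Proof.
move=> kw; have w0 : (0 < w)%N by lia.
have w0R : 0 < w%:R :> R by rewrite ltr0n.
(* All three arguments lie in the closed interval on which [bump] is the polynomial, since its
   definition includes [|k| = w]. The difference of the two sides is then a sum of nonnegative terms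
   over [y ^+ 6]. *)
rewrite /bump ifT; last by lia.
rewrite ifT; last by lia.
rewrite ifT; last by lia.
rewrite intrD intrB mulr1z; move: (k%:~R : R) (w%:R : R) w0R => {kw w0} x y y0.
rewrite -subr_ge0.
have -> : (1 - ((x + 1) / y) ^+ 2) ^+ 2 + (1 - ((x - 1) / y) ^+ 2) ^+ 2 -
  2 * (1 - (x / y) ^+ 2) ^+ 2 - - (9 / y ^+ 2) * (1 - (x / y) ^+ 2) ^+ 2 =
  (4 * y ^+ 4 + (y ^+ 2 - 3 * x ^+ 2) ^+ 2 + 2 * y ^+ 2) / y ^+ 6.
  by field; rewrite gt_eqF.
by rewrite divr_ge0 ?exprn_ge0 ?(ltW y0)// !addr_ge0 ?sqr_ge0// mulr_ge0 ?exprn_ge0 ?(ltW y0).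
Qed.

(** The product of the bumps over the coordinates equals 1 at [y], vanishes off the box and loses at
    most a factor [1 - 9 d eta / w^2] in each step, so it can be compared with the supersolution. *)
Lemma stay_in_box (R : realType) (d : nat) (G : set 'rV[int]_d) (eta : R) u y w n :
  (0 < w)%N -> 0 <= eta -> 2 * d%:R * eta <= 1 -> 9 * d%:R / w%:R ^+ 2 * eta <= 1 ->
  supersolution G eta u -> box y w `<=` G ->
  (forall x, box y w x -> 1 <= u 0%N x set0) ->
  (1 - 9 * d%:R / w%:R ^+ 2 * eta) ^+ n <= u n y set0.
Proof.
move=> w0 e0 e1 le1 [u0 u1 u2] yG ub.
pose phi (z : 'rV[int]_d) : R := \prod_(i < d) bump R w (z 0 i - y 0 i).
have phi0 z : 0 <= phi z by apply: prodr_ge0 => i _; exact: bump_ge0.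
have phi_out z : ~ box y w z -> phi z = 0.
  move=> /existsNP[i /negP zi]; rewrite /phi (bigD1 i)//= bump_edge ?mul0r//.
set la := 9 * d%:R / w%:R ^+ 2 in le1 *.
have step z : box y w z -> (1 - la * eta) * phi z <= nnstep eta phi z.
  move=> zy; rewrite nnstepE mulrBl mul1r lerD2l.
  have -> : - (la * eta * phi z) = eta * \sum_(i < d) - (9 / w%:R ^+ 2) * phi z.
    by rewrite sumr_const card_ord -mulr_natr /la; ring.
  rewrite ler_wpM2l//; apply: ler_sum => i _.
  pose rest : R := \prod_(j < d | j != i) bump R w (z 0 j - y 0 j).
  have phiE (z' : 'rV[int]_d) : (forall j, j != i -> z' 0 j = z 0 j) ->
      phi z' = bump R w (z' 0 i - y 0 i) * rest.
    by move=> zj; rewrite /phi (bigD1 i)//=; congr (_ * _); apply: eq_bigr => j /zj ->.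
  rewrite (phiE z)// (phiE (z + _)); last by move=> j ji; rewrite !mxE (negbTE ji) addr0.
  rewrite (phiE (z - _)); last by move=> j ji; rewrite !mxE (negbTE ji) subr0.
  rewrite !mxE !eqxx/=.
  have rest0 : 0 <= rest by apply: prodr_ge0 => j _; exact: bump_ge0.
  have := ler_wpM2r rest0 (bump_second_difference R (zy i)).
  congr (is_true (_ <= _)).
    by rewrite mulrA.
  rewrite mulrBl mulrDl mulrA; congr (_ * _ + _ * _ - _); congr bump; ring.
have claim k z : (1 - la * eta) ^+ k * phi z <= u k z set0.
  elim: k z => [|k IH] z.
    rewrite expr0 mul1r; have [zy|zy] := pselect (box y w z); last by rewrite phi_out.
    apply: le_trans (ub z zy).
    rewrite [leRHS](_ : 1 = \prod_(i < d) 1); last by rewrite big1.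
    by apply: ler_prod => i _; rewrite bump_ge0 bump_le1.
  have [zy|zy] := pselect (box y w z); last by rewrite phi_out// mulr0.
  apply: le_trans (u2 k z set0 (yG z zy)); rewrite set0D.
  apply: (@le_trans _ _ ((1 - la * eta) ^+ k * nnstep eta phi z)).
    by rewrite exprSr -mulrA ler_wpM2l ?exprn_ge0 ?subr_ge0//; exact: step.
  have -> : (1 - la * eta) ^+ k * nnstep eta phi z =
      nnstep eta (fun z => (1 - la * eta) ^+ k * phi z) z.
    by rewrite /nnstep mulrDr mulrCA; congr (_ + _); rewrite mulrCA mulr_sumr;
      congr (_ * _); apply: eq_bigr => i _; rewrite mulrDr.
  exact: le_nnstep.
have := claim n y; rewrite /phi big1 ?mulr1// => i _.
by rewrite subrr /bump normr0 lez_nat leq0n mul0r expr0n subr0 expr1n.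
Qed.

(** The probability that the lazy walk killed outside [D] visits all of [Y] in [n] steps and ends in
    [S], written as a recursion. It plays two roles: the quantity finally bounded below, and the
    description of one run in [repeated_runs]. *)
Fixpoint nn_value (R : realType) (d : nat) (D S : set 'rV[int]_d) (eta : R) (n : nat)
    (x : 'rV[int]_d) (Y : set 'rV[int]_d) : R :=
  if n is m.+1 then
    if `[< D x >] then nnstep eta (fun z => nn_value D S eta m z (Y `\ x)) x else 0
  else (`[< [/\ D x, S x & Y `<=` [set x]] >])%:R.

Lemma nnstep_ge0 (R : realType) (d : nat) (eta : R) (f : 'rV[int]_d -> R) x :
  0 <= eta -> 2 * d%:R * eta <= 1 -> (forall z, 0 <= f z) -> 0 <= nnstep eta f x.
Proof.
move=> e0 e1 f0; rewrite addr_ge0 ?mulr_ge0 ?subr_ge0//.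
by apply: sumr_ge0 => i _; rewrite addr_ge0.
Qed.

Lemma nn_value_super (R : realType) (d : nat) (D S : set 'rV[int]_d) (eta : R) :
  0 <= eta -> 2 * d%:R * eta <= 1 -> supersolution D eta (@nn_value R d D S eta).
Proof.
move=> e0 e1; split=> [|n x Y|n x Y Dx].
- elim=> [|n IH] x Y //=; case: asboolP => // _.
  by apply: nnstep_ge0 => // z; exact: IH.
- have E : (Y `\ x) `\ x = Y `\ x by rewrite setDDl setUid.
  case: n => [|n] /=; last by rewrite E.
  rewrite le_eqVlt; apply/orP; left; apply/eqP; congr (_%:R); congr (nat_of_bool _).
  apply: asbool_equiv_eq; split=> -[Dx Sx YS]; split => //.
    by move=> z Yz; apply: contrapT => zx; apply: (zx); apply: YS; split.
  by move=> z [/YS].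
- by rewrite /= asboolT.
Qed.

Lemma nn_value_anti (R : realType) (d : nat) (D S : set 'rV[int]_d) (eta : R) n x
    (Y Y' : set 'rV[int]_d) :
  0 <= eta -> 2 * d%:R * eta <= 1 -> Y' `<=` Y ->
  nn_value D S eta n x Y <= nn_value D S eta n x Y'.
Proof.
move=> e0 e1; elim: n x Y Y' => [|n IH] x Y Y' YY /=.
  case: asboolP => [[Dx Sx YS]|]; last by rewrite ler0n.
  by rewrite asboolT//; split => //; exact: subset_trans YS.
case: asboolP => // _.
by apply: le_nnstep => // *; apply: IH; apply: setSD.
Qed.

Lemma nnstep1 (R : realType) (d : nat) (eta : R) (x : 'rV[int]_d) :
  nnstep eta (fun=> 1) x = 1.
Proof. by rewrite nnstepE big1 ?mulr0 ?addr0// => i _; lra. Qed.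

Lemma nn_value_le1 (R : realType) (d : nat) (D S : set 'rV[int]_d) (eta : R) n x Y :
  0 <= eta -> 2 * d%:R * eta <= 1 -> nn_value D S eta n x Y <= 1.
Proof.
move=> e0 e1; elim: n x Y => [|n IH] x Y /=; first by rewrite lern1 leq_b1.
case: asboolP => // _; rewrite -[leRHS](nnstep1 eta x).
by apply: le_nnstep => // *; exact: IH.
Qed.

Lemma nnstepZ (R : realType) (d : nat) (eta c : R) (f : 'rV[int]_d -> R) x :
  nnstep eta (fun z => c * f z) x = c * nnstep eta f x.
Proof.
rewrite /nnstep mulrDr; congr (_ + _); first by ring.
rewrite [RHS]mulrCA; congr (_ * _); rewrite mulr_sumr.
by apply: eq_bigr => i _; rewrite mulrDr.
Qed.

Lemma nnstepB (R : realType) (d : nat) (eta : R) (f g : 'rV[int]_d -> R) x :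
  nnstep eta (fun z => f z - g z) x = nnstep eta f x - nnstep eta g x.
Proof.
rewrite !nnstepE opprD addrACA -mulrBr -sumrB; congr (_ + _ * _).
by apply: eq_bigr => i _; ring.
Qed.

Lemma nnstep_sum (R : realType) (d : nat) (eta : R) (E : seq 'rV[int]_d)
    (g : 'rV[int]_d -> 'rV[int]_d -> R) x :
  nnstep eta (fun z => \sum_(y <- E) g y z) x = \sum_(y <- E) nnstep eta (g y) x.
Proof.
rewrite /nnstep [RHS]big_split/= -!mulr_sumr exchange_big/=; congr (_ + _ * _).
by apply: eq_bigr => i _; rewrite big_split.
Qed.

Lemma nnstepB_sum (R : realType) (d : nat) (eta c t : R) (f : 'rV[int]_d -> R)
    (E : seq 'rV[int]_d) (b : 'rV[int]_d -> R) (g : 'rV[int]_d -> 'rV[int]_d -> R) x :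
  nnstep eta (fun z => c * (f z - t * \sum_(y <- E) b y * g y z)) x =
  c * (nnstep eta f x - t * \sum_(y <- E) b y * nnstep eta (g y) x).
Proof.
rewrite nnstepZ nnstepB nnstepZ nnstep_sum; congr (_ * (_ - _ * _)).
by apply: eq_bigr => y _; rewrite nnstepZ.
Qed.

(** All [m] runs must stay in [D] and end in [S], whence [q ^+ m]. Given this, a site of [E] is
    missed by every run with probability at most [(1 - q) ^+ m], and the sum over the sites of [E]
    in [Z] is a union bound. Once [E] is exhausted the bound [a] takes over. *)
Lemma repeated_runs (R : realType) (d : nat) (G D S : set 'rV[int]_d)
    (E : seq 'rV[int]_d) (eta : R) u (Y : set 'rV[int]_d) (a q : R) (n2 N1 : nat) y0 :
  0 <= eta -> 2 * d%:R * eta <= 1 -> D `<=` G -> supersolution G eta u ->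
  0 <= a -> 0 <= q <= 1 -> y0 \in E ->
  (forall x y, S x -> y \in E -> q <= nn_value D S eta N1 x [set y]) ->
  (forall Y' x n, Y' `<=` Y `\` [set` E] -> S x -> (n2 <= n)%N -> a <= u n x Y') ->
  forall m Z x n, Z `<=` Y -> S x -> (n2 + m * N1 <= n)%N ->
    a * q ^+ m * (1 - (1 - q) ^+ m * \sum_(y <- E) `[< Z y >]%:R) <= u n x Z.
Proof.
move=> e0 e1 DG su a0 /andP[q0 q1] y0E Hq Hu.
have [u0 u1 u2] := su.
pose V n x Y := nn_value D S eta n x Y.
have [V0 _ _] := @nn_value_super R d D S eta e0 e1.
pose g y n x := V n x set0 - V n x [set y].
have g_ge0 y n x : 0 <= g y n x by rewrite subr_ge0 nn_value_anti//; exact: sub0set.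
have t0 : 0 <= 1 - q by rewrite subr_ge0.
elim=> [|m IH] Z x n ZY Sx nn.
  rewrite !expr0 mulr1 mul1r.
  have [ZE|] := pselect (Z `<=` ~` [set` E]).
    rewrite big1_seq ?subr0 ?mulr1 => [|y /andP[_ yE]].
      by apply: Hu => //; [move=> y Zy; split; [exact: ZY|exact: ZE]|rewrite addn0 in nn].
    by case: asboolP => // /ZE/=; rewrite yE.
  move=> /existsNP[y /not_implyP[Zy /contrapT yE]].
  apply: le_trans (u0 _ _ _); rewrite mulr_ge0_le0// subr_le0.
  rewrite (big_rem y)//= asboolT// lerDl sumr_ge0// => z _; exact: ler0n.
pose aq := a * q ^+ m.
have aq0 : 0 <= aq by rewrite mulr_ge0 ?exprn_ge0.
(* The bound for the remaining [m] runs is affine in the indicators of the unvisited sites, so it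
   passes through one run by linearity. Here [g y] is the probability that the run succeeds without
   visiting [y]. *)
have claim j z Z' k : Z' `<=` Y -> (n2 + m * N1 <= k)%N ->
    aq * (V j z set0 - (1 - q) ^+ m * \sum_(y <- E) `[< Z' y >]%:R * g y j z)
      <= u (k + j)%N z Z'.
  have rhs0 i v : V i v set0 = 0 ->
      V i v set0 - (1 - q) ^+ m * \sum_(y <- E) `[< Z' y >]%:R * g y i v = 0.
    move=> v0; rewrite v0 big1 ?mulr0 ?subr0// => y _.
    by rewrite /g v0 (_ : V i v _ = 0) ?subrr ?mulr0//; apply/eqP; rewrite eq_le V0 -v0
      nn_value_anti//; exact: sub0set.
  elim: j z Z' k rhs0 => [|j IHj] z Z' k rhs0 Z'Y kk.
    rewrite addn0; have [[Dz Sz]|DS] := pselect (D z /\ S z); last first.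
      rewrite rhs0 ?mulr0; first exact: u0.
      by rewrite /V /= asboolF// => -[Dz Sz _]; apply: DS.
    apply: le_trans (u1 _ _ _).
    have Z'zY : Z' `\ z `<=` Y by apply: subset_trans Z'Y; exact: subDsetl.
    apply: le_trans (IH _ _ _ Z'zY Sz kk); rewrite ler_wpM2l//.
    rewrite /V /= asboolT; last by split => //; exact: sub0set.
    rewrite lerD2l lerN2 ler_wpM2l ?exprn_ge0// ler_sum// => y _.
    case: (asboolP ((Z' `\ z) y)) => [[Zy yz]|_]; last by rewrite mulr_ge0 ?ler0n.
    rewrite (asboolT Zy) mul1r /g /V /= asboolT; last by split => //; exact: sub0set.
    by rewrite asboolF ?subr0// => -[_ _ /(_ y erefl)].
  have [Dz|Dz] := pselect (D z); last first.
    rewrite rhs0 ?mulr0; first exact: u0.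
    by rewrite /V /= asboolF.
  rewrite addnS; apply: le_trans (u2 _ z Z' (DG z Dz)).
  have Z'zY : Z' `\ z `<=` Y by apply: subset_trans Z'Y; exact: subDsetl.
  have rhs0' i v : V i v set0 = 0 ->
      V i v set0 - (1 - q) ^+ m * \sum_(y <- E) `[< (Z' `\ z) y >]%:R * g y i v = 0.
    move=> v0; rewrite v0 big1 ?mulr0 ?subr0// => y _.
    by rewrite /g v0 (_ : V i v _ = 0) ?subrr ?mulr0//; apply/eqP; rewrite eq_le V0 -v0
      nn_value_anti//; exact: sub0set.
  apply: (@le_trans _ _ (nnstep eta (fun v => aq * (V j v set0 -
      (1 - q) ^+ m * \sum_(y <- E) `[< (Z' `\ z) y >]%:R * g y j v)) z)); last first.
    by apply: le_nnstep => // *; apply: IHj.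
  rewrite (nnstepB_sum eta aq ((1 - q) ^+ m) (fun v => V j v set0) E
     (fun y => `[< (Z' `\ z) y >]%:R) (fun y v => g y j v)).
  have VS Z2 : V j.+1 z Z2 = nnstep eta (fun v => V j v (Z2 `\ z)) z.
    by rewrite /V /= asboolT.
  rewrite VS set0D ler_wpM2l// lerD2l lerN2 ler_wpM2l ?exprn_ge0//.
  apply: ler_sum => y _.
  case: (asboolP ((Z' `\ z) y)) => [[Z'y yz]|_]; last by rewrite mul0r mulr_ge0 ?ler0n.
  rewrite (asboolT Z'y) !mul1r nnstepB /g !VS set0D (_ : [set y] `\ z = [set y])//.
  by apply/seteqP; split=> v /= => [[]//|->].
have nE : (n = n - N1 + N1)%N by rewrite subnK//; move: nn; rewrite mulSn; lia.
have nm : (n2 + m * N1 <= n - N1)%N by move: nn; rewrite mulSn; lia.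
have := claim N1 x Z (n - N1)%N ZY nm; rewrite -nE.
set g0 := V N1 x set0.
have g0q : q <= g0.
  by apply: le_trans (Hq x y0 Sx y0E) _; apply: nn_value_anti => //; exact: sub0set.
have g01 : g0 <= 1 by exact: nn_value_le1.
have [neg|pos] := leP (1 - (1 - q) ^+ m.+1 * \sum_(y <- E) `[< Z y >]%:R) 0.
  by move=> _; apply: le_trans (u0 _ _ _); rewrite mulr_ge0_le0 ?mulr_ge0 ?exprn_ge0.
apply: le_trans; rewrite exprSr mulrA -/aq -mulrA ler_wpM2l//.
apply: (@le_trans _ _ (g0 * (1 - (1 - q) ^+ m.+1 * \sum_(y <- E) `[< Z y >]%:R))).
  by rewrite ler_wpM2r// ltW.
rewrite mulrBr mulr1 lerD2l lerN2 exprSr -!mulrA mulrCA ler_wpM2l ?exprn_ge0//.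
rewrite mulrA mulr_sumr [leLHS]big_seq [leRHS]big_seq; apply: ler_sum => y yE.
rewrite mulrC ler_wpM2r ?ler0n// /g -/g0.
(* A successful run misses [y] with conditional probability at most [1 - q]:
   [g0 - V <= g0 - q <= g0 (1 - q)] because [g0 <= 1]. *)
have := Hq x y Sx yE; rewrite -/(V N1 x [set y]); nra.
Qed.

(** * Covering a cube *)

Definition cube (d : nat) (a : 'rV[int]_d) (n : nat) : set 'rV[int]_d :=
  [set z | forall i, a 0 i <= z 0 i < a 0 i + n%:Z].

Definition cube_seq (d : nat) (a : 'rV[int]_d) (n : nat) : seq 'rV[int]_d :=
  codom (fun f : {ffun 'I_d -> 'I_n} => a + \row_i (f i)%:Z).

Lemma size_cube_seq d (a : 'rV[int]_d) n : size (cube_seq a n) = (n ^ d)%N.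
Proof. by rewrite size_codom card_ffun !card_ord. Qed.

Lemma mem_cube_seq d (a : 'rV[int]_d) n : [set` cube_seq a n] = cube a n.
Proof.
apply/seteqP; split=> z /=.
  move=> /codomP[f ->] i; rewrite !mxE.
  by rewrite lerDl ltrD2l ltz_nat ltn_ord.
move=> az; have {}az i : a 0 i <= z 0 i < a 0 i + n%:Z := az i.
have zi i : (absz (z 0 i - a 0 i)%R < n)%N by have := az i; lia.
apply/codomP; exists [ffun i => Ordinal (zi i)]; apply/rowP => i.
rewrite !mxE ffunE/= gez0_abs ?subr_ge0; last by case/andP: (az i).
by rewrite addrC subrK.
Qed.

(* From [x], a supersolution loses at most a factor [exp (- kappa)] until the
   sites of [E] have been visited and the walk stands at [y]; this takes a time
   at most [kappa * T]. *)
Definition task (R : realType) (d : nat) (G : set 'rV[int]_d) (eta T : R)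
    (x : 'rV[int]_d) (E : set 'rV[int]_d) (y : 'rV[int]_d) (kappa : R) :=
  exists2 n0 : nat, n0%:R * eta <= kappa * T &
  forall u, supersolution G eta u -> forall Y (a : R) n2, 0 <= a ->
    (forall Y' n, Y' `<=` Y `\` E -> (n2 <= n)%N -> a <= u n y Y') ->
    forall Y' n, Y' `<=` Y -> (n2 + n0 <= n)%N -> a * expR (- kappa) <= u n x Y'.

(** Since 3/4 exceeds [1 / sqrt 2], the ratio of the geometric factors grows at least like
    [(51/50)^(2j)], and [(51/50)^j >= j/50]; hence the constant 2500. *)
Lemma sqr_le_geometric (R : realType) (j : nat) :
  j%:R ^+ 2 * ((Num.sqrt 2)^-1) ^+ j <= 2500 * (3 / 4) ^+ j :> R.
Proof.
have s0 : 0 < Num.sqrt 2 :> R by rewrite sqrtr_gt0.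
have sE : Num.sqrt 2 ^+ 2 = 2 :> R by rewrite sqr_sqrtr.
pose b : R := 51 / 50.
have b1 : 1 <= b by rewrite /b; lra.
have bs : b ^+ 2 <= 3 / 4 * Num.sqrt 2.
  rewrite -(@ler_pXn2r _ 2)// ?nnegrE ?exprn_ge0 ?mulr_ge0 ?sqrtr_ge0//.
  by rewrite [leRHS]exprMn sE /b; lra.
have bj : j%:R / 50 <= b ^+ j.
  elim: j => [|j IH]; first by rewrite mul0r expr0.
  have bj1 : 1 <= b ^+ j by rewrite exprn_ege1.
  by rewrite exprS -natr1; move: (b ^+ j) IH bj1 => B; rewrite /b; lra.
rewrite exprVn ler_pdivrMr ?exprn_gt0// -mulrA -exprMn.
apply: (@le_trans _ _ (2500 * (b ^+ 2) ^+ j)); last first.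
  apply: ler_wpM2l; first exact: ler0n.
  by apply: lerXn2r => //; rewrite nnegrE ?exprn_ge0 ?mulr_ge0 ?sqrtr_ge0 ?(le_trans ler01 b1).
rewrite -exprM mulnC exprM; move: (b ^+ j) bj => B bj.
have : (j%:R / 50) ^+ 2 <= B ^+ 2.
  by apply: lerXn2r => //; rewrite nnegrE ?divr_ge0// (le_trans _ bj)// divr_ge0.
by move: (j%:R : R) (B ^+ 2) => x y; rewrite expr_div_n; clear; lra.
Qed.

Lemma powR_hit_exponent (R : realType) (d j : nat) : (0 < d)%N ->
  ((2 ^ j)%N%:R ^+ 2) `^ hit_exponent R d =
  (2 ^+ d.-1) ^+ j * ((Num.sqrt 2)^-1) ^+ j.
Proof.
move=> d0; rewrite -exprMn natrX exprAC -powR_mulrn; last by rewrite exprn_ge0.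
rewrite -powRrM mulrC powRrM powR_mulrn ?powR_ge0//; congr (_ ^+ _).
rewrite -(powR_mulrn 2)// -powRrM.
have -> : 2 * hit_exponent R d = d.-1%:R + - 2^-1.
  by rewrite /hit_exponent -{1}(prednK d0) -natr1; field.
by rewrite powRD ?pnatr_eq0 ?implybT// powRN powR12_sqrt// powR_mulrn.
Qed.

Lemma expR_le_onem (R : realType) (t : R) : 0 <= t <= 2^-1 -> expR (- (2 * t)) <= 1 - t.
Proof.
move=> /andP[t0 t2]; rewrite expRN; have := expR_ge1Dx (2 * t).
move=> H; have e0 := expR_gt0 (2 * t).
by rewrite -[leLHS]mul1r ler_pdivrMr//; nra.
Qed.

Lemma nrm2_le_coord (R : realType) d (z : 'rV[int]_d) (k : nat) :
  (forall i, `|z 0 i| <= k%:Z) -> nrm2 R z <= d%:R * k%:R ^+ 2.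
Proof.
move=> zk; apply: (@le_trans _ _ (\sum_(i < d) k%:R ^+ 2)).
  apply: ler_sum => i _; rewrite -[_ ^+ 2]real_normK ?num_real// -intr_norm.
  by rewrite lerXn2r ?nnegrE ?ler0z// -[leRHS]/(k%:Z%:~R) ler_int.
by rewrite sumr_const card_ord mulr_natl.
Qed.

Lemma coord_lt_nrm2 (R : realType) d (z : 'rV[int]_d) (k : nat) i :
  nrm2 R z < k%:R ^+ 2 -> `|z 0 i| < k%:Z.
Proof.
move=> zk; rewrite -(ltr_int R) -[ltRHS]/(k%:R) intr_norm.
rewrite -(@ltr_pXn2r _ 2)// ?nnegrE// real_normK ?num_real//.
exact: le_lt_trans (coord_le_nrm2 R z i) zk.
Qed.

Definition corner (d : nat) (c : 'rV[int]_d) (w : nat) : 'rV[int]_d := c - const_mx w%:Z.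

Lemma row_subE d (x y : 'rV[int]_d) i : (x - y) 0 i = x 0 i - y 0 i.
Proof. by rewrite !mxE. Qed.

Lemma row_addE d (x y : 'rV[int]_d) i : (x + y) 0 i = x 0 i + y 0 i.
Proof. by rewrite !mxE. Qed.

Lemma cornerE d (c : 'rV[int]_d) w i : corner c w 0 i = c 0 i - w%:Z.
Proof. by rewrite !mxE. Qed.

(** Hitting estimates ask for a lower bound at the target that is uniform in the remaining time [n],
    while the probability of staying in a box decays like [rho ^+ n]. Dividing by that factor
    restores uniformity, and as [rho <= 1] the inequality survives. *)
Lemma supersolution_discount (R : realType) (d : nat) (D : set 'rV[int]_d) (eta rho : R) u :
  0 <= eta -> 2 * d%:R * eta <= 1 -> 0 < rho <= 1 -> supersolution D eta u ->
  supersolution D eta (fun n x Y => u n x Y / rho ^+ n).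
Proof.
move=> eta0 eta1 /andP[rho0 rho1] [V0 V1 V2]; split=> [n z Y|n z Y|n z Y Dz].
- by rewrite divr_ge0// exprn_ge0// ltW.
- by rewrite ler_wpM2r// invr_ge0 exprn_ge0// ltW.
- under [X in nnstep eta X]eq_fun do rewrite mulrC.
  rewrite nnstepZ mulrC ler_pM ?invr_ge0 ?exprn_ge0 ?(ltW rho0)//.
  + exact: nnstep_ge0.
  + exact: V2.
  + by rewrite lef_pV2 ?posrE ?exprn_gt0// exprS ger_pMl ?exprn_gt0.
Qed.

(** A run hits [y] and then stays near [y] until its prescribed length is used up; over a time of
    order [w^2] the second requirement costs only the constant [e1]. The same hitting estimate,
    aimed at the centre, gives the return for an arbitrary supersolution. *)
Lemma run_success (R : realType) (d : nat) : (2 <= d)%N ->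
  exists q1 K1 : R, [/\ 0 < q1 <= 1, 1 <= K1 &
  forall (w : nat) (eta : R) (c : 'rV[int]_d), (3 <= w)%N -> 0 < eta -> 2 * d%:R * eta <= 1 ->
  exists2 N1 : nat, N1%:R * eta <= K1 * w%:R ^+ 2 &
  (forall x y, box c (2 * w).+1 x -> cube (corner c w) (2 * w) y ->
     q1 * (w%:R ^+ 2) `^ (- hit_exponent R d) <=
       nn_value (box c ((6 * d).+1 * w)) (box c (2 * w).+1) eta N1 x [set y]) /\
  (forall u, supersolution (box c ((6 * d).+1 * w)) eta u -> forall Y (a : R) n2, 0 <= a ->
     (forall Y' n, Y' `<=` Y -> (n2 <= n)%N -> a <= u n c Y') ->
     forall x Y' n, box c (2 * w).+1 x -> Y' `<=` Y -> (n2 + N1 <= n)%N ->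
     a * (q1 * (w%:R ^+ 2) `^ (- hit_exponent R d)) <= u n x Y')].
Proof.
move=> d2; have [q0 [K0 [/andP[q00 q01] K00 H]]] := hit_estimate R d2.
set p := hit_exponent R d in H *.
have d2R : 2 <= d%:R :> R by rewrite (ler_nat _ 2).
pose K1 : R := K0 * 9 * d%:R ^+ 2 + 1.
have K11 : 1 <= K1 by rewrite lerDr !mulr_ge0 ?exprn_ge0// ltW.
pose e1 : R := expR (- (18 * d%:R * K1)).
have e10 : 0 < e1 := expR_gt0 _.
have e11 : e1 <= 1.
  by rewrite -expR0 ler_expR oppr_le0 !mulr_ge0// (le_trans ler01 K11).
have p0 : 0 <= p by rewrite /p /hit_exponent; lra.
pose dp : R := (9 * d%:R ^+ 2) `^ (- p).
have d9 : 1 <= (9 * d%:R ^+ 2 : R) by move: d2R; clear; nra.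
have dp0 : 0 < dp by rewrite powR_gt0// (lt_le_trans ltr01).
have dp1 : dp <= 1.
  rewrite /dp powRN invf_le1 ?powR_gt0 ?(lt_le_trans ltr01 d9)//.
  by have := ler_powR d9 p0; rewrite powRr0.
have qd0 : 0 < q0 * dp by rewrite mulr_gt0.
have qd1 : q0 * dp <= 1 by rewrite mulr_ile1// ltW.
exists (e1 * (q0 * dp)), K1; split => //.
  by rewrite mulr_gt0//= mulr_ile1// ltW.
move=> w eta c w3 eta0 eta1.
have w3R : 3 <= w%:R :> R by rewrite (ler_nat _ 3).
have w0R : 0 < w%:R :> R by exact: lt_le_trans w3R.
have eta1' : eta <= 1 by move: d2R eta0 eta1; clear; nra.
(* A start and a target are at Euclidean distance at most [3 w sqrt d <= l], and the ball of radius
   [2 l = 6 d w] about the target fits into the box of half-width [(6 d + 1) w] about [c]. *)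
pose l : R := (3 * d * w)%:R.
have lE : l ^+ 2 = 9 * d%:R ^+ 2 * w%:R ^+ 2 by rewrite /l !natrM; ring.
have l1 : 1 <= l by rewrite /l ler1n !muln_gt0 (ltnW d2) (leq_trans _ w3).
have lp : (l ^+ 2) `^ (- p) = dp * (w%:R ^+ 2) `^ (- p).
  by rewrite lE powRM// ?exprn_ge0// (le_trans ler01 d9).
have w21 : 1 <= (w%:R ^+ 2 : R) by rewrite exprn_ege1//; lra.
have Kl0 : 0 <= K0 * l ^+ 2 by rewrite mulr_ge0 ?sqr_ge0// ltW.
have [N1 /andP[N1l N1u]] := nat_ceil_div eta0 Kl0.
have N1K : N1%:R * eta <= K1 * w%:R ^+ 2.
  apply: le_trans N1u _; rewrite lE /K1 [leRHS]mulrDl [1 * _]mul1r; apply: lerD; last exact: le_trans w21.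
  by rewrite !mulrA.
exists N1 => //.
have near (x y : 'rV[int]_d) : box c (2 * w).+1 x -> (forall i, `|y 0 i - c 0 i| <= w%:Z) ->
    nrm2 R (x - y) <= l ^+ 2.
  move=> xc yc; apply: (@le_trans _ _ (d%:R * (3 * w)%:R ^+ 2)).
    apply: nrm2_le_coord => i; rewrite row_subE.
    have {}xc : `|x 0 i - c 0 i| < (2 * w).+1%:Z := xc i.
    by have := yc i; move: xc w3; clear; lia.
  rewrite lE natrM exprMn mulrA ler_wpM2r ?exprn_ge0//.
  by move: d2R; clear; nra.
have ball (z y : 'rV[int]_d) : (forall i, `|y 0 i - c 0 i| <= w%:Z) ->
    nrm2 R (z - y) < 4 * l ^+ 2 -> box c ((6 * d).+1 * w) z.
  move=> yc zy i; have := @coord_lt_nrm2 R d (z - y) (6 * d * w) i.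
  rewrite (_ : (6 * d * w)%:R ^+ 2 = 4 * l ^+ 2); last by rewrite lE !natrM; ring.
  by move=> /(_ zy); rewrite row_subE; have := yc i; move: w3 d2; clear; nia.
split; last first.
  move=> u su Y a n2 a0 Hc x Y' n xc Y'Y nn.
  have cc i : `|c 0 i - c 0 i| <= w%:Z by rewrite subrr normr0.
  have := H (box c ((6 * d).+1 * w)) eta u Y a n2 N1 c x l eta0 eta1 l1
    (fun z => ball z c cc) (near x c xc cc) su a0 _ N1l Y' n Y'Y nn.
  move=> h; apply: le_trans (h _); last first.
    by move=> Z m ZY; apply: Hc; apply: subset_trans ZY _; exact: subDsetl.
  rewrite lp ler_wpM2l// -!mulrA mulrA -[leRHS]mul1r -[leLHS]mulrA.
  by rewrite ler_wpM2r// !mulr_ge0 ?powR_ge0 ?(ltW q00)// ltW.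
move=> x y xc yc.
have {}yc i : `|y 0 i - c 0 i| <= w%:Z.
  have : corner c w 0 i <= y 0 i < corner c w 0 i + (2 * w)%:Z := yc i.
  by rewrite !cornerE; clear; lia.
pose la : R := 9 * d%:R / w%:R ^+ 2.
have la0 : 0 <= la by rewrite divr_ge0 ?mulr_ge0 ?exprn_ge0.
have la2 : la * eta <= 2^-1.
  rewrite /la mulrAC ler_pdivrMr ?exprn_gt0//.
  by move: eta1 w3R; clear; nra.
pose rho := 1 - la * eta.
have rho1 : rho <= 1 by rewrite gerBl mulr_ge0// ltW.
have rho0 : 0 < rho by rewrite /rho; move: la2; clear; lra.
pose D := box c ((6 * d).+1 * w); pose S := box c (2 * w).+1.
have sV := @nn_value_super R d D S eta (ltW eta0) eta1.
pose u' n x Y := nn_value D S eta n x Y / rho ^+ n.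
have su' : supersolution D eta u'.
  by apply: supersolution_discount => //; rewrite ?rho0// ltW.
have base Y' n : Y' `<=` [set y] `\ y -> (0 <= n)%N -> 1 <= u' n y Y'.
  rewrite setDv subset0 => -> _; rewrite ler_pdivlMr ?exprn_gt0// mul1r.
  have w0 : (0 < w)%N by exact: leq_trans w3.
  have := @stay_in_box R d D eta (nn_value D S eta) y w n w0 (ltW eta0) eta1 _ sV.
  apply.
  + by move: la2; rewrite -/la; clear; lra.
  + by move=> z zy i; have zi : `|z 0 i - y 0 i| < w%:Z := zy i; have := yc i; move: zi w3 d2; clear; nia.
  + move=> z zy /=; rewrite asboolT//; split; last exact: sub0set.
      by move=> i; have zi : `|z 0 i - y 0 i| < w%:Z := zy i; have := yc i; move: zi w3 d2; clear; nia.
    by move=> i; have zi : `|z 0 i - y 0 i| < w%:Z := zy i; have := yc i; move: zi w3 d2; clear; nia.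
have := H D eta u' [set y] 1 0%N N1 y x l eta0 eta1 l1
  (fun z => ball z y yc) (near x y xc yc) su' ler01 base N1l [set y] N1 (@subset_refl _ _) (leqnn _).
rewrite mul1r lp ler_pdivlMr ?exprn_gt0// => h; apply: le_trans h.
rewrite -mulrA mulrC mulrA.
rewrite ler_wpM2l//.
  by rewrite !mulr_ge0 ?powR_ge0 ?(ltW q00)// ltW.
apply: (@le_trans _ _ (expR (- (2 * (la * eta))) ^+ N1)).
  rewrite -expRM_natl ler_expR mulrN lerN2.
  have -> : N1%:R * (2 * (la * eta)) = 2 * la * (N1%:R * eta) by ring.
  apply: (@le_trans _ _ (2 * la * (K1 * w%:R ^+ 2))); first by rewrite ler_wpM2l ?mulr_ge0.
  by rewrite /la le_eqVlt; apply/orP; left; apply/eqP; field; rewrite gt_eqF.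
apply: lerXn2r; rewrite ?nnegrE ?expR_ge0 ?(ltW rho0)//.
by apply: expR_le_onem; rewrite la2 mulr_ge0// ltW.
Qed.

(** With w = 2^j this is [w^(d-1) (3/4)^j], below the surface of the cube by a geometric factor; the
    factor is what makes the sum over all scales converge. *)
Definition scale_cost (R : realType) (d j : nat) : R := (2 ^+ d.-1 * (3 / 4)) ^+ j.

Lemma scale_cost_ge (R : realType) (d : nat) : (2 <= d)%N ->
  exists2 C : R, 0 < C & forall j,
    j%:R ^+ 2 * ((2 ^ j)%N%:R ^+ 2) `^ hit_exponent R d <= C * scale_cost R d j.
Proof.
move=> d2; exists 2500 => [|j]; first by rewrite ltr0n.
rewrite powR_hit_exponent ?(ltnW d2)// /scale_cost exprMn.
rewrite [leLHS]mulrCA [leRHS]mulrCA; apply: ler_wpM2l; last exact: sqr_le_geometric.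
by rewrite !exprn_ge0.
Qed.

(** Coupon collecting: about [j / q] runs are needed for the order of [2^(j d)] sites, and the
    success of each costs [ln (1 / q)], of order [j]. With [1 / q] of order [(w^2)^p] this is the
    quantity bounded in [scale_cost_ge]. *)
Lemma cover_cube (R : realType) (d : nat) : (2 <= d)%N ->
  exists2 K : R, 0 < K & forall (j : nat) (G : set 'rV[int]_d) (eta T : R) c,
    (2 <= j)%N -> 0 < eta -> 2 * d%:R * eta <= 1 ->
    box c ((6 * d).+1 * 2 ^ j) `<=` G -> (2 ^ j)%N%:R ^+ 2 <= T ->
    task G eta T c (cube (corner c (2 ^ j)) (2 * 2 ^ j)) c (K * scale_cost R d j).
Proof.
move=> d2; have [q1 [K1 [/andP[q10 q11] K11 H]]] := run_success R d2.
have [C C0 HC] := scale_cost_ge R d2.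
set p := hit_exponent R d in H HC.
have d2R : 2 <= d%:R :> R by rewrite (ler_nat _ 2).
have p0 : 0 <= p by rewrite /p /hit_exponent; lra.
have lq1 : 0 <= ln q1^-1 by rewrite ln_ge0// invf_ge1.
pose A : R := (3 + 2 * d%:R) / q1.
have A0 : 0 <= A by rewrite divr_ge0 ?addr_ge0 ?mulr_ge0// ltW.
have A1 : 1 <= A by rewrite ler_pdivlMr// mul1r; move: q11 d2R; clear; lra.
pose B : R := ln q1^-1 + 2 * p + 1.
have B1 : 1 <= B by rewrite /B lerDr addr_ge0// mulr_ge0.
have AB0 : 0 <= (A + 1) * B.
  by apply: mulr_ge0; [exact: addr_ge0|exact: le_trans ler01 B1].
have AK0 : 0 <= A * K1 by apply: mulr_ge0 => //; exact: le_trans ler01 K11.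
pose K : R := C * (A * K1 + (A + 1) * B).
have K0 : 0 < K.
  have [A2 B2] : 0 < A /\ 0 < B by split; exact: lt_le_trans ltr01 _.
  by rewrite mulr_gt0// addr_gt0// mulr_gt0// ?addr_gt0// (lt_le_trans ltr01).
exists K => // j G eta T c j2 eta0 eta1 cG wT.
set w := (2 ^ j)%N in cG wT *.
have w4 : (4 <= w)%N by rewrite (leq_pexp2l (m := 2) (n1 := 2)).
have w4R : 4 <= w%:R :> R by rewrite (ler_nat _ 4).
have w0R : 0 < w%:R :> R by exact: lt_le_trans w4R.
have [N1 N1K [Hy Hc]] := H w eta c (ltnW w4) eta0 eta1.
pose W := (w%:R ^+ 2) `^ p : R.
have W1 : 1 <= W.
  rewrite /W -[leLHS](powRr0 (w%:R ^+ 2)); apply: ler_powR => //; rewrite exprn_ege1//.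
  by apply: le_trans w4R; rewrite ler1n.
have W0 : 0 < W by exact: lt_le_trans W1.
pose q := q1 * (w%:R ^+ 2) `^ (- p).
have qE : q = q1 / W by rewrite /q powRN.
have q0 : 0 < q by rewrite qE divr_gt0.
have q1' : q <= 1 by rewrite qE ler_pdivrMr// mul1r (le_trans q11).
have j2R : 2 <= j%:R :> R by rewrite (ler_nat _ 2).
pose L : R := ln (2 * (2 * w%:R) ^+ d).
have ww : 0 < (2 * w%:R) ^+ d :> R by rewrite exprn_gt0// mulr_gt0.
have ln2 : ln 2 <= 1 :> R.
  by rewrite -[leRHS](expRK 1) ler_ln ?posrE ?expR_gt0//; apply: le_trans (expR_ge1Dx _); lra.
have lw : ln w%:R <= j%:R :> R.
  by rewrite /w natrX lnXn// -[leLHS]mulr_natr ler_piMl.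
have LE : L = ln 2 + d%:R * (ln 2 + ln w%:R).
  by rewrite /L lnM ?posrE// lnXn ?mulr_gt0// lnM ?posrE// mulr_natl.
have ln20 : 0 <= ln 2 :> R by rewrite ln_ge0//; lra.
have lnw0 : 0 <= ln w%:R :> R by rewrite ln_ge0//; move: w4R; clear; lra.
have L0 : 0 <= L by rewrite LE addr_ge0// mulr_ge0// addr_ge0.
have Lj : L <= (1 + 2 * d%:R) * j%:R.
  by rewrite LE; move: (ln 2) (ln w%:R) ln2 lw ln20 lnw0 j2R d2R; clear => x y; nra.
(* With [m] about [L / q], the union bound over the [(2 w)^d] sites is at most 1/2. *)
have [m /andP[mL mLu]] := nat_ceil_div q0 L0.
have m1 : m%:R + 1 <= A * (j%:R * W).
  have -> : A * (j%:R * W) = ((3 + 2 * d%:R) * j%:R) / q.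
    by rewrite qE /A; field; rewrite !gt_eqF.
  rewrite ler_pdivlMr//; move: (m%:R : R) mLu Lj q1' q0 j2R; clear => x; nra.
have half : (1 - q) ^+ m * (2 * w%:R) ^+ d <= 2^-1.
  rewrite -ler_pdivlMr//; apply: (@le_trans _ _ (expR (- q) ^+ m)).
    by rewrite lerXn2r ?nnegrE ?subr_ge0 ?expR_ge0//; exact: expR_ge1Dx.
  rewrite -expRM_natl -invfM mulrN expRN lef_pV2 ?posrE ?expR_gt0 ?mulr_gt0//.
  by rewrite -ler_ln ?posrE ?expR_gt0 ?mulr_gt0// expRK.
have jW : j%:R ^+ 2 * W <= C * scale_cost R d j by exact: HC.
have jW1 : j%:R * W <= j%:R ^+ 2 * W.
  by rewrite ler_wpM2r ?(ltW W0)//; move: j2R; clear; nra.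
have jW1' : 1 <= j%:R ^+ 2 * W.
  by move: j2R W1; clear; nra.
have lq : ln q^-1 <= (B - 1) * j%:R.
  rewrite qE invf_div lnM ?posrE ?invr_gt0// ln_powR.
  rewrite lnXn// /B addrK mulr2n.
  move: lw lnw0 j2R lq1 p0.
  by move: (ln w%:R) (ln q1^-1) (p) => x y z; clear; nra.
(* The [m] runs are followed by one excursion that brings the walk back to [c]. *)
exists (N1 + m * N1)%N.
  rewrite natrD natrM -[X in X + _]mul1r -mulrDl addrC -mulrA.
  apply: (@le_trans _ _ (A * (j%:R * W) * (K1 * T))).
    rewrite ler_pM ?addr_ge0 ?mulr_ge0 ?(ltW eta0)//.
    by apply: le_trans N1K _; rewrite ler_wpM2l// (le_trans ler01).
  rewrite mulrA ler_wpM2r ?(le_trans (sqr_ge0 _) wT)//.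
  apply: (@le_trans _ _ (A * K1 * (C * scale_cost R d j))).
    rewrite mulrAC ler_wpM2l ?(le_trans jW1)// mulr_ge0// (le_trans ler01)//.
  rewrite mulrA ler_wpM2r ?exprn_ge0 ?mulr_ge0 ?exprn_ge0//.
  rewrite [leLHS]mulrC /K; apply: ler_wpM2l; first exact: ltW.
  by rewrite lerDl.
move=> u su Y a n2 a0 Hu Y' n Y'Y nn.
set E := cube _ _ in Hu *.
have su' : supersolution (box c ((6 * d).+1 * w)) eta u := supersolutionS cG su.
have base Z x k : Z `<=` Y `\` [set` cube_seq (corner c w) (2 * w)] ->
    box c (2 * w).+1 x -> (n2 + N1 <= k)%N -> a * q <= u k x Z.
  rewrite mem_cube_seq => ZY xc kk.
  exact: (Hc u su' (Y `\` E) a n2 a0 Hu x Z k xc ZY kk).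
have cS : box c (2 * w).+1 c by move=> i; rewrite subrr normr0.
have cE : c \in cube_seq (corner c w) (2 * w).
  have : [set` cube_seq (corner c w) (2 * w)] c; last by [].
  by rewrite mem_cube_seq => i; rewrite cornerE; move: w4; clear; lia.
have Hq x y : box c (2 * w).+1 x -> y \in cube_seq (corner c w) (2 * w) ->
    q <= nn_value (box c ((6 * d).+1 * w)) (box c (2 * w).+1) eta N1 x [set y].
  move=> xc yE; apply: Hy => //.
  by have : [set` cube_seq (corner c w) (2 * w)] y by []; rewrite mem_cube_seq.
have := repeated_runs (ltW eta0) eta1 (@subset_refl _ _) su' (mulr_ge0 a0 (ltW q0))
  (introT andP (conj (ltW q0) q1')) cE Hq base Y'Y cS.
move=> /(_ m n); rewrite -addnA => /(_ nn); apply: le_trans.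
have sumE : \sum_(y <- cube_seq (corner c w) (2 * w)) `[< Y' y >]%:R <= (2 * w%:R) ^+ d :> R.
  apply: (@le_trans _ _ (\sum_(y <- cube_seq (corner c w) (2 * w)) 1)).
    by apply: ler_sum => y _; rewrite lern1 leq_b1.
  by rewrite big_const_seq count_predT size_cube_seq iter_addr_0 natrX natrM.
have q0' := ltW q0.
apply: (@le_trans _ _ (a * q * q ^+ m * 2^-1)); last first.
  apply: ler_wpM2l; first by apply: mulr_ge0; [exact: mulr_ge0|exact: exprn_ge0].
  have : (1 - q) ^+ m * \sum_(y <- cube_seq (corner c w) (2 * w)) `[< Y' y >]%:R <= 2^-1.
    by apply: le_trans half; rewrite ler_wpM2l// exprn_ge0// subr_ge0.
  by move: ((1 - q) ^+ m * _) => x; clear; lra.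
have -> : a * q * q ^+ m * 2^-1 = a * (q ^+ m.+1 / 2) by rewrite exprS !mulrA.
rewrite ler_wpM2l//.
have -> : q ^+ m.+1 / 2 = expR (- (m.+1%:R * ln q^-1 + ln 2)).
  by rewrite expRN expRD expRM_natl !lnK ?posrE ?invr_gt0// exprVn invfM invrK.
rewrite ler_expR lerN2.
apply: (@le_trans _ _ ((A + 1) * B * (C * scale_cost R d j))); last first.
  rewrite mulrA ler_wpM2r ?exprn_ge0 ?mulr_ge0 ?exprn_ge0//.
  rewrite [leLHS]mulrC /K; apply: ler_wpM2l; first exact: ltW.
  by rewrite lerDr.
apply: (@le_trans _ _ ((A + 1) * B * (j%:R ^+ 2 * W))); last first.
  by rewrite ler_wpM2l.
have lq0 : 0 <= ln q^-1 by rewrite ln_ge0// invf_ge1.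
apply: (@le_trans _ _ (A * (j%:R * W) * ((B - 1) * j%:R) + 1)).
  by rewrite lerD// -natr1 ler_pM// addr_ge0.
have -> : A * (j%:R * W) * ((B - 1) * j%:R) = A * (B - 1) * (j%:R ^+ 2 * W) by ring.
by move: (j%:R ^+ 2 * W) jW1' A1 B1; clear => x; nra.
Qed.

(** * Composition of tasks and the cost of travel *)

Lemma task_refl (R : realType) (d : nat) (G : set 'rV[int]_d) (eta T : R) x :
  task G eta T x [set x] x 0.
Proof.
exists 0%N => [|u [_ u1 _] Y a n2 a0 H Y' n Y'Y nn]; first by rewrite !mul0r.
rewrite oppr0 expR0 mulr1; apply: le_trans (u1 n x Y'); apply: H; first exact: setSD.
by rewrite addn0 in nn.
Qed.

Lemma task_weaken (R : realType) (d : nat) (G : set 'rV[int]_d) (eta T : R) x E E' y k k' :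
  0 <= T -> E' `<=` E -> k <= k' -> task G eta T x E y k -> task G eta T x E' y k'.
Proof.
move=> T0 EE kk [n0 n0k H]; exists n0; first by rewrite (le_trans n0k)// ler_wpM2r.
move=> u su Y a n2 a0 HY Y' n Y'Y nn.
apply: le_trans (H u su Y a n2 a0 _ Y' n Y'Y nn); first by rewrite ler_wpM2l// ler_expR lerN2.
by move=> Z m ZY; apply: HY; apply: subset_trans ZY _; exact: setDS.
Qed.

(** [kappa] measures the logarithmic loss and also the time in units of [T]; both are additive, and
    the bound for the second task serves as terminal value for the first. *)
Lemma task_trans (R : realType) (d : nat) (G : set 'rV[int]_d) (eta T : R) x E1 y E2 z k1 k2 :
  task G eta T x E1 y k1 -> task G eta T y E2 z k2 ->
  task G eta T x (E1 `|` E2) z (k1 + k2).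
Proof.
move=> [m1 m1k H1] [m2 m2k H2]; exists (m2 + m1)%N.
  by rewrite natrD !mulrDl addrC lerD.
move=> u su Y a n2 a0 HY Y' n Y'Y nn.
have -> : a * expR (- (k1 + k2)) = a * expR (- k2) * expR (- k1).
  by rewrite opprD expRD; ring.
apply: (H1 u su Y _ (n2 + m2)%N _ _ Y' n Y'Y).
- by rewrite mulr_ge0// expR_ge0.
- move=> Z m ZY mm; apply: (H2 u su (Y `\` E1) a n2 a0 _ Z m ZY mm).
  by move=> Z' m' ZY'; apply: HY; rewrite -setDDl.
- by rewrite -addnA.
Qed.

Lemma task_seq (R : realType) (d : nat) (G : set 'rV[int]_d) (eta T : R) c (I : eqType)
    (s : seq I) (E : I -> set 'rV[int]_d) (k : I -> R) :
  (forall i, i \in s -> task G eta T c (E i) c (k i)) ->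
  task G eta T c [set z | exists2 i, i \in s & E i z] c (\sum_(i <- s) k i).
Proof.
elim: s => [|i s IH] H.
  rewrite big_nil; have [n0 n0T Hc] := task_refl G eta T c; exists n0 => //.
  move=> u su Y a n2 a0 HY; apply: Hc => // Z m ZY; apply: HY.
  by apply: subset_trans ZY _ => z [Yz _]; split => // -[].
rewrite big_cons (_ : [set z | _] = E i `|` [set z | exists2 i, i \in s & E i z]).
  apply: task_trans; first by apply: H; rewrite mem_head.
  by apply: IH => j js; apply: H; rewrite inE js orbT.
apply/seteqP; split=> z /=.
  by move=> [j]; rewrite inE => /predU1P[->|js]; [left|right; exists j].
by move=> [Ez|[j js Ez]]; [exists i => //; rewrite mem_head|exists j => //; rewrite inE js orbT].
Qed.

(** The logarithmic loss is only of order [i]. It is bounded generously by [scale_cost], at least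
    [(3/2)^i], so that travel and covering are booked in the same unit. *)
Lemma task_hop (R : realType) (d : nat) : (2 <= d)%N ->
  exists2 H : R, 0 < H & forall (i : nat) (G : set 'rV[int]_d) (eta T : R) x y,
    0 < eta -> 2 * d%:R * eta <= 1 -> (2 ^ i)%N%:R ^+ 2 <= T ->
    nrm2 R (x - y) <= (2 ^ i)%N%:R ^+ 2 ->
    (forall z, nrm2 R (z - y) < 4 * (2 ^ i)%N%:R ^+ 2 -> G z) ->
    task G eta T x set0 y (H * scale_cost R d i).
Proof.
move=> d2; have [q0 [K0 [/andP[q00 q01] K00 H]]] := hit_estimate R d2.
set p := hit_exponent R d in H.
have d2R : 2 <= d%:R :> R by rewrite (ler_nat _ 2).
have p0 : 0 <= p by rewrite /p /hit_exponent; lra.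
have lq0 : 0 <= ln q0^-1 by rewrite ln_ge0// invf_ge1.
pose B : R := ln q0^-1 + 2 * p.
have B0 : 0 <= B by rewrite addr_ge0// mulr_ge0.
have BK : 0 < K0 + 1 + 2 * B by rewrite ltr_pwDl ?mulr_ge0// addr_gt0.
have cost1 i : 1 <= scale_cost R d i.
  rewrite exprn_ege1//; apply: (@le_trans _ _ (2 ^+ 1 * (3 / 4))); first by lra.
  by rewrite ler_wpM2r// ler_weXn2l//; [lra|lia].
have costi i : i%:R <= 2 * scale_cost R d i :> R.
  apply: (@le_trans _ _ (2 * (3 / 2) ^+ i)); last first.
    rewrite ler_wpM2l// lerXn2r ?nnegrE ?mulr_ge0 ?exprn_ge0//.
    apply: (@le_trans _ _ (2 ^+ 1 * (3 / 4))); first by lra.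
    by rewrite ler_wpM2r// ler_weXn2l//; [lra|lia].
  elim: i => [|i IH]; first by rewrite expr0; lra.
  have x1 : 1 <= (3 / 2 : R) ^+ i by rewrite exprn_ege1//; lra.
  by rewrite exprS -[i.+1%:R]natr1; lra.
exists (K0 + 1 + 2 * B) => // i G eta T x y eta0 eta1 iT xy yG.
have e1' : eta <= 1 by move: d2R eta1 eta0; clear; nra.
set w := (2 ^ i)%N in iT xy yG *.
have w1 : 1 <= w%:R :> R by rewrite ler1n expn_gt0.
have w0 : 0 < w%:R :> R by exact: lt_le_trans ltr01 w1.
have w21 : 1 <= w%:R ^+ 2 :> R by rewrite exprn_ege1.
have KT : 0 <= K0 * w%:R ^+ 2 by rewrite mulr_ge0 ?sqr_ge0// ltW.
have [n0 /andP[n0l n0u]] := nat_ceil_div eta0 KT.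
exists n0.
  apply: le_trans n0u _; apply: (@le_trans _ _ ((K0 + 1) * T)).
    by rewrite mulrDl mul1r lerD ?(le_trans e1')// ?(le_trans w21)// ler_wpM2l// ltW.
  rewrite ler_wpM2r ?(le_trans _ iT)// ?exprn_ge0//.
  apply: (@le_trans _ _ (K0 + 1 + 2 * B)); first by rewrite lerDl mulr_ge0.
  by rewrite ler_peMr// ltW.
move=> u su Y a n2 a0 HY Y' n Y'Y nn.
have Hy Z m : Z `<=` Y `\ y -> (n2 <= m)%N -> a <= u m y Z.
  by move=> ZY; apply: HY; rewrite setD0; apply: subset_trans ZY _; exact: subDsetl.
apply: le_trans (H G eta u Y a n2 n0 y x w%:R eta0 eta1 w1 yG xy su a0 Hy n0l Y' n Y'Y nn).
rewrite ler_wpM2l//.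
have -> : q0 * (w%:R ^+ 2) `^ (- p) = expR (- (ln q0^-1 + p * ln (w%:R ^+ 2))).
  rewrite [X in expR X]opprD expRD -lnV ?posrE ?invr_gt0// invrK lnK ?posrE//; congr (_ * _).
  by rewrite /powR gt_eqF ?exprn_gt0// mulNr.
rewrite ler_expR lerN2 lnXn// mulr2n.
have ln2 : ln 2 <= 1 :> R.
  by rewrite -[leRHS](expRK 1) ler_ln ?posrE ?expR_gt0//; apply: le_trans (expR_ge1Dx _); lra.
have lw : ln w%:R <= i%:R :> R.
  by rewrite /w natrX lnXn// -[leLHS]mulr_natr ler_piMl.
have lnw0 : 0 <= ln w%:R :> R by rewrite ln_ge0.
have := costi i; have := cost1 i; rewrite /B; move: (scale_cost R d i) => s s1 si.
move: (ln w%:R) (ln q0^-1) (p) lw lnw0 lq0 p0 K00 si s1; clear => v z r vi v0 z0 r0 K00 si s1.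
have : r * v <= r * (2 * s) by rewrite ler_wpM2l// (le_trans vi).
nra.
Qed.

(** Forcing the steps one by one costs an amount proportional to the distance, but needs no room
    beyond the coordinate rectangle spanned by the two ends; it serves at the bottom scale only. *)
Lemma task_path (R : realType) (d : nat) : (2 <= d)%N ->
  exists2 K : R, 0 < K & forall (G : set 'rV[int]_d) (eta T : R) (y : 'rV[int]_d) k z,
    0 < eta -> 2 * d%:R * eta <= 1 -> 1 <= T -> nrm1 z = k ->
    (forall z' : 'rV[int]_d, (forall j, (0 <= z' 0 j <= z 0 j) || (z 0 j <= z' 0 j <= 0)) ->
       G (y + z')) ->
    task G eta T (y + z) set0 y (k%:R * K).
Proof.
move=> d2; have d2R : 2 <= d%:R :> R by rewrite (ler_nat _ 2).
have ld : 0 <= ln (4 * d%:R) :> R by rewrite ln_ge0//; move: d2R; clear; lra.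
exists (2 + ln (4 * d%:R)) => [|G eta T y k z eta0 eta1 T1]; first by rewrite ltr_pwDl.
elim: k z => [|k IH] z zk zG.
  have -> : z = 0.
    apply/rowP => i; move/eqP: zk; rewrite /nrm1 sum_nat_eq0 => /forallP/(_ i).
    by rewrite mxE /= absz_eq0 => /eqP.
  rewrite addr0 mul0r; apply: task_weaken (task_refl G eta T y) => //.
  exact: le_trans ler01 T1.
have [z' [[i zi] z'k _ z'z]] := nrm1_gt0_step R zk.
have -> : k.+1%:R * (2 + ln (4 * d%:R)) = (2 + ln (4 * d%:R)) + k%:R * (2 + ln (4 * d%:R)) :> R.
  by rewrite -[k.+1%:R]natr1; ring.
rewrite -[set0](setU0 set0).
apply: (task_trans _ (IH z' z'k _)); last first.
  move=> v vz'; apply: zG => j; have := vz' j; have := z'z j; clear.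
  by move: (v 0 j) (z 0 j) (z' 0 j) => a b c; lia.
have eta1' : eta <= 1 by move: d2R eta0 eta1; clear; nra.
have [n1 /andP[n1e n1u]] := nat_ceil_div eta0 (ler01 : 0 <= (1 : R)).
exists n1.
  apply: le_trans n1u _; apply: (@le_trans _ _ (2 * 1)); first by lra.
  by apply: ler_pM => //; rewrite lerDl.
move=> u su Y a n2 a0 HY Y' n Y'Y nn.
have Gz : G (y + z).
  by apply: zG => j; rewrite !lexx !andbT /=; exact: le_total.
have Hz Z m : Z `<=` Y -> (n2 <= m)%N -> a <= u m (y + z') Z.
  by move=> ZY; apply: HY; rewrite setD0.
apply: le_trans (hit_neighbour (leq_trans _ d2) (ltW eta0) eta1 su a0 Gz _ Hz n1e Y'Y nn) => //.
  rewrite ler_wpM2l// -[leRHS]invrK -(@lnK _ (4 * d%:R)^-1^-1).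
    rewrite -expRN ler_expR lerN2 invrK; lra.
  by rewrite posrE invrK; lra.
by exists i; rewrite -!addrA; case: zi => ->; [left|right].
Qed.

Lemma axis_hop (R : realType) (d : nat) : (2 <= d)%N ->
  exists2 H : R, 0 < H & forall (i : nat) (G : set 'rV[int]_d) (eta T : R) (c x y : 'rV[int]_d) (k : 'I_d),
    0 < eta -> 2 * d%:R * eta <= 1 -> (2 ^ i)%N%:R ^+ 2 <= T ->
    box c (4 * 2 ^ i) `<=` G ->
    (forall j, j != k -> x 0 j = y 0 j) -> `|x 0 k - y 0 k| = (2 ^ i)%N%:Z ->
    (forall j, `|y 0 j - c 0 j| <= (2 * 2 ^ i)%N%:Z) ->
    task G eta T x set0 y (H * scale_cost R d i).
Proof.
move=> d2; have [H H0 HH] := task_hop R d2; exists H => //.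
move=> i G eta T c x y k eta0 eta1 iT cG xy xyk yc; apply: HH => //.
  rewrite /nrm2 (bigD1 k)//= big1 ?addr0 => [|j jk]; last first.
    by rewrite row_subE xy// subrr expr0n.
  by rewrite row_subE -[_ ^+ 2]real_normK ?num_real// -intr_norm xyk.
move=> z; have -> : 4 * (2 ^ i)%N%:R ^+ 2 = (2 * 2 ^ i)%N%:R ^+ 2 :> R.
  by rewrite natrM exprMn; congr (_ * _); rewrite -natrX.
move=> zy; apply: cG => j; have := coord_lt_nrm2 j zy; rewrite row_subE.
by have := yc j; clear; move: (2 ^ i)%N => s; lia.
Qed.

(** Coordinates are changed one at a time, each by two hops of length s = 2^i. A hop needs a ball of
    radius 2s about its target, and all these balls fit into the box of half-width 4s about [c].
    When the centre of a cube is joined to that of a child, this box is the cube itself, so no room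
    beyond the faces is needed. *)
Lemma axis_travel (R : realType) (d : nat) : (2 <= d)%N ->
  exists2 H : R, 0 < H & forall (i : nat) (G : set 'rV[int]_d) (eta T : R) (c : 'rV[int]_d) (s : 'I_d -> bool),
    0 < eta -> 2 * d%:R * eta <= 1 -> (2 ^ i)%N%:R ^+ 2 <= T ->
    box c (4 * 2 ^ i) `<=` G ->
    let y := \row_j (c 0 j + (-1) ^+ s j * (2 * 2 ^ i)%N%:Z) in
    task G eta T c set0 y (H * scale_cost R d i) /\
    task G eta T y set0 c (H * scale_cost R d i).
Proof.
move=> d2; have [H H0 HH] := axis_hop R d2.
exists (2 * d%:R * H) => [|i G eta T c s eta0 eta1 iT cG y].
  by rewrite !mulr_gt0// ltr0n (leq_trans _ d2).
have T0 : 0 <= T by apply: le_trans iT; exact: sqr_ge0.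
pose z (k : nat) : 'rV[int]_d :=
  \row_j (c 0 j + (if (j < k)%N then (-1) ^+ s j * (2 * 2 ^ i)%N%:Z else 0)).
pose m (k : nat) : 'rV[int]_d :=
  \row_j (c 0 j + (if (j < k)%N then (-1) ^+ s j * (2 * 2 ^ i)%N%:Z else
                   if j == k :> nat then (-1) ^+ s j * (2 ^ i)%N%:Z else 0)).
have zE k j : z k 0 j = c 0 j + (if (j < k)%N then (-1) ^+ s j * (2 * 2 ^ i)%N%:Z else 0).
  by rewrite mxE.
have mE k j : m k 0 j = c 0 j + (if (j < k)%N then (-1) ^+ s j * (2 * 2 ^ i)%N%:Z else
                   if j == k :> nat then (-1) ^+ s j * (2 ^ i)%N%:Z else 0).
  by rewrite mxE.
have sgn (j : 'I_d) : ((-1) ^+ s j = 1 :> int) \/ ((-1) ^+ s j = -1 :> int).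
  by case: (s j); [right|left].
have zc k j : `|z k 0 j - c 0 j| <= (2 * 2 ^ i)%N%:Z.
  by rewrite zE; case: (sgn j) => ->; case: ifP => _; clear; move: (2 ^ i)%N => w; lia.
have mc k j : `|m k 0 j - c 0 j| <= (2 * 2 ^ i)%N%:Z.
  by rewrite mE; case: (sgn j) => ->; do ?case: ifP => _; clear; move: (2 ^ i)%N => w; lia.
have mz (k j : 'I_d) : j != k -> m k 0 j = z k 0 j.
  by move=> jk; rewrite zE mE (_ : (j == k :> nat) = false)//; apply/negbTE.
have mz' (k j : 'I_d) : j != k -> m k 0 j = z k.+1 0 j.
  move=> jk; have jk' : (j == k :> nat) = false by exact/negbTE.
  by rewrite zE mE jk' (_ : (j < k.+1)%N = (j < k)%N) // ltnS leq_eqVlt jk'.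
have mzk (k : 'I_d) : `|m k 0 k - z k 0 k| = (2 ^ i)%N%:Z.
  by rewrite zE mE ltnn eqxx; case: (sgn k) => ->; clear; move: (2 ^ i)%N => w; lia.
have mzk' (k : 'I_d) : `|m k 0 k - z k.+1 0 k| = (2 ^ i)%N%:Z.
  by rewrite zE mE ltnn ltnS leqnn eqxx; case: (sgn k) => ->; clear; move: (2 ^ i)%N => w; lia.
set h := scale_cost R d i.
have claim k : (k <= d)%N -> task G eta T c set0 (z k) (k%:R * (2 * H * h)) /\
    task G eta T (z k) set0 c (k%:R * (2 * H * h)).
  elim: k => [|k IH] kd.
    have -> : z 0%N = c by apply/rowP => j; rewrite zE ltn0 addr0.
    by rewrite mul0r; split; apply: task_weaken (task_refl G eta T c).
  have [IH1 IH2] := IH (ltnW kd); pose k' := Ordinal kd.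
  have t1 : task G eta T (z k) set0 (m k) (H * h).
    apply: (HH i G eta T c _ _ k') => // [j jk|]; first exact: (esym (mz k' j jk)).
    by rewrite distrC; exact: (mzk k').
  have t2 : task G eta T (m k) set0 (z k.+1) (H * h).
    apply: (HH i G eta T c _ _ k') => // [j jk|]; first exact: (mz' k' j jk).
    exact: (mzk' k').
  have t3 : task G eta T (z k.+1) set0 (m k) (H * h).
    apply: (HH i G eta T c _ _ k') => // [j jk|]; first exact: (esym (mz' k' j jk)).
    by rewrite distrC; exact: (mzk' k').
  have t4 : task G eta T (m k) set0 (z k) (H * h).
    apply: (HH i G eta T c _ _ k') => // [j jk|]; first exact: (mz k' j jk).
    exact: (mzk k').
  have kE : k.+1%:R * (2 * H * h) = k%:R * (2 * H * h) + (H * h + H * h).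
    by rewrite -natr1; ring.
  rewrite kE; split; first by have := task_trans IH1 (task_trans t1 t2); rewrite !setU0.
  by rewrite addrC; have := task_trans (task_trans t3 t4) IH2; rewrite !setU0.
have -> : y = z d by apply/rowP => j; rewrite zE mxE ltn_ord.
have -> : 2 * d%:R * H * h = d%:R * (2 * H * h) by ring.
exact: claim.
Qed.

(* The cost of the dyadic decomposition of a cube of side [N = 2^J] is charged
   to the sites: a site at distance [l] of a face gets the weight [om J lam l],
   of order [l^(-1-delta)] and hence summable in [l]. *)
Definition om (R : realType) (J lam l : nat) : R :=
  \sum_(i < J.+1) (3 / 8) ^+ i * (l < lam * 2 ^ i)%N%:R.

Definition Om (R : realType) (N J lam x n : nat) : R :=
  \sum_(x <= l < x + n) (om R J lam l + om R J lam (N.-1 - l)).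

Lemma om_ge0 (R : realType) J lam l : 0 <= om R J lam l.
Proof. by apply: sumr_ge0 => i _; rewrite mulr_ge0 ?exprn_ge0. Qed.

Lemma Om_ge0 (R : realType) N J lam x n : 0 <= Om R N J lam x n.
Proof. by apply: sumr_ge0 => i _; rewrite addr_ge0 ?om_ge0. Qed.

Lemma Om_split (R : realType) N J lam x n :
  Om R N J lam x (2 * n) = Om R N J lam x n + Om R N J lam (x + n) n.
Proof.
by rewrite /Om (@big_cat_nat _ _ _ (x + n)%N) ?leq_addr ?leq_add2l ?leq_pmull//=
  -addnA addnn mul2n.
Qed.

(** Each of the 2^j sites of the interval is at distance less than [lam * 2 ^ j] from one and the
    same face, hence has weight at least [(3/8)^j]. *)
Lemma Om_ge (R : realType) N J lam x j : (j <= J)%N -> (0 < lam)%N ->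
  (x + 2 ^ j <= lam * 2 ^ j)%N || (N <= x + lam * 2 ^ j)%N ->
  (3 / 4) ^+ j <= Om R N J lam x (2 ^ j).
Proof.
move=> jJ lam0 near.
have om_j l : (l < lam * 2 ^ j)%N -> (3 / 8) ^+ j <= om R J lam l.
  move=> lj; rewrite /om (bigD1 (inord j))//= inordK// lj mulr1 lerDl.
  by apply: sumr_ge0 => i _; rewrite mulr_ge0 ?exprn_ge0.
have L0 : (0 < lam * 2 ^ j)%N by rewrite muln_gt0 lam0 expn_gt0.
apply: (@le_trans _ _ (\sum_(x <= l < x + 2 ^ j) (3 / 8) ^+ j)).
  rewrite big_const_nat addKn iter_addr_0 -[leRHS]mulr_natl natrX -exprMn.
  by rewrite (_ : 2 * (3 / 8) = 3 / 4)//; field.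
rewrite /Om big_nat [leRHS]big_nat; apply: ler_sum => l /andP[xl lx].
have l0 := om_ge0 R J lam l; have l0' := om_ge0 R J lam (N.-1 - l).
case/orP: near => near.
  by apply: le_trans (om_j l _) _; [exact: leq_trans near|rewrite lerDl].
apply: le_trans (om_j (N.-1 - l)%N _) _; last by rewrite lerDr.
by move: near xl L0; clear; move: (lam * 2 ^ j)%N => L; lia.
Qed.

Lemma sum_om_le (R : realType) J lam N : \sum_(0 <= l < N) om R J lam l <= 4 * lam%:R.
Proof.
rewrite exchange_big/=.
apply: (@le_trans _ _ (\sum_(i < J.+1) lam%:R * (3 / 4) ^+ i)); last first.
  rewrite -mulr_sumr mulrC ler_wpM2r//.
  have := subrX1 (3 / 4 : R) J.+1; have : 0 <= (3 / 4 : R) ^+ J.+1 by rewrite exprn_ge0.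
  by move: (_ ^+ J.+1) => x x0; lra.
apply: ler_sum => i _; rewrite -mulr_sumr.
have -> : lam%:R * (3 / 4) ^+ i = (3 / 8) ^+ i * (lam * 2 ^ i)%N%:R :> R.
  by rewrite natrM natrX mulrCA -exprMn (_ : 3 / 8 * 2 = 3 / 4)//; field.
rewrite ler_wpM2l ?exprn_ge0// -natr_sum ler_nat.
elim: N => [|N IH]; first by rewrite big_geq.
rewrite big_nat_recr//=; move: IH; case: ltnP => [Nl _|]; last by rewrite addn0.
apply: leq_trans Nl; rewrite addn1 ltnS; apply: leq_trans (_ : \sum_(0 <= k < N) 1 <= _)%N.
  by apply: leq_sum => k _; exact: leq_b1.
by rewrite sum_nat_const_nat subn0 muln1.
Qed.

Lemma Om_total (R : realType) J lam N : Om R N J lam 0 N <= 8 * lam%:R.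
Proof.
rewrite /Om add0n big_split/= [X in _ + X]big_nat_rev/= add0n.
have -> : \sum_(0 <= l < N) om R J lam (N.-1 - (N - l.+1)) = \sum_(0 <= l < N) om R J lam l.
  apply: eq_big_nat => l /andP[_ lN]; congr om; lia.
by have := sum_om_le R J lam N; lra.
Qed.

Lemma sum_ffun_bool (R : realType) (d : nat) (f : bool -> R) (i : 'I_d) :
  \sum_(e : {ffun 'I_d -> bool}) f (e i) = 2 ^+ d.-1 * (f false + f true).
Proof.
pose flip (e : {ffun 'I_d -> bool}) := [ffun j => if j == i then ~~ e j else e j].
have flipK : involutive flip.
  by move=> e; apply/ffunP => j; rewrite !ffunE; case: eqP => // _; rewrite negbK.
have d0 : (0 < d)%N by apply: leq_ltn_trans (ltn_ord i).
have E : \sum_(e : {ffun 'I_d -> bool}) f (e i) = \sum_(e : {ffun 'I_d -> bool}) f (~~ e i).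
  rewrite (reindex_inj (inv_inj flipK)); apply: eq_bigr => e _.
  by rewrite ffunE eqxx.
have : \sum_(e : {ffun 'I_d -> bool}) f (e i) + \sum_(e : {ffun 'I_d -> bool}) f (e i) =
    2 ^+ d * (f false + f true).
  rewrite {2}E -big_split/= (eq_bigr (fun=> f false + f true)) => [|e _]; last first.
    by case: (e i) => //=; rewrite addrC.
  by rewrite sumr_const card_ffun card_bool card_ord -[LHS]mulr_natl natrX.
have -> : 2 ^+ d = 2 * 2 ^+ d.-1 :> R by rewrite -exprS (prednK d0).
by rewrite -[2 * _ * _]mulrA; move: (2 ^+ d.-1 * _) => x; lra.
Qed.

(** The total weight of the sites of a cube of side 2^j, summed over the coordinates: each value of
    the i-th coordinate is shared by [(2^j)^(d-1)] sites. In this reading additivity under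
    subdivision is clear. *)
Definition Psi (R : realType) (d N J lam j : nat) (b : 'I_d -> nat) : R :=
  (2 ^+ d.-1) ^+ j * \sum_(i < d) Om R N J lam (b i) (2 ^ j).

Lemma Psi_split (R : realType) (d N J lam j : nat) (b : 'I_d -> nat) :
  \sum_(e : {ffun 'I_d -> bool}) Psi R N J lam j (fun i => b i + e i * 2 ^ j)%N =
  Psi R N J lam j.+1 b.
Proof.
rewrite /Psi -mulr_sumr exchange_big/= exprSr -mulrA; congr (_ * _).
rewrite mulr_sumr; apply: eq_bigr => i _.
rewrite (sum_ffun_bool (fun e : bool => Om R N J lam (b i + e * 2 ^ j) (2 ^ j))).
by rewrite mul0n addn0 mul1n expnS Om_split.
Qed.

Lemma Psi_ge (R : realType) (d N J lam j : nat) (b : 'I_d -> nat) (i : 'I_d) :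
  (j <= J)%N -> (0 < lam)%N ->
  (b i + 2 ^ j <= lam * 2 ^ j)%N || (N <= b i + lam * 2 ^ j)%N ->
  scale_cost R d j <= Psi R N J lam j b.
Proof.
move=> jJ l0 near; rewrite /scale_cost exprMn /Psi ler_wpM2l ?exprn_ge0//.
rewrite (bigD1 i)//= -[leLHS]addr0 lerD ?Om_ge//.
by apply: sumr_ge0 => k _; exact: Om_ge0.
Qed.

Definition crn (d : nat) (g : 'rV[int]_d) (b : 'I_d -> nat) : 'rV[int]_d :=
  \row_i (g 0 i + (b i)%:Z).

(** The centre of the cube of side [2 * 2 ^ j]: the index is that of the half-side. *)
Definition ctr (d : nat) (g : 'rV[int]_d) (b : 'I_d -> nat) (j : nat) : 'rV[int]_d :=
  \row_i (g 0 i + (b i)%:Z + (2 ^ j)%N%:Z).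

Lemma crnE d (g : 'rV[int]_d) b i : crn g b 0 i = g 0 i + (b i)%:Z.
Proof. by rewrite mxE. Qed.

Lemma ctrE d (g : 'rV[int]_d) b j i : ctr g b j 0 i = g 0 i + (b i)%:Z + (2 ^ j)%N%:Z.
Proof. by rewrite mxE. Qed.

Lemma corner_ctr d (g : 'rV[int]_d) b j : corner (ctr g b j) (2 ^ j) = crn g b.
Proof. by apply/rowP => i; rewrite cornerE ctrE crnE addrK. Qed.

Lemma box_ctr_sub d (g : 'rV[int]_d) b j w N :
  (forall i, w <= b i + 2 ^ j)%N -> (forall i, b i + 2 ^ j + w <= N)%N ->
  box (ctr g b j) w `<=` cube g N.
Proof.
move=> wl wu z zb i; have := zb i; rewrite ctrE; have := wl i; have := wu i; clear.
by move: (2 ^ j)%N => s; lia.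
Qed.

Lemma scale_cost_ge1 (R : realType) d j : (2 <= d)%N -> 1 <= scale_cost R d j.
Proof.
move=> d2; apply: exprn_ege1; apply: (@le_trans _ _ (2 ^+ 1 * (3 / 4))); first by lra.
by rewrite ler_wpM2r// ler_weXn2l//; [lra|lia].
Qed.

Lemma le_scale_cost (R : realType) d i j : (2 <= d)%N -> (i <= j)%N ->
  scale_cost R d i <= scale_cost R d j.
Proof.
move=> d2 ij; apply: ler_weXn2l => //.
by have := scale_cost_ge1 R 1 d2; rewrite /scale_cost expr1.
Qed.

(** Bottom of the decomposition: in a cube of side 8 every site is visited by a forced path from the
    centre and back, at a cost depending on the dimension only. *)
Lemma cover_brute (R : realType) (d : nat) : (2 <= d)%N ->
  exists2 K : R, 0 < K & forall N (G : set 'rV[int]_d) (eta T : R) (g : 'rV[int]_d) b,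
    0 < eta -> 2 * d%:R * eta <= 1 -> 1 <= T -> cube (crn g b) 8 `<=` G ->
    N = 8%N ->
    task G eta T (ctr g b 2) (cube (crn g b) N) (ctr g b 2) K.
Proof.
move=> d2; have [K K0 HK] := task_path R d2.
exists ((8 ^ d)%N%:R * (2 * ((d * 8)%N%:R * K))).
  by rewrite !mulr_gt0// ltr0n ?expn_gt0// muln_gt0 (leq_trans _ d2).
move=> N G eta T g b eta0 eta1 T1 DG ->.
have T0 : 0 <= T by exact: le_trans ler01 T1.
have DE z i : cube (crn g b) 8 z -> g 0 i + (b i)%:Z <= z 0 i < g 0 i + (b i)%:Z + 8%:Z.
  by move=> /(_ i); rewrite crnE.
set c := ctr g b 2.
have cD : cube (crn g b) 8 c by move=> i; rewrite crnE ctrE; clear; lia.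
have path x y : cube (crn g b) 8 x -> cube (crn g b) 8 y ->
    task G eta T x set0 y ((d * 8)%N%:R * K).
  move=> xD yD; have -> : x = y + (x - y) by rewrite addrC subrK.
  have kd : (nrm1 (x - y) <= d * 8)%N.
    rewrite /nrm1 -[X in (_ <= X * _)%N](card_ord d) -sum_nat_const leq_sum// => i _.
    by rewrite row_subE; have := DE x i xD; have := DE y i yD; clear; lia.
  apply: task_weaken (HK G eta T y _ (x - y) eta0 eta1 T1 erefl _) => //.
    by rewrite ler_wpM2r ?ler_nat// ltW.
  move=> z' z'xy; apply: DG => i; rewrite row_addE crnE.
  have := z'xy i; rewrite row_subE; have := DE x i xD; have := DE y i yD; clear.
  by move: (x 0 i) (y 0 i) (z' 0 i) (g 0 i) => p q r s; lia.
have Hy y : y \in cube_seq (crn g b) 8 ->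
    task G eta T c [set y] c (2 * ((d * 8)%N%:R * K)).
  move=> ys; have yD : cube (crn g b) 8 y by rewrite -mem_cube_seq.
  have := task_trans (path c y cD yD) (task_trans (task_refl G eta T y) (path y c yD cD)).
  by rewrite setU0 set0U add0r mulr2n mulrDl mul1r.
apply: task_weaken (task_seq Hy) => //.
  move=> z zD; exists z => //.
  by have : [set` cube_seq (crn g b) 8] z; [rewrite mem_cube_seq|].
by rewrite big_const_seq count_predT size_cube_seq iter_addr_0 -[leLHS]mulr_natl.
Qed.

(** The induction runs over cubes lying near a face relative to their side, because only these can
    be charged to the weights. The subtracted multiple of [scale_cost] is a reserve: without it the
    trips between a cube and its 2^d children could not be absorbed, the weights being exactly
    additive. *)
Lemma cover_dyadic (R : realType) (d : nat) : (2 <= d)%N ->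
  exists A A' : R, [/\ 0 < A', A' <= A & forall J (eta : R) (g : 'rV[int]_d),
    0 < eta -> 2 * d%:R * eta <= 1 ->
    forall j (b : 'I_d -> nat), (2 <= j)%N -> (j.+1 <= J)%N ->
    (forall i, b i + 2 ^ j.+1 <= 2 ^ J)%N ->
    (exists i, (b i + 2 ^ j.+1 <= (6 * d).+2 * 2 ^ j.+1)%N ||
               (2 ^ J <= b i + (6 * d).+2 * 2 ^ j.+1)%N) ->
    task (cube g (2 ^ J)) eta ((2 ^ J)%N%:R ^+ 2) (ctr g b j)
      (cube (crn g b) (2 * 2 ^ j)) (ctr g b j)
      (A * Psi R (2 ^ J) J (6 * d).+2 j.+1 b - A' * scale_cost R d j.+1)].
Proof.
move=> d2; have [K K0 HK] := cover_cube R d2.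
have [H H0 HH] := axis_travel R d2; have [B B0 HB] := cover_brute R d2.
exists (4 * H + K + B), (4 * H); split; [by rewrite mulr_gt0| |].
  by rewrite -addrA lerDl addr_ge0 ?ltW.
move=> J eta g eta0 eta1; set N := (2 ^ J)%N; set lam := (6 * d).+2.
set G := cube g N; set T := N%:R ^+ 2.
have N1 : 1 <= N%:R :> R by rewrite ler1n expn_gt0.
have T1 : 1 <= T by rewrite exprn_ege1.
have T0 : 0 <= T by exact: le_trans ler01 T1.
have sT i : (i <= J)%N -> (2 ^ i)%N%:R ^+ 2 <= T.
  by move=> iJ; apply: lerXn2r; rewrite ?nnegrE ?ler_nat ?leq_pexp2l.
(* A cube covered without further subdivision: its weight already dominates its cost, reserve
   included. *)
have direct j (b : 'I_d -> nat) k : (j.+1 <= J)%N -> (exists i, (b i + 2 ^ j.+1 <= lam * 2 ^ j.+1)%N ||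
               (N <= b i + lam * 2 ^ j.+1)%N) -> k <= (K + B) * scale_cost R d j.+1 ->
    k <= (4 * H + K + B) * Psi R N J lam j.+1 b - 4 * H * scale_cost R d j.+1.
  move=> jJ [i near] kk; have := @Psi_ge R d N J lam j.+1 b i jJ isT near.
  move: kk; move: (Psi _ _ _ _ _ _) (scale_cost _ _ _) => p s kk sp.
  have : (4 * H + K + B) * s <= (4 * H + K + B) * p.
    by rewrite ler_wpM2l// !addr_ge0 ?mulr_ge0 ?ltW.
  lra.
elim=> [//|j IH] b j2 jJ bN near.
(* Whitney criterion: the cube is covered at once if the box required by [cover_cube] fits into the
   large cube. *)
have [good|bad] := boolP [forall i, ((6 * d).+1 * 2 ^ j.+1 <= b i + 2 ^ j.+1)%N &&
    (b i + 2 ^ j.+1 + (6 * d).+1 * 2 ^ j.+1 <= N)%N].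
  have cG : box (ctr g b j.+1) ((6 * d).+1 * 2 ^ j.+1) `<=` G.
    by apply: box_ctr_sub => i; move/forallP: good => /(_ i) /andP[].
  have := HK j.+1 G eta T (ctr g b j.+1) j2 eta0 eta1 cG (sT _ (ltnW jJ)).
  rewrite corner_ctr; apply: task_weaken => //.
  apply: direct => //; apply: (@le_trans _ _ (K * scale_cost R d j.+2)).
    by rewrite ler_wpM2l ?(ltW K0)// le_scale_cost.
  by rewrite ler_wpM2r ?(le_trans ler01 (scale_cost_ge1 _ _ _))// lerDl ltW.
have DG : cube (crn g b) (2 * 2 ^ j.+1) `<=` G.
  move=> z zD i; have := zD i; have := bN i; rewrite crnE expnS -/N; clear.
  by move: (2 ^ j.+1)%N => s; lia.
have [j1|j1] := leqP j 1.
  have {j1 j2}j1 : j = 1%N by apply/eqP; rewrite eqn_leq j1.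
  rewrite j1 in DG near jJ *.
  by apply: task_weaken (HB _ G eta T g b eta0 eta1 T1 DG erefl) => //;
    apply: direct => //; rewrite -[leLHS]mulr1; apply: ler_pM;
    rewrite ?(ltW B0) ?scale_cost_ge1 ?lerDr ?(ltW K0).
set c := ctr g b j.+1; set S1 := scale_cost R d j.+1.
pose be (e : {ffun 'I_d -> bool}) i := (b i + e i * 2 ^ j.+1)%N.
have two (n : nat) : (2 ^ n.+1 = 2 * 2 ^ n)%N by rewrite expnS.
(* In a bad cube the centre is less than [6 d + 1] half-sides away from some face. A child's far
   side is at most one half-side further, which is why [lam] is [6 d + 2]. *)
have near' e : exists i, (be e i + 2 ^ j.+1 <= lam * 2 ^ j.+1)%N ||
               (N <= be e i + lam * 2 ^ j.+1)%N.
  move: bad; rewrite negb_forall => /existsP[i]; rewrite negb_and -!ltnNge => bad.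
  exists i; move: bad; rewrite /be /lam; clear; case: (e i); move: (2 ^ j.+1)%N => s;
  rewrite ?mul1n ?mul0n; nia.
have beN e i : (be e i + 2 ^ j.+1 <= N)%N.
  have := bN i; rewrite two /be; clear; case: (e i); rewrite ?mul1n ?mul0n; lia.
have trav e : task G eta T c set0 (ctr g (be e) j) (H * S1) /\
    task G eta T (ctr g (be e) j) set0 c (H * S1).
  have j4 : (4 * 2 ^ j.-1 = 2 ^ j.+1)%N.
    by rewrite -[in RHS](prednK (ltnW j1)) !two mulnA.
  have cG : box c (4 * 2 ^ j.-1) `<=` G.
    by rewrite j4; apply: box_ctr_sub => i; have := bN i; rewrite two; clear; lia.
  have jJ' : (j.-1 <= J)%N by move: jJ; clear; lia.
  have := HH j.-1 G eta T c (fun k => ~~ e k) eta0 eta1 (sT _ jJ') cG.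
  have -> /= : \row_k (c 0 k + (-1) ^+ (~~ e k) * (2 * 2 ^ j.-1)%N%:Z) = ctr g (be e) j.
    apply/rowP => k; rewrite mxE !ctrE /be; move: j4; rewrite two.
    by case: (e k) => /=; rewrite ?mul1n ?mul0n ?expr0 ?expr1; clear;
      move: (2 ^ j)%N (2 ^ j.-1)%N => s s' ss; lia.
  have le : H * scale_cost R d j.-1 <= H * S1.
    by rewrite ler_wpM2l ?(ltW H0)// le_scale_cost//; move: j1; clear; lia.
  by move=> [t1 t2]; split; apply: (task_weaken T0 (@subset_refl _ _) le).
have child (e : {ffun 'I_d -> bool}) : e \in enum {ffun 'I_d -> bool} ->
    task G eta T c (cube (crn g (be e)) (2 * 2 ^ j)) c
      (H * S1 + (4 * H + K + B) * Psi R N J lam j.+1 (be e) - 4 * H * S1 + H * S1).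
  move=> _; have [t1 t2] := trav e.
  have t := IH (be e) j1 (ltnW jJ) (beN e) (near' e).
  have := task_trans (task_trans t1 t) t2.
  by rewrite set0U setU0 !addrA.
have := task_seq child; rewrite big_enum/= => H1.
apply: task_weaken H1 => //.
  move=> z zD; exists [ffun i => g 0 i + (b i)%:Z + (2 ^ j.+1)%N%:Z <= z 0 i].
    by rewrite mem_enum.
  move=> i; have := zD i; rewrite !crnE /be ffunE two.
  case: leP => h; rewrite ?mul1n ?mul0n; move: h; clear; move: (2 ^ j)%N => s; lia.
rewrite (eq_bigr (fun e => (4 * H + K + B) * Psi R N J lam j.+1 (be e) + - (2 * H * S1))); last first.
  by move=> e _; ring.
rewrite big_split/= -mulr_sumr Psi_split lerD2l sumr_const card_ffun card_bool card_ord.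
rewrite mulNrn lerN2.
(* Each child returns a reserve [4 H S1] and uses [2 H S1] for the two trips. The 2^d children leave
   [4 H S1 2^(d-1)], while the parent needs only [3 H S1 2^(d-1)]. *)
have -> : 4 * H * scale_cost R d j.+2 = 3 * H * S1 * 2 ^+ d.-1.
  by rewrite /S1 /scale_cost [X in _ * X = _]exprS; field.
have -> : (2 * H * S1) *+ 2 ^ d = 4 * H * S1 * 2 ^+ d.-1.
  by rewrite -[LHS]mulr_natl natrX -(prednK (ltnW d2)) exprS/=; ring.
rewrite ler_wpM2r ?exprn_ge0// ler_wpM2r ?(le_trans ler01 (scale_cost_ge1 _ _ _))//.
by rewrite ler_wpM2r ?(ltW H0)// ler_nat.
Qed.

Definition centred_cube (d w : nat) : set 'rV[int]_d := cube (corner 0 w) (2 * w).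
Arguments centred_cube : clear implicits.

(** The whole cube is trivially near its own faces, and its total weight is of order [w^(d-1)]
    because the weights along a line have a sum bounded independently of the side. Discounting by
    the rate of staying in the cube extends the bound to every later time. *)
Lemma cover_value (R : realType) (d : nat) : (2 <= d)%N ->
  exists2 C : R, 0 < C & forall (J : nat) (eta : R) (w := (2 ^ J)%N) (G := centred_cube d w),
    (2 <= J)%N -> 0 < eta -> 2 * d%:R * eta <= 1 ->
    exists2 n0 : nat, n0%:R * eta <= C * w%:R ^+ d.+1 &
    forall n, (n0 <= n)%N ->
      expR (- (C * w%:R ^+ d.-1)) * (1 - 9 * d%:R / w%:R ^+ 2 * eta) ^+ n
        <= nn_value G G eta n 0 G.
Proof.
move=> d2; have [A [A' [A'0 AA HA]]] := cover_dyadic R d2.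
pose lam := (6 * d).+2.
pose C1 : R := A * 8 * lam%:R * d%:R * 2 ^+ d.-1.
have A0 : 0 < A by exact: lt_le_trans AA.
have dR : 0 < d%:R :> R by rewrite ltr0n (leq_trans _ d2).
have C10 : 0 < C1 by rewrite !mulr_gt0// exprn_gt0.
exists (4 * C1) => [|J eta w G J2 eta0 eta1]; first by rewrite mulr_gt0.
have w4 : (4 <= w)%N by rewrite (leq_pexp2l (m := 2) (n1 := 2)).
have w4R : 4 <= w%:R :> R by rewrite (ler_nat _ 4).
have w0R : 0 < w%:R :> R by exact: lt_le_trans w4R.
pose b (i : 'I_d) := 0%N.
have bJ i : (b i + 2 ^ J.+1 <= 2 ^ J.+1)%N by [].
have near : exists i, (b i + 2 ^ J.+1 <= lam * 2 ^ J.+1)%N ||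
               (2 ^ J.+1 <= b i + lam * 2 ^ J.+1)%N.
  by exists (Ordinal (leq_trans (isT : 0 < 2)%N d2)); rewrite leq_pmull.
have := HA J.+1 eta (corner 0 w) eta0 eta1 J b J2 (leqnn _) bJ near.
have -> : crn (corner 0 w) b = corner 0 w by apply/rowP => i; rewrite crnE addr0.
have -> : ctr (corner 0 w) b J = 0.
  by apply/rowP => i; rewrite ctrE cornerE !mxE addr0 add0r addNr.
have NE : (2 ^ J.+1 = 2 * w)%N by rewrite expnS.
rewrite -/w NE; set N := (2 * w)%N.
have NR : N%:R = 2 * w%:R :> R by rewrite natrM.
have PsiE : Psi R N J.+1 lam J.+1 b <= 8 * lam%:R * d%:R * 2 ^+ d.-1 * w%:R ^+ d.-1.
  rewrite /Psi exprAC -natrX NE -/N NR exprMn.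
  have -> : 8 * lam%:R * d%:R * 2 ^+ d.-1 * w%:R ^+ d.-1 =
     2 ^+ d.-1 * w%:R ^+ d.-1 * (8 * lam%:R * d%:R) :> R by ring.
  rewrite ler_wpM2l ?mulr_ge0 ?exprn_ge0//.
  apply: (@le_trans _ _ (\sum_(i < d) 8 * lam%:R)); last first.
    by rewrite sumr_const card_ord -[leLHS]mulr_natr.
  by apply: ler_sum => i _; exact: Om_total.
set S := scale_cost R d J.+1; set k := _ - _.
have kC : k <= C1 * w%:R ^+ d.-1.
  apply: (@le_trans _ _ (A * Psi R N J.+1 lam J.+1 b)).
    by rewrite gerBl mulr_ge0// ?(ltW A'0)// (le_trans ler01)// scale_cost_ge1.
  by rewrite /C1 -!mulrA ler_wpM2l ?(ltW A0)// !mulrA.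
move=> [n0 n0k Hn]; exists n0.
  apply: le_trans n0k _; rewrite NR exprMn.
  apply: (@le_trans _ _ (C1 * w%:R ^+ d.-1 * (2 ^+ 2 * w%:R ^+ 2))).
    by rewrite ler_wpM2r// mulr_ge0 ?exprn_ge0.
  have -> : w%:R ^+ d.+1 = w%:R ^+ d.-1 * w%:R ^+ 2 :> R.
    by rewrite -exprD; congr (_ ^+ _); move: d2; clear; lia.
  by rewrite le_eqVlt; apply/orP; left; apply/eqP; ring.
move=> n nn; pose rho := 1 - 9 * d%:R / w%:R ^+ 2 * eta.
have la1 : 9 * d%:R / w%:R ^+ 2 * eta <= 2^-1.
  rewrite mulrAC ler_pdivrMr ?exprn_gt0//.
  by move: eta1 w4R; clear; nra.
have la0 : 0 <= 9 * d%:R / w%:R ^+ 2 * eta by rewrite !mulr_ge0 ?invr_ge0 ?exprn_ge0 ?ltW.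
have rho0 : 0 < rho <= 1 by rewrite /rho; move: la1 la0; clear; lra.
have sV := @nn_value_super R d G G eta (ltW eta0) eta1.
have su' := supersolution_discount (ltW eta0) eta1 rho0 sV.
have boxG : box 0 w `<=` G.
  move=> z zb i; have := zb i; rewrite mxE cornerE mxE subr0.
  by clear; move: (z 0 i) => t; lia.
have base Z m : Z `<=` G `\` G -> (0 <= m)%N -> 1 <= nn_value G G eta m 0 Z / rho ^+ m.
  have [rho0' rho1] := andP rho0.
  rewrite setDv subset0 => -> _; rewrite ler_pdivlMr ?exprn_gt0// mul1r.
  apply: (@stay_in_box R d G eta (nn_value G G eta) 0 w m) => //.
  + by rewrite (leq_trans _ w4).
  + exact: ltW.
  + by move: la1; clear; lra.
  + by move=> z /boxG Gz /=; rewrite asboolT//; split => //; exact: sub0set.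
have := Hn _ su' G 1 0%N ler01 base G n (@subset_refl _ _) nn.
have [rho0' _] := andP rho0.
rewrite mul1r ler_pdivlMr ?exprn_gt0//; apply: le_trans.
rewrite ler_wpM2r ?exprn_ge0 ?(ltW rho0')// ler_expR lerN2 (le_trans kC)//.
by rewrite ler_wpM2r ?exprn_ge0// ler_peMl ?(ltW C10)// ler1n.
Qed.

(** * From the time grid to the range *)

Lemma srw_step_ge0 (R : realType) d k (x y : 'rV[int]_d) : 0 <= srw_step R k x y.
Proof.
elim: k x => [|k IH] x /=; first exact: ler0n.
by rewrite mulr_ge0 ?invr_ge0// sumr_ge0// => i _; rewrite addr_ge0.
Qed.

Lemma srw_step_le1 (R : realType) d k (x y : 'rV[int]_d) : (0 < d)%N -> srw_step R k x y <= 1.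
Proof.
move=> d0; elim: k x => [|k IH] x /=; first by rewrite lern1 leq_b1.
rewrite mulrC ler_pdivrMr ?ltr0n ?muln_gt0// mul1r.
apply: (@le_trans _ _ (\sum_(i < d) 2)); first by apply: ler_sum => i _; rewrite lerD.
by rewrite sumr_const card_ord natrM -[leLHS]mulr_natr.
Qed.

Definition adj_kernel (R : realType) d (x z : 'rV[int]_d) : R :=
  \sum_(i < d) ((x + delta_mx 0 i == z)%:R + (x - delta_mx 0 i == z)%:R).

(** The terms with no jump or one jump are explicit; the rest is at most the probability that a
    Poisson variable of parameter [u = 2 d h] is at least two. *)
Lemma heat_kernel_bounds (R : realType) d (h : R) (x y : 'rV[int]_d) :
  (0 < d)%N -> 0 <= h ->
  0 <= heat_kernel h x y - expR (- (2 * d%:R * h)) * ((x == y)%:R + h * adj_kernel R x y)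
    <= (2 * d%:R * h) ^+ 2.
Proof.
move=> d0 h0; rewrite /heat_kernel natrM; set u := 2 * d%:R * h.
have u0 : 0 <= u by rewrite !mulr_ge0.
have d0R : 0 < d%:R :> R by rewrite ltr0n.
pose c : R := expR (- u); have c0 : 0 < c := expR_gt0 _.
set a := (X in series X).
have a0 n : 0 <= a n.
  by rewrite /a mulr_ge0 ?srw_step_ge0// !mulr_ge0 ?expR_ge0 ?exprn_ge0 ?invr_ge0.
have aE n : a n <= c * exp_coeff u n.
  rewrite (_ : a n = c * exp_coeff u n * srw_step R n x y); last first.
    by rewrite /a /exp_coeff/= -/c mulrA.
  by rewrite ler_piMr ?srw_step_le1// mulr_ge0 ?exp_coeff_ge0// ltW.
have e0 n : 0 <= exp_coeff u n by exact: exp_coeff_ge0.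
have ndS (f : nat -> R) : (forall n, 0 <= f n) -> nondecreasing_seq (series f).
  by move=> f0; apply: nondecreasing_series => *; exact: f0.
have expE n : series (exp_coeff u) n <= expR u.
  by apply: nondecreasing_cvgn_le; [exact: ndS|exact: is_cvg_series_exp_coeff].
have tail n : series a n.+2 <= a 0%N + a 1%N + c * (expR u - 1 - u).
  apply: (@le_trans _ _ (a 0%N + a 1%N + c * (series (exp_coeff u) n.+2 - 1 - u))); last first.
    by rewrite lerD2l ler_wpM2l ?(ltW c0)// !lerD2r.
  have split2 (f : nat -> R) : \sum_(0 <= i < n.+2) f i = f 0%N + (f 1%N + \sum_(0 <= i < n) f i.+2).
    by rewrite big_nat_recl// big_nat_recl.
  rewrite /series/= !split2 -[leRHS]addrA lerD2l lerD2l.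
  rewrite (_ : exp_coeff u 0%N = 1); last by rewrite /exp_coeff/= expr0 fact0 divr1.
  rewrite (_ : exp_coeff u 1%N = u); last by rewrite /exp_coeff/= expr1 factS fact0 divr1.
  rewrite (_ : 1 + (u + _) - 1 - u = \sum_(0 <= i < n) exp_coeff u i.+2); last by ring.
  by rewrite mulr_sumr; apply: ler_sum => i _; exact: aE.
have cva : cvgn (series a).
  apply: nondecreasing_is_cvgn; first exact: ndS.
  exists (a 0%N + a 1%N + c * (expR u - 1 - u)) => _ [n _ <-].
  by apply: le_trans (tail n); apply: ndS => //; rewrite -addn2 leq_addr.
have a0E : a 0%N = c * (x == y)%:R.
  by rewrite /a/= expr0 ?fact0 divr1 mulr1.
have a1E : a 1%N = c * (h * adj_kernel R x y).
  rewrite /a/= expr1 divr1 -/c -!mulrA; congr (_ * _).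
  rewrite /adj_kernel; move: (\sum_(i < d) _) => s; rewrite /u natrM.
  by field; rewrite gt_eqF.
have sE : c * ((x == y)%:R + h * adj_kernel R x y) = series a 2.
  by rewrite /series/= !big_nat_recl// big_geq// addr0 a0E a1E mulrDr.
rewrite sE subr_ge0 nondecreasing_cvgn_le//=; last exact: ndS.
rewrite lerBlDl; apply: limr_le => //; near=> n.
have -> : n = n.-2.+2 by rewrite -subn2 -addn2 subnK//; near: n; exists 2%N.
apply: le_trans (tail _) _.
rewrite (_ : series a 2 = a 0%N + a 1%N); last first.
  by rewrite /series/= !big_nat_recl// big_geq// addr0.
rewrite lerD2l !mulrBr mulr1 -expRD addNr expR0.
(* The Poisson tail is [1 - c (1 + u) <= 1 - (1 - u)(1 + u) = u^2]. *)
have : 1 - u <= c by apply: le_trans (expR_ge1Dx _).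
by move: (c) => t; clear -u0; nra.
Unshelve. all: by end_near. Qed.

(** The analogue of [nn_value] for a general kernel. The heat kernel reaches every site in one step,
    so killing outside a finite list is what keeps the sums finite. *)
Fixpoint path_value (R : realType) (d : nat) (p : 'rV[int]_d -> 'rV[int]_d -> R)
    (D : seq 'rV[int]_d) (n : nat) (x : 'rV[int]_d) (Y : set 'rV[int]_d) : R :=
  if n is m.+1 then
    (x \in D)%:R * \sum_(z <- D) p x z * path_value p D m z (Y `\ x)
  else ((x \in D) && `[< Y `<=` [set x] >])%:R.

Lemma sum_adj_kernel (R : realType) d (D : seq 'rV[int]_d) (f : 'rV[int]_d -> R) x :
  uniq D -> (forall z, z \notin D -> f z = 0) ->
  \sum_(z <- D) adj_kernel R x z * f z =
  \sum_(i < d) (f (x + delta_mx 0 i) + f (x - delta_mx 0 i)).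
Proof.
move=> uD fD.
have pick y : \sum_(z <- D) (y == z)%:R * f z = f y.
  have [yD|yD] := boolP (y \in D).
    rewrite (bigD1_seq y)//= eqxx mul1r big1 ?addr0// => z zy.
    by rewrite eq_sym (negbTE zy) mul0r.
  rewrite fD// big1_seq// => z /andP[_ zD]; case: eqVneq => [yz|_]; last by rewrite mul0r.
  by rewrite yz zD in yD.
under eq_bigr do rewrite /adj_kernel mulr_suml.
rewrite exchange_big/=; apply: eq_bigr => i _.
by under eq_bigr do rewrite mulrDl; rewrite big_split/= !pick.
Qed.

Lemma sum_delta_kernel (R : realType) d (D : seq 'rV[int]_d) (f : 'rV[int]_d -> R) x :
  uniq D -> x \in D -> \sum_(z <- D) (x == z)%:R * f z = f x.
Proof.
move=> uD xD; rewrite (bigD1_seq x)//= eqxx mul1r big1 ?addr0// => z zy.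
by rewrite eq_sym (negbTE zy) mul0r.
Qed.

Lemma path_value_ge0 (R : realType) d p (D : seq 'rV[int]_d) n x Y :
  (forall x y, 0 <= p x y :> R) -> 0 <= path_value p D n x Y.
Proof.
move=> p0; elim: n x Y => [|n IH] x Y /=; first exact: ler0n.
by rewrite mulr_ge0// sumr_ge0// => z _; rewrite mulr_ge0.
Qed.

Lemma adj_kernel_ge0 (R : realType) d (x z : 'rV[int]_d) : 0 <= adj_kernel R x z.
Proof. by apply: sumr_ge0 => i _; rewrite addr_ge0. Qed.

Lemma heat_kernel_ge0 (R : realType) d (h : R) (x y : 'rV[int]_d) :
  (0 < d)%N -> 0 <= h -> 0 <= heat_kernel h x y.
Proof.
move=> d0 h0; have /andP[] := heat_kernel_bounds x y d0 h0; rewrite subr_ge0 => + _.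
apply: le_trans; apply: mulr_ge0; first exact: expR_ge0.
by rewrite addr_ge0 ?mulr_ge0 ?adj_kernel_ge0.
Qed.

(* The heat kernel for the time [h] dominates one step of the lazy nearest
   neighbour walk of parameter [eta = h / (1 + 2 d h)], up to the factor
   [exp(- 2dh) (1 + 2dh) = 1 - O(h^2)]. *)
Lemma nn_value_le_path_value (R : realType) d (D : seq 'rV[int]_d) (h : R)
    (eta := h / (1 + 2 * d%:R * h)) (r := expR (- (2 * d%:R * h)) * (1 + 2 * d%:R * h)) n x Y :
  (0 < d)%N -> 0 <= h -> uniq D ->
  r ^+ n * nn_value [set` D] [set` D] eta n x Y <= path_value (@heat_kernel R d h) D n x Y.
Proof.
move=> d0 h0 uD; pose G := [set` D].
have u1 : 0 < 1 + 2 * d%:R * h by rewrite ltr_pwDl// !mulr_ge0.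
have eta0 : 0 <= eta by rewrite divr_ge0// ltW.
have eta1 : 2 * d%:R * eta <= 1.
  by rewrite /eta mulrA ler_pdivrMr// mul1r lerDr.
have r0 : 0 <= r by rewrite mulr_ge0 ?expR_ge0// ltW.
have [V0 _ _] := @nn_value_super R d G G eta eta0 eta1.
have Vout n' z Z : z \notin D -> nn_value G G eta n' z Z = 0.
  by move=> zD; case: n' => [|n'] /=; rewrite asboolF// /G/=; [case=> zD'; rewrite zD' in zD|exact/negP].
elim: n x Y => [|n IH] x Y.
  rewrite expr0 mul1r /= ler_nat; case: asboolP => // -[xD _ YS].
  by rewrite (asboolT YS) andbT (xD : x \in D).
have [xD|xD] := boolP (x \in D); last first.
  by rewrite Vout// mulr0 path_value_ge0// => u v; exact: heat_kernel_ge0.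
rewrite /= asboolT// xD mul1r.
set f := fun z => nn_value G G eta n z (Y `\ x).
have f0 z : 0 <= f z by exact: V0.
apply: (@le_trans _ _ (\sum_(z <- D) (r * ((1 - 2 * d%:R * eta) * (x == z)%:R + eta * adj_kernel R x z))
    * (r ^+ n * f z))).
  have -> : \sum_(z <- D) (r * ((1 - 2 * d%:R * eta) * (x == z)%:R + eta * adj_kernel R x z))
    * (r ^+ n * f z) = r ^+ n.+1 * \sum_(z <- D) ((1 - 2 * d%:R * eta) * ((x == z)%:R * f z)
       + eta * (adj_kernel R x z * f z)).
    by rewrite mulr_sumr; apply: eq_bigr => z _; rewrite exprS; ring.
  rewrite big_split/= -!mulr_sumr sum_delta_kernel// sum_adj_kernel//.
  by move=> z zD; rewrite /f Vout.
apply: ler_sum => z _; apply: ler_pM; last exact: IH.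
- by rewrite mulr_ge0// addr_ge0// mulr_ge0 ?subr_ge0 ?adj_kernel_ge0.
- by rewrite mulr_ge0 ?exprn_ge0.
- have /andP[] := heat_kernel_bounds x z d0 h0; rewrite subr_ge0 => + _; apply: le_trans.
  rewrite le_eqVlt; apply/orP; left; apply/eqP; rewrite /r /eta.
  by field; rewrite gt_eqF.
Qed.

(** * Grid events and the measurability of the range *)

Lemma measurable_site (R : realType) d (s : {nonneg R}) (x : 'rV[int]_d) :
  measurable [set w : path_space R d | path_fun w s = x].
Proof. by apply: sub_sigma_algebra; exists s, x. Qed.

Definition start (R : realType) (d : nat) (w : path_space R d) : 'rV[int]_d :=
  path_fun w (NngNum (lexx 0)).

Lemma srw_starts_at_origin (R : realType) d (P : probability (path_space R d) R) :
  is_srw_law P -> P [set w : path_space R d | start w <> 0] = 0%E.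
Proof.
move=> PL; pose Z := [set w : path_space R d | start w = 0].
have -> : [set w : path_space R d | start w <> 0] = ~` Z by [].
have mZ : measurable Z by exact: measurable_site.
have PZ : P Z = 1%E.
  pose t (_ : nat) : {nonneg R} := NngNum (lexx 0).
  have <- : [set w : path_space R d | forall i, (i <= 0)%N -> path_fun w (t i) = 0] = Z.
    by apply/seteqP; split=> w wZ; [exact: (wZ 0%N)|move=> i _; exact: wZ].
  have t0 : t 0%N = 0%:nng by exact/val_inj.
  by rewrite (PL 0%N t (fun=> 0) t0)// big_ord0.
by rewrite probability_setC// PZ subee.
Qed.

Lemma measurable_prefix (R : realType) d (t : nat -> {nonneg R}) (x : nat -> 'rV[int]_d) n :
  measurable [set w : path_space R d | forall i, (i <= n)%N -> path_fun w (t i) = x i].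
Proof.
rewrite (_ : [set w | _] = \bigcap_(i in [set i | (i <= n)%N])
  [set w : path_space R d | path_fun w (t i) = x i]); last first.
  by apply/seteqP; split=> w H i /=; apply: H.
by apply: bigcap_measurableType => i _; exact: measurable_site.
Qed.

Lemma measure_seq_union (R : realType) (dT : measure_display) (T : measurableType dT)
    (P : {measure set T -> \bar R}) (I : choiceType) (s : seq I) (F : I -> set T) :
  uniq s -> (forall i, i \in s -> measurable (F i)) ->
  (forall i j, i != j -> F i `&` F j = set0) ->
  measurable [set w | exists2 i, i \in s & F i w] /\
  P [set w | exists2 i, i \in s & F i w] = (\sum_(i <- s) P (F i))%E.
Proof.
elim: s => [|i s IH] /= us mF dF.
  rewrite big_nil (_ : [set w | _] = set0); last by apply/seteqP; split=> w // [].
  split; first exact: measurable0.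
  by rewrite measure0.
have [iNs us'] := andP us.
have [mI PI] := IH us' (fun j js => mF j (mem_behead (s := i :: s) js)) dF.
have mi : measurable (F i) by apply: mF; rewrite mem_head.
rewrite (_ : [set w | _] = F i `|` [set w | exists2 j, j \in s & F j w]); last first.
  apply/seteqP; split=> w /=.
    by move=> [j]; rewrite inE => /predU1P[->|js]; [left|right; exists j].
  by move=> [Fi|[j js Fj]]; [exists i; rewrite ?mem_head|exists j => //; rewrite inE js orbT].
have dU : F i `&` [set w | exists2 j, j \in s & F j w] = set0.
  apply/seteqP; split=> w // -[Fi [j js Fj]].
  have : (F i `&` F j) w by [].
  by rewrite dF//; apply: contra iNs => /eqP ->.
split; first exact: measurableU.
by rewrite measureU// big_cons; congr (_ + _)%E; exact: PI.
Qed.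

Definition grid (R : realType) (h : {nonneg R}) (i : nat) : {nonneg R} := (i%:R * h%:num)%:nng.

(** The trajectory is prescribed up to time [m] and constrained for [n] more steps. With this prefix
    the recursion of [path_value] follows by splitting according to the next site, until only
    cylinder events of known probability remain; no Markov property is invoked. *)
Definition grid_event (R : realType) d (h : {nonneg R}) (D : seq 'rV[int]_d)
    (m n : nat) (x : nat -> 'rV[int]_d) (Y : set 'rV[int]_d) : set (path_space R d) :=
  [set w | [/\ forall i, (i <= m)%N -> path_fun w (grid h i) = x i,
     forall i, (m <= i <= m + n)%N -> path_fun w (grid h i) \in D &
     forall y, Y y -> exists2 i, (m <= i <= m + n)%N & path_fun w (grid h i) = y]].

Lemma grid_event_law (R : realType) d (P : probability (path_space R d) R)
    (h : {nonneg R}) (D : seq 'rV[int]_d) : is_srw_law P -> uniq D ->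
  forall n m x Y, x 0%N = 0 ->
  measurable (grid_event h D m n x Y) /\
  P (grid_event h D m n x Y) =
    ((\prod_(i < m) heat_kernel h%:num (x i) (x i.+1)) *
      path_value (@heat_kernel R d h%:num) D n (x m) Y)%:E.
Proof.
move=> PL uD; elim=> [|n IH] m x Y x0.
  have E (w : path_space R d) : grid_event h D m 0 x Y w <->
      (forall i, (i <= m)%N -> path_fun w (grid h i) = x i) /\
      (x m \in D) && `[< Y `<=` [set x m] >].
    rewrite /grid_event/= addn0; split=> [[wx wD wY]|[wx /andP[xD /asboolP YS]]].
      split=> //; rewrite -(wx m)// wD ?leqnn//=; apply/asboolP => y /wY[i].
      by rewrite -eqn_leq => /eqP <- <-; rewrite wx.
    split=> // [i|y /YS/= ->]; first by rewrite -eqn_leq => /eqP <-; rewrite wx.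
    by exists m; rewrite ?leqnn ?wx.
  rewrite /=; case: ((x m \in D) && _) E => E; last first.
    rewrite (_ : grid_event _ _ _ _ _ _ = set0); last first.
      by apply/seteqP; split=> w // /E[].
    by rewrite mulr0 measure0; split; first exact: measurable0.
  rewrite (_ : grid_event _ _ _ _ _ _ =
    [set w : path_space R d | forall i, (i <= m)%N -> path_fun w (grid h i) = x i]); last first.
    by apply/seteqP; split=> w; [case/E|move=> ?; apply/E].
  split; first exact: measurable_prefix.
  rewrite (PL m (grid h) x)//.
  - rewrite mulr1; congr (_%:E); apply: eq_bigr => i _.
    by rewrite (_ : (grid h i.+1)%:num - (grid h i)%:num = h%:num)//= -natr1; ring.
  - by apply/val_inj; rewrite /= mul0r.
  - by move=> i /=; rewrite ler_wpM2r// ler_nat.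
pose xz z i := if i == m.+1 then z else x i.
have xz0 z : xz z 0%N = 0 by rewrite /xz/= x0.
have xzm z i : (i <= m)%N -> xz z i = x i.
  by move=> im; rewrite /xz ltn_eqF.
have [xD|xD] := boolP (x m \in D); last first.
  rewrite /= (negbTE xD) mul0r mulr0 (_ : grid_event _ _ _ _ _ _ = set0).
    by rewrite measure0; split; first exact: measurable0.
  apply/seteqP; split=> w // -[wx wD _].
  by move: (wD m); rewrite leqnn leq_addr wx// (negbTE xD) => /(_ isT).
have E : grid_event h D m n.+1 x Y =
   [set w | exists2 z, z \in D & grid_event h D m.+1 n (xz z) (Y `\ x m) w].
  apply/seteqP; split=> w.
    move=> [wx wD wY]; exists (path_fun w (grid h m.+1)).
      by apply: wD; rewrite leqnSn addnS ltnS leq_addr.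
    split=> [i|i /andP[mi im]|y [/wY[i /andP[mi im] wi] yx]].
    - rewrite leq_eqVlt => /predU1P[->|]; first by rewrite /xz eqxx.
      by rewrite ltnS => im; rewrite xzm// wx.
    - by apply: wD; rewrite (ltnW mi)/= addnS -addSn.
    - exists i => //; rewrite addSn -addnS im andbT ltn_neqAle mi andbT.
      by apply/eqP => mE; apply: yx; rewrite -wi -mE wx.
  move=> [z zD [wx wD wY]]; split=> [i im|i /andP[mi im]|y Yy].
  - by rewrite wx ?xzm// leqW.
  - move: mi; rewrite leq_eqVlt => /predU1P[<-|mi].
      by rewrite wx ?xzm.
    by apply: wD; rewrite mi addSn -addnS.
  - have [->|yx] := eqVneq y (x m).
      by exists m; [rewrite leqnn leq_addr|rewrite wx ?xzm].
    have [|i /andP[mi im] wi] := wY y; first by split => //; exact/eqP.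
    by exists i => //; rewrite (ltnW mi)/= addnS -addSn.
rewrite E; have [|i j ij|mE ->] := @measure_seq_union R _ _ P _ D
    (fun z => grid_event h D m.+1 n (xz z) (Y `\ x m)) uD.
- by move=> z _; have [] := IH m.+1 (xz z) (Y `\ x m) (xz0 z).
- apply/seteqP; split=> w // -[[wi _ _] [wj _ _]].
  by move: ij; have := wi m.+1 (leqnn _); rewrite wj// /xz eqxx => ->; rewrite eqxx.
split => //; rewrite /= xD mul1r mulr_sumr -sumEFin; apply: eq_bigr => z _.
have [_ ->] := IH m.+1 (xz z) (Y `\ x m) (xz0 z); congr (_%:E).
rewrite big_ord_recr/= (_ : xz z m.+1 = z); last by rewrite /xz eqxx.
rewrite (xzm z m)// -[LHS]mulrA; congr (_ * _).
by apply: eq_bigr => i _; rewrite !xzm// ltnW.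
Qed.

Definition grid_cover (R : realType) d (h : {nonneg R}) (D : seq 'rV[int]_d)
    (n : nat) (Y : set 'rV[int]_d) : set (path_space R d) :=
  [set w | (forall i, (i <= n)%N -> path_fun w (grid h i) \in D) /\
     (forall y, Y y -> exists2 i, (i <= n)%N & path_fun w (grid h i) = y)].

Lemma grid_cover_law (R : realType) d (P : probability (path_space R d) R)
    (h : {nonneg R}) (D : seq 'rV[int]_d) n Y : is_srw_law P -> uniq D ->
  measurable (grid_cover h D n Y) ->
  P (grid_cover h D n Y) = (path_value (@heat_kernel R d h%:num) D n 0 Y)%:E.
Proof.
move=> PL uD mC.
have [mE PE] := grid_event_law h PL uD n 0%N Y (erefl : (fun=> 0 : 'rV[int]_d) 0%N = 0).
rewrite big_ord0 mul1r in PE; rewrite -PE; apply/eqP; rewrite eq_le; apply/andP; split.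
  have mZ : measurable [set w : path_space R d | start w <> 0].
    by apply: measurableC; exact: measurable_site.
  apply: (@le_trans _ _ (P (grid_event h D 0 n (fun=> 0) Y `|` [set w | start w <> 0]))).
    apply: le_measure; rewrite ?inE//; first exact: measurableU.
    move=> w [wD wY]; have [w0|] := pselect (start w = 0); last by right.
    left; split=> // i; rewrite leqn0 => /eqP ->; rewrite -w0; congr (path_fun w _).
    by apply/val_inj; rewrite /= mul0r.
  apply: le_trans (measureU2 _ _ _) _ => //.
  by rewrite [X in (_ + X)%E](_ : _ = 0%E) ?adde0; last exact: srw_starts_at_origin.
apply: le_measure; rewrite ?inE// => w [_ wD wY]; split=> [i im|y /wY[i im wi]].
  exact: wD.
by exists i.
Qed.

Definition dyadic_mesh (R : realType) (t : {nonneg R}) (k : nat) : {nonneg R} :=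
  (t%:num * (2 ^+ k)^-1)%:nng.

Lemma dyadic_mesh_last (R : realType) (t : {nonneg R}) k :
  (grid (dyadic_mesh t k) (2 ^ k))%:num = t%:num.
Proof. by rewrite /= natrX mulrC -mulrA mulVf ?mulr1// expf_neq0. Qed.

Lemma dyadic_mesh_lt (R : realType) (t : {nonneg R}) (e : R) : 0 < e ->
  exists k0, forall k, (k0 <= k)%N -> (dyadic_mesh t k)%:num < e.
Proof.
move=> e0; exists (Num.truncn (t%:num / e)).+1 => k kk /=.
have t0 : 0 <= t%:num / e by rewrite divr_ge0// ltW.
rewrite ltr_pdivrMr ?exprn_gt0// mulrC -ltr_pdivrMr//.
have /andP[_ h] := truncn_itv t0; apply: (lt_le_trans h).
by rewrite -natrX ler_nat (leq_trans kk)// ltnW// ltn_expl.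
Qed.

Lemma walk_range_dyadic (R : realType) d (w : walk_path R d) (t : {nonneg R}) v :
  walk_range w t%:num v <->
  exists k, exists2 i, (i <= 2 ^ k)%N & path_fun w (grid (dyadic_mesh t k) i) = v.
Proof.
split=> [[s st wsv]|[k [i ik wv]]]; last first.
  exists (grid (dyadic_mesh t k) i) => //; rewrite -(dyadic_mesh_last t k) /=.
  by rewrite ler_wpM2r// ler_nat.
have [rc _] := path_nn w.
(* The time [t] itself has no grid point to its right within the horizon, but it belongs to every
   grid; earlier times are handled by right-continuity. *)
move: st; rewrite le_eqVlt => /orP[/eqP st|st].
  exists 0%N, 1%N => //; rewrite -wsv; congr (path_fun w _); apply/val_inj.
  by rewrite /= st expr0 invr1 mulr1 mul1r.
have t0 : 0 < t%:num by apply: le_lt_trans st.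
have [e e0 we] := rc s.
have me : 0 < Num.min e (t%:num - s%:num) by rewrite lt_min e0 subr_gt0.
have [k /(_ k (leqnn _))] := dyadic_mesh_lt t me; rewrite lt_min => /andP[he hts].
have h0 : 0 < (dyadic_mesh t k)%:num by rewrite /= divr_gt0// exprn_gt0.
have [i /andP[si ish]] := nat_ceil_div h0 (ge0 s).
exists k, i.
  rewrite -(ler_nat R) -(ler_pM2r h0); have := dyadic_mesh_last t k; rewrite /= => ->.
  by move: hts ish => /=; lra.
rewrite -wsv; apply: we => /=; rewrite si/=.
by move: he ish => /=; lra.
Qed.

Lemma measurable_in_range (R : realType) d (t : {nonneg R}) (v : 'rV[int]_d) :
  measurable [set w : path_space R d | walk_range w t%:num v].
Proof.
rewrite (_ : [set w | _] = \bigcup_k \bigcup_(i in [set i | (i <= 2 ^ k)%N])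
  [set w : path_space R d | path_fun w (grid (dyadic_mesh t k) i) = v]); last first.
  apply/seteqP; split=> w /=.
    by move=> /walk_range_dyadic[k [i ik wv]]; exists k => //; exists i.
  by move=> [k _ [i ik wv]]; apply/walk_range_dyadic; exists k; exists i.
by apply: bigcupT_measurable => k; apply: bigcup_measurable => i _; exact: measurable_site.
Qed.

(** The range takes its values among the finite subsets of the lattice, which are countably many;
    hence any property whatsoever of the range is an event. *)
Lemma measurable_range (R : realType) d (t : {nonneg R}) (Phi : set 'rV[int]_d -> Prop) :
  measurable [set w : path_space R d | Phi (walk_range w t%:num)].
Proof.
rewrite (_ : [set w | _] = \bigcup_(F : {fset 'rV[int]_d})
  [set w : path_space R d | walk_range w t%:num = [set` F] /\ Phi [set` F]]); last first.
  apply/seteqP; split=> w /=.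
    move=> Pw; exists (fset_set (walk_range w t%:num)) => //=.
    by rewrite fset_setK//; exact: finite_walk_range.
  by move=> [F _ /= [-> ]].
apply: countable_bigcupT_measurable => // F.
have [PF|nPF] := pselect (Phi [set` F]); last first.
  by rewrite (_ : [set w | _] = set0)//; apply/seteqP; split=> w // [].
rewrite (_ : [set w | _] = ~` \bigcup_(v : 'rV[int]_d)
  (if v \in F then ~` [set w : path_space R d | walk_range w t%:num v]
   else [set w : path_space R d | walk_range w t%:num v])); last first.
  apply/seteqP; split=> w /=.
    by move=> [wF _] [v _]; case: ifPn => vF /=; rewrite wF /= => vF'; [exact: vF'|move/negP: vF].
  move=> H; split=> //; apply/seteqP; split=> v /= vR; apply: contrapT => vF; apply: H;
    exists v => //.
    by rewrite ifN//; apply/negP.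
  by rewrite ifT.
apply: measurableC; apply: countable_bigcupT_measurable => // v.
by case: ifP => _; [apply: measurableC|]; exact: measurable_in_range.
Qed.

Lemma measurable_grid_cover (R : realType) d (h : {nonneg R}) (D : seq 'rV[int]_d) n Y :
  measurable (grid_cover h D n Y).
Proof.
rewrite (_ : grid_cover _ _ _ _ =
  (\bigcap_(i in [set i | (i <= n)%N])
     \bigcup_(v in [set` D]) [set w : path_space R d | path_fun w (grid h i) = v]) `&`
  ~` \bigcup_(v : 'rV[int]_d) (if `[< Y v >] then
     \bigcap_(i in [set i | (i <= n)%N]) ~` [set w : path_space R d | path_fun w (grid h i) = v]
     else set0)); last first.
  apply/seteqP; split=> w /=.
    move=> [wD wY]; split=> [i /wD wi|]; first by exists (path_fun w (grid h i)).
    move=> [v _]; case: asboolP => // /wY[i im wi] /(_ i im).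
    exact.
  move=> [wD wY]; split=> [i /wD[v vD /= ->]//|y Yy].
  apply: contrapT => H; apply: wY; exists y => //; rewrite asboolT// => i im /= wi.
  by apply: H; exists i.
apply: measurableI.
  apply: bigcap_measurableType => i _.
  apply: fin_bigcup_measurable => // v _; exact: measurable_site.
apply: measurableC; apply: countable_bigcupT_measurable => // v.
case: ifP => // _; apply: bigcap_measurableType => i _; apply: measurableC.
exact: measurable_site.
Qed.

(** On refining grids, staying in [D] is a decreasing event while covering [D] is an increasing one.
    Replacing the second by the mesh-free event [V] gives events [A k] that decrease to the desired
    one and contain the grid events. *)
Lemma range_law_ge (R : realType) d (P : probability (path_space R d) R) (t : {nonneg R})
    (D : seq 'rV[int]_d) (c : R) (k0 : nat) :
  (forall k, (k0 <= k)%N ->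
     (c%:E <= P (grid_cover (dyadic_mesh t k) D (2 ^ k) [set` D]))%E) ->
  (c%:E <= P [set w | walk_range w t%:num = [set` D]])%E.
Proof.
move=> Hc; pose V := [set w : path_space R d | [set` D] `<=` walk_range w t%:num].
have mV : measurable V by exact: (@measurable_range R d t (fun S => [set` D] `<=` S)).
pose A k := grid_cover (dyadic_mesh t k) D (2 ^ k) set0 `&` V.
have mA k : measurable (A k) by apply: measurableI => //; exact: measurable_grid_cover.
have AE : \bigcap_k A k = [set w | walk_range w t%:num = [set` D]].
  apply/seteqP; split=> w.
    move=> H; apply/seteqP; split; last by have [] := H 0%N I.
    move=> v /walk_range_dyadic[k [i ik <-]].
    by have [[wD _] _] := H k I; exact: wD.
  move=> /= wD k _; split; last by rewrite /V/= wD.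
  split=> // i ik; have : [set` D] (path_fun w (grid (dyadic_mesh t k) i)) by
    rewrite -wD; apply/walk_range_dyadic; exists k; exists i.
  by [].
have Adec : nonincreasing_seq A.
  apply/nonincreasing_seqP => k; apply/subsetPset => w [[wD _] wV]; split=> //; split=> // i ik.
  rewrite (_ : grid (dyadic_mesh t k) i = grid (dyadic_mesh t k.+1) (2 * i)).
    by apply: wD; rewrite expnS leq_mul2l.
  by apply/val_inj; rewrite /= natrM exprS; field; rewrite expf_neq0.
have := @nonincreasing_cvg_mu _ _ _ P A _ mA _ Adec; rewrite AE => cvP.
apply: (@cvge_to_ge _ _ _ _ _ _ _ (cvP _ _)).
- apply: le_lt_trans (probability_le1 P (mA 0%N)) _; exact: ltry.
- exact: (@measurable_range R d t (fun S => S = [set` D])).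
near=> k; apply: le_trans (Hc k _) _; first by near: k; exact: nbhs_infty_ge.
apply: le_measure; rewrite ?inE//; first exact: measurable_grid_cover.
move=> w [wD wY]; split; first by split.
by move=> v /wY[i ik wv]; apply/walk_range_dyadic; exists k; exists i.
Unshelve. all: by end_near. Qed.

Lemma centred_cube_seq d w : [set` undup (cube_seq (corner (0 : 'rV[int]_d) w) (2 * w))] = centred_cube d w.
Proof. by rewrite /centred_cube -mem_cube_seq; apply/seteqP; split=> z /=; rewrite mem_undup. Qed.

Lemma range_cube_prob (R : realType) (d : nat) : (2 <= d)%N ->
  exists2 C : R, 0 < C & forall (P : probability (path_space R d) R) (J : nat) (t : {nonneg R})
      (w := (2 ^ J)%N), is_srw_law P -> (2 <= J)%N -> C * w%:R ^+ d.+1 <= t%:num ->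
    ((expR (- (1 + C * w%:R ^+ d.-1 + C * t%:num / w%:R ^+ 2)))%:E <=
      P [set v | walk_range v t%:num = centred_cube d w])%E.
Proof.
move=> d2; have [C0 C00 HC] := cover_value R d2.
have d2R : 2 <= d%:R :> R by rewrite (ler_nat _ 2).
have d0 : 0 < d%:R :> R by exact: lt_le_trans d2R.
exists (2 * C0 + 18 * d%:R) => [|P J t w PL J2 wt]; first by rewrite addr_gt0 ?mulr_gt0.
have w1 : 1 <= w%:R :> R by rewrite ler1n expn_gt0.
have w0 : 0 < w%:R :> R by exact: lt_le_trans ltr01 w1.
have w4 : 4 <= w%:R :> R by rewrite (ler_nat _ 4) (leq_pexp2l (m := 2) (n1 := 2)).
have wd0 : 0 < w%:R ^+ d.+1 :> R by rewrite exprn_gt0.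
have tw : 2 * C0 * w%:R ^+ d.+1 <= t%:num.
  by apply: le_trans wt; rewrite ler_wpM2r ?(ltW wd0)// lerDl mulr_ge0// ltW.
have t0 : 0 < t%:num by apply: lt_le_trans tw; rewrite !mulr_gt0.
(* A mesh below [e] makes both [u = 2 d h] and [n u^2 = 4 d^2 t h] at most 1/2, so that passing from
   the heat kernel to the lazy walk costs at most a factor [exp (-1)] over the whole time. *)
pose e : R := (8 * d%:R ^+ 2 * t%:num + 4 * d%:R)^-1.
have e0' : 0 < 8 * d%:R ^+ 2 * t%:num + 4 * d%:R :> R by rewrite addr_gt0// ?mulr_gt0// exprn_gt0.
have e0 : 0 < e by rewrite invr_gt0.
have [k0 hk0] := dyadic_mesh_lt t e0.
rewrite -centred_cube_seq; apply: (range_law_ge (k0 := k0)) => k kk.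
have he := hk0 k kk; set h := (dyadic_mesh t k)%:num in he.
have h0 : 0 < h by rewrite /h /= divr_gt0// exprn_gt0.
have hE : h * (8 * d%:R ^+ 2 * t%:num + 4 * d%:R) < 1.
  by rewrite -ltr_pdivlMr// mul1r.
rewrite (grid_cover_law PL (undup_uniq _) (measurable_grid_cover _ _ _ _)) lee_fin centred_cube_seq.
set n := (2 ^ k)%N.
have nh : n%:R * h = t%:num := dyadic_mesh_last t k.
pose u := 2 * d%:R * h.
have dt : 0 <= d%:R ^+ 2 * t%:num :> R by rewrite mulr_ge0 ?exprn_ge0 ?ltW.
have u12 : 0 < u <= 2^-1.
  rewrite /u mulr_gt0 ?mulr_gt0//=.
  have : 0 <= h * (8 * d%:R ^+ 2 * t%:num) by rewrite mulr_ge0 ?(ltW h0)// -mulrA mulr_ge0.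
  by move: hE; rewrite mulrDr; move: (h * (8 * _ * _)) => x; clear; lra.
have [u0 u2] := andP u12.
have nu2 : n%:R * u ^+ 2 <= 2^-1.
  have -> : n%:R * u ^+ 2 = 4 * d%:R ^+ 2 * t%:num * h by rewrite -nh /u; ring.
  have : 0 <= h * (4 * d%:R) by rewrite mulr_ge0 ?(ltW h0)// mulr_ge0.
  by move: hE; rewrite mulrDr; clear; move: (d%:R ^+ 2) t%:num => x y; lra.
pose eta := h / (1 + u).
have eta0 : 0 < eta by rewrite divr_gt0// addr_gt0.
have u1 : 0 < 1 + u by rewrite addr_gt0.
have eta1 : 2 * d%:R * eta <= 1.
  by rewrite /eta mulrA ler_pdivrMr// mul1r lerDr.
have nd : (0 < d)%N by apply: leq_trans d2.
have := @nn_value_le_path_value R d (undup (cube_seq (corner 0 w) (2 * w))) h n 0 (centred_cube d w)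
  nd (ltW h0) (undup_uniq _).
rewrite -/u -/eta centred_cube_seq; apply: le_trans.
have [m0 m0C Hn] := HC J eta J2 eta0 eta1.
have neta : n%:R * eta = t%:num / (1 + u) by rewrite /eta -nh mulrA.
have nm0 : (m0 <= n)%N.
  rewrite -(ler_nat R) -(ler_pM2r eta0); apply: (le_trans m0C); rewrite neta ler_pdivlMr//.
  apply: le_trans tw; rewrite mulrC -mulrA ler_wpM2r ?mulr_ge0 ?(ltW C00) ?(ltW wd0)//.
  by move: u2; clear; lra.
(* The factors are the cost of discretisation, from [exp (-u) (1 + u) >= 1 - u^2], the cost of
   covering, and that of staying in the cube for the time [n eta <= t]. *)
apply: (@le_trans _ _ (expR (- (2 * u ^+ 2)) ^+ n * (expR (- (C0 * w%:R ^+ d.-1)) *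
    expR (- (2 * (9 * d%:R / w%:R ^+ 2 * eta))) ^+ n))).
  rewrite -!expRM_natl -!expRD ler_expR !mulrN -!opprD lerN2.
  have -> : n%:R * (2 * (9 * d%:R / w%:R ^+ 2 * eta)) = 18 * d%:R / w%:R ^+ 2 * (n%:R * eta).
    by ring.
  have le1 : n%:R * (2 * u ^+ 2) <= 1 by move: nu2; move: (n%:R : R) (u ^+ 2) => x y; clear; lra.
  have le2 : C0 * w%:R ^+ d.-1 <= (2 * C0 + 18 * d%:R) * w%:R ^+ d.-1.
    rewrite ler_wpM2r ?exprn_ge0//; move: C00 d0; clear; lra.
  have le3 : 18 * d%:R / w%:R ^+ 2 * (n%:R * eta) <= (2 * C0 + 18 * d%:R) * t%:num / w%:R ^+ 2.
    rewrite [leRHS]mulrAC; apply: ler_pM.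
    - by rewrite divr_ge0 ?mulr_ge0 ?exprn_ge0.
    - by rewrite mulr_ge0// ltW.
    - by rewrite ler_wpM2r ?invr_ge0 ?exprn_ge0// lerDr mulr_ge0// ltW.
    - by rewrite neta ler_pdivrMr// ler_peMr// lerDl ltW.
  by rewrite -addrA lerD// lerD.
have la0 : 0 <= 9 * d%:R / w%:R ^+ 2 * eta by rewrite !mulr_ge0 ?invr_ge0 ?exprn_ge0 ?ltW.
have la1 : 9 * d%:R / w%:R ^+ 2 * eta <= 2^-1.
  rewrite mulrAC ler_pdivrMr ?exprn_gt0//.
  by move: eta1 w4; clear; nra.
have u2' : u ^+ 2 <= 2^-1 by move: u0 u2; clear; nra.
apply: ler_pM.
- by rewrite exprn_ge0// expR_ge0.
- by rewrite mulr_ge0 ?exprn_ge0 ?expR_ge0.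
- apply: lerXn2r; rewrite ?nnegrE ?expR_ge0 ?mulr_ge0 ?expR_ge0 ?(ltW u1)//.
  apply: (@le_trans _ _ (1 - u ^+ 2)); first by apply: expR_le_onem; rewrite u2' sqr_ge0.
  have -> : 1 - u ^+ 2 = (1 - u) * (1 + u) by ring.
  by rewrite ler_wpM2r ?(ltW u1)//; exact: expR_ge1Dx.
- apply: le_trans (Hn n nm0); rewrite ler_wpM2l ?expR_ge0//.
  apply: lerXn2r; rewrite ?nnegrE ?expR_ge0 ?subr_ge0 ?(le_trans la1)//; first by lra.
  by apply: expR_le_onem; rewrite la0.
Qed.

(** * The partition function *)

Lemma card_set_le_size (R : realType) d (G : set 'rV[int]_d) (s : seq 'rV[int]_d) :
  G `<=` [set` s] -> card_set R G <= (size s)%:R.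
Proof.
move=> Gs; have Gfin : finite_set G by apply: sub_finite_set Gs _; exact: finite_seq.
rewrite ler_nat; apply: uniq_leq_size; first exact: fset_uniq.
by move=> x; rewrite in_fset_set// inE => /Gs.
Qed.

Lemma adjacent_coord d (x y : 'rV[int]_d) (i : 'I_d) : Defs.adjacent x y -> `|x 0 i - y 0 i| <= 1.
Proof.
move=> /eqP <-; rewrite [leRHS](bigD1 i)//= lerDl.
by apply: sumr_ge0.
Qed.

Lemma cube_boundary_card (R : realType) d (a : 'rV[int]_d) n : (0 < d)%N -> (0 < n)%N ->
  card_set R (inner_boundary (cube a n)) <= 2 * d%:R * n%:R ^+ d.-1.
Proof.
case: d a => // d a _ n0 /=.
pose face (ib : 'I_d.+1 * bool) : seq 'rV[int]_d.+1 :=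
  codom (fun f : {ffun 'I_d -> 'I_n} => \row_k (if unlift ib.1 k is Some j then a 0 k + (f j)%:Z
    else a 0 k + (if ib.2 then n.-1 else 0)%N%:Z)).
pose faces := flatten [seq face ib | ib <- enum {: 'I_d.+1 * bool}].
have sz : size faces = (d.+1 * 2 * n ^ d)%N.
  rewrite size_flatten /shape -map_comp (eq_map (g := fun=> (n ^ d)%N)); last first.
    by move=> ib /=; rewrite size_codom card_ffun !card_ord.
  rewrite sumnE big_map big_const_seq count_predT iter_addn addn0 -cardE card_prod card_ord card_bool.
  by rewrite mulnC.
apply: (@le_trans _ _ (size faces)%:R); last first.
  by rewrite sz !natrM natrX (mulrC d.+1%:R).
apply: card_set_le_size => x [xa [y xy /existsNP[i yi]]].
have {}xa k : a 0 k <= x 0 k < a 0 k + n%:Z := xa k.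
have xyi := adjacent_coord i xy.
have [b xb] : exists b : bool, x 0 i = a 0 i + (if b then n.-1 else 0)%N%:Z.
  have := xa i; move: yi xyi n0; case: (ltP (y 0 i) (a 0 i)) => h.
    by exists false; move: h xyi (xa i); clear; lia.
  by exists true; move: h xyi (xa i) yi n0; clear; lia.
apply/flattenP; exists (face (i, b)); first by apply/mapP; exists (i, b); rewrite ?mem_enum.
have xf j : (absz (x 0 (lift i j) - a 0 (lift i j))%R < n)%N.
  by have := xa (lift i j); clear; lia.
apply/codomP; exists [ffun j => Ordinal (xf j)]; apply/rowP => k; rewrite mxE /=.
case: unliftP => [j ->|->]; last by rewrite xb.
rewrite ffunE/= gez0_abs ?subr_ge0; last by case/andP: (xa (lift i j)).
by rewrite addrC subrK.
Qed.

Lemma gibbs_weight_gt0 (R : realType) d beta t (w : path_space R d) : 0 < gibbs_weight beta t w.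
Proof. exact: expR_gt0. Qed.

Lemma gibbs_weight_le1 (R : realType) d beta t (w : path_space R d) : 0 <= beta ->
  gibbs_weight beta t w <= 1.
Proof.
by move=> b0; rewrite -expR0 ler_expR mulNr oppr_le0 mulr_ge0// ler0n.
Qed.

Lemma measurable_gibbs_weight (R : realType) d (beta t : R) : 0 < t ->
  measurable_fun setT (@gibbs_weight R d beta t).
Proof.
move=> t0 _ B mB; rewrite setTI.
exact: (@measurable_range R d (NngNum (ltW t0))
  (fun S => B (expR (- beta * card_set R (inner_boundary S))))).
Qed.

Lemma partition_functionE (R : realType) d (P : probability (path_space R d) R) (beta t : R) :
  0 <= beta -> 0 < t ->
  (\int[P]_w (gibbs_weight beta t w)%:E)%E = (partition_function P beta t)%:E.
Proof.
move=> b0 t0; rewrite /partition_function unlock fineK// ge0_fin_numE; last first.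
  by apply: integral_ge0 => w _; rewrite lee_fin ltW// gibbs_weight_gt0.
apply: (@le_lt_trans _ _ (\int[P]_(w in setT) (cst 1%E) w)%E).
  apply: ge0_le_integral => //.
  - by move=> w _; rewrite lee_fin ltW// gibbs_weight_gt0.
  - by apply/measurable_EFinP; exact: measurable_gibbs_weight.
  - by move=> w _; rewrite lee_fin gibbs_weight_le1.
rewrite integral_cst// mul1e; apply: (@le_lt_trans _ _ 1%E); last exact: ltry.
exact: (probability_le1 P measurableT).
Qed.

Lemma partition_function_ge (R : realType) d (P : probability (path_space R d) R)
    (beta t om : R) (B : set (path_space R d)) :
  0 <= beta -> 0 < t -> 0 <= om -> measurable B ->
  (forall w, B w -> om <= gibbs_weight beta t w) ->
  (om%:E * P B <= (partition_function P beta t)%:E)%E.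
Proof.
move=> b0 t0 om0 mB HB; rewrite -partition_functionE//.
have mW := @measurable_gibbs_weight R d beta t t0.
apply: (@le_trans _ _ (\int[P]_(w in B) (gibbs_weight beta t w)%:E)%E).
  rewrite -(integral_cst P mB); apply: ge0_le_integral => //.
  by apply/measurable_EFinP; exact: measurable_funTS.
apply: ge0_subset_integral => //; first exact/measurable_EFinP.
by move=> w _; rewrite lee_fin ltW// gibbs_weight_gt0.
Qed.

Lemma gibbs_le (R : realType) d (P : probability (path_space R d) R)
    (beta t om : R) (B : set (path_space R d)) :
  0 <= beta -> 0 < t -> 0 <= om -> 0 < partition_function P beta t -> measurable B ->
  (forall w, B w -> gibbs_weight beta t w <= om) ->
  (gibbs P beta t B <= ((partition_function P beta t)^-1 * om)%:E * P B)%E.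
Proof.
move=> b0 t0 om0 Z0 mB HB.
have mW := @measurable_gibbs_weight R d beta t t0.
have Z0' := ltW Z0.
rewrite /gibbs -(integral_cst P mB); apply: ge0_le_integral => //.
- by move=> w _; rewrite lee_fin mulr_ge0 ?invr_ge0// ltW// gibbs_weight_gt0.
- apply/measurable_EFinP; apply: measurable_funM => //; exact: measurable_funTS.
- by move=> w /HB wom; rewrite lee_fin ler_wpM2l// invr_ge0.
Qed.

Lemma gibbs_ge0 (R : realType) d (P : probability (path_space R d) R) (beta t : R)
    (A : set (path_space R d)) :
  0 < partition_function P beta t -> (0 <= gibbs P beta t A)%E.
Proof.
move=> Z0; apply: integral_ge0 => w _.
by rewrite lee_fin mulr_ge0 ?invr_ge0 ?(ltW Z0)// ltW// gibbs_weight_gt0.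
Qed.

Lemma gibbs_setU (R : realType) d (P : probability (path_space R d) R) (beta t : R)
    (A B : set (path_space R d)) :
  0 < t -> 0 < partition_function P beta t -> measurable A -> measurable B ->
  A `&` B = set0 -> (gibbs P beta t (A `|` B) = gibbs P beta t A + gibbs P beta t B)%E.
Proof.
move=> t0 Z0 mA mB AB; rewrite /gibbs ge0_integral_setU//.
- apply/measurable_EFinP; apply: measurable_funM => //.
  by apply: measurable_funTS; exact: measurable_gibbs_weight.
- move=> w _; rewrite lee_fin mulr_ge0 ?invr_ge0 ?(ltW Z0)//.
  by rewrite ltW// gibbs_weight_gt0.
- by rewrite disj_set2E AB.
Qed.

Lemma gibbs_setT (R : realType) d (P : probability (path_space R d) R) (beta t : R) :
  0 <= beta -> 0 < t -> 0 < partition_function P beta t -> gibbs P beta t setT = 1%E.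
Proof.
move=> b0 t0 Z0; rewrite /gibbs; under eq_integral do rewrite EFinM.
rewrite ge0_integralZl_EFin//; last 3 first.
- by move=> w _; rewrite lee_fin ltW// gibbs_weight_gt0.
- by apply/measurable_EFinP; exact: measurable_gibbs_weight.
- by rewrite invr_ge0 ltW.
by rewrite partition_functionE// -EFinM mulVf// gt_eqF.
Qed.

Lemma gibbs_concentration (R : realType) d (P : probability (path_space R d) R)
    (beta t p om : R) (A B : set (path_space R d)) :
  0 <= beta -> 0 < t -> 0 < partition_function P beta t -> 0 <= om ->
  measurable A -> measurable B -> (P B <= p%:E)%E ->
  (forall w, ~ A w -> ~ B w -> gibbs_weight beta t w <= om) ->
  ((1 - (partition_function P beta t)^-1 * (p + om))%:E <= gibbs P beta t A <= 1)%E.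
Proof.
move=> b0 t0 Z0 om0 mA mB PB HB; set Z := partition_function P beta t in Z0 *.
have mAC : measurable (~` A) by exact: measurableC.
have mAB : measurable (~` A `&` B) by exact: measurableI.
have mAD : measurable (~` A `\` B) by exact: measurableD.
have total : (gibbs P beta t A + gibbs P beta t (~` A) = 1)%E.
  by rewrite -gibbs_setU ?setICr// setUv gibbs_setT.
have split_compl : (gibbs P beta t (~` A) =
    gibbs P beta t (~` A `&` B) + gibbs P beta t (~` A `\` B))%E.
  by rewrite -gibbs_setU ?setUIDK//; apply/seteqP; split=> // w [[_ ?] [_ ?]].
have le1 : (gibbs P beta t (~` A `&` B) <= (Z^-1 * p)%:E)%E.
  apply: le_trans (gibbs_le b0 t0 ler01 Z0 mAB _) _ => [w _|]; first exact: gibbs_weight_le1.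
  rewrite mulr1 EFinM lee_pmul2l ?lte_fin ?invr_gt0//.
  by apply: le_trans PB; apply: le_measure; rewrite ?inE.
have le2 : (gibbs P beta t (~` A `\` B) <= (Z^-1 * om)%:E)%E.
  apply: le_trans (gibbs_le b0 t0 om0 Z0 mAD _) _ => [w [Aw Bw]|]; first exact: HB.
  rewrite -[leRHS]mule1 lee_pmul// ?lee_fin ?mulr_ge0 ?invr_ge0 ?(ltW Z0)//.
  exact: probability_le1.
have le3 : (gibbs P beta t (~` A) <= (Z^-1 * (p + om))%:E)%E.
  by rewrite split_compl mulrDr EFinD leeD.
apply/andP; split; last by rewrite -total leeDl// gibbs_ge0.
by rewrite EFinB leeBlDr// -total leeD2l.
Qed.

Lemma dyadic_floor (R : realType) (x : R) : 4 <= x ->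
  exists J, [/\ (2 <= J)%N, (2 ^ J)%N%:R <= x & x < 2 * (2 ^ J)%N%:R].
Proof.
move=> x4; have x0 : 0 <= x by apply: le_trans x4.
have n4 : (4 <= Num.truncn x)%N by rewrite truncn_ge_nat.
have n0 : (0 < Num.truncn x)%N by apply: leq_trans n4.
have /andP[l u] := truncn_itv x0; exists (trunc_log 2 (Num.truncn x)); split.
- by apply: (@leq_trans (trunc_log 2 4)) => //; apply: leq_trunc_log.
- by apply: le_trans l; rewrite ler_nat trunc_logP.
- apply: lt_le_trans u _; rewrite -natrM ler_nat -expnS.
  exact: trunc_log_ltn.
Qed.

Lemma partition_function_lower (R : realType) d (beta0 : R) : (2 <= d)%N -> 0 < beta0 ->
  exists C K : R, 0 < C /\ forall (P : probability (path_space R d) R) (beta r : R),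
    is_srw_law P -> beta0 < beta -> 0 < r -> K <= r ->
    expR (- (C * (beta * r ^+ d.-1))) <= partition_function P beta (beta * r ^+ d.+1).
Proof.
move=> d2 b0; have [C1 C10 H] := @range_cube_prob R d d2.
(* The cube has side of order [c r], with [c] so small that the covering time [C1 w^(d+1)] is at
   most [beta0 r^(d+1) <= t]. *)
pose c := Num.min 1 (beta0 / C1).
have c0 : 0 < c by rewrite /c lt_min ltr01 divr_gt0.
have c1 : c <= 1 by rewrite /c ge_min lexx.
have cC : C1 * c <= beta0 by rewrite mulrC -ler_pdivlMr// /c ge_min lexx orbT.
clearbody c.
(* The four summands pay for the boundary of the cube, the discretisation, the covering and the
   confinement up to time [t]. For the threshold, [4 / c] guarantees a dyadic side of at least 4 and
   [1 / beta0] guarantees [L >= 1], which absorbs the additive constant. *)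
exists (2 * d%:R * 2 ^+ d.-1 + 1 + C1 / beta0 + C1 * 4 / c ^+ 2), (4 / c + beta0^-1 + 1).
have d20 : 0 <= 2 * d%:R * 2 ^+ d.-1 :> R by rewrite !mulr_ge0.
have Cb0 : 0 < C1 / beta0 by rewrite divr_gt0.
have Cc0 : 0 < C1 * 4 / c ^+ 2 by rewrite divr_gt0 ?mulr_gt0 ?exprn_gt0.
split=> [|P beta r lawP bb r0 Kr]; first by move: d20 Cb0 Cc0; clear; lra.
have [h1 h2] : 0 < 4 / c /\ 0 < beta0^-1 by rewrite divr_gt0 ?invr_gt0.
have r1 : 1 <= r by move: h1 h2 Kr; clear; lra.
have cr4 : 4 <= c * r.
  by rewrite mulrC -ler_pdivrMr//; move: h1 h2 Kr; clear; lra.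
have br1 : 1 <= beta0 * r.
  by rewrite mulrC -ler_pdivrMr// mul1r; move: h1 h2 Kr; clear; lra.
have [J [J2 Jl Ju]] := dyadic_floor cr4.
have be0 : 0 < beta := lt_trans b0 bb.
have w0 : (0 < 2 ^ J)%N by rewrite expn_gt0.
set w := (2 ^ J)%N in Jl Ju w0 *.
have wR : 0 < w%:R :> R by rewrite ltr0n.
have wr : w%:R <= r by apply: le_trans Jl _; rewrite ler_piMl// ltW.
set t := beta * r ^+ d.+1; set L := beta * r ^+ d.-1.
have t0 : 0 < t by rewrite mulr_gt0 ?exprn_gt0.
have L0 : 0 < L by rewrite mulr_gt0 ?exprn_gt0.
have tL : t = L * r ^+ 2.
  by rewrite /t /L -mulrA -exprD addn2 prednK// ltnW.
have wt : C1 * w%:R ^+ d.+1 <= t.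
  apply: (@le_trans _ _ (C1 * (c * r) ^+ d.+1)).
    by rewrite ler_pM2l// lerXn2r ?nnegrE// ltW// mulr_gt0.
  rewrite exprMn mulrA ler_wpM2r ?exprn_ge0 ?(ltW r0)//.
  apply: le_trans (ltW bb); apply: le_trans cC; rewrite ler_pM2l// exprS.
  by rewrite ler_piMr ?(ltW c0)// exprn_ile1// ltW.
pose B : set (path_space R d) := [set v | walk_range v t = centred_cube d w].
pose p := expR (- (1 + C1 * w%:R ^+ d.-1 + C1 * t / w%:R ^+ 2)).
have pB : (p%:E <= P B)%E := H P J (NngNum (ltW t0)) lawP J2 wt.
pose om := expR (- beta * (2 * d%:R * (2 * w)%:R ^+ d.-1)) : R.
have mB : measurable B by exact: (@measurable_range R d (NngNum (ltW t0)) (fun S => S = centred_cube d w)).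
have Bom v : B v -> om <= gibbs_weight beta t v.
  move=> Bv; rewrite /om /gibbs_weight Bv ler_expR !mulNr lerN2 ler_pM2l//.
  by apply: cube_boundary_card; [exact: leq_trans d2|rewrite muln_gt0].
have := partition_function_ge P (ltW be0) t0 (expR_ge0 _) mB Bom.
have : ((om * p)%:E <= om%:E * P B)%E by rewrite EFinM lee_wpmul2l// lee_fin expR_ge0.
move=> /le_trans h /h; rewrite lee_fin.
apply: le_trans; rewrite -expRD ler_expR.
have L1 : 1 <= L.
  apply: le_trans br1 _; rewrite /L; apply: ler_pM; rewrite ?(ltW b0) ?(ltW bb) ?(ltW r0)//.
  by rewrite ler_eXnr//; move: d2; clear; lia.
have e1 : beta * (2 * d%:R * (2 * w)%:R ^+ d.-1) <= 2 * d%:R * 2 ^+ d.-1 * L.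
  have wrd : w%:R ^+ d.-1 <= r ^+ d.-1 by rewrite lerXn2r ?nnegrE// ltW.
  rewrite natrM exprMn /L; move: (2 ^+ d.-1) (w%:R ^+ d.-1) (r ^+ d.-1) d20 wrd => x y z d20 wrd.
  rewrite (_ : beta * _ = 2 * d%:R * x * (beta * y)); last by ring.
  by rewrite ler_wpM2l// ler_pM2l.
have e2 : C1 * w%:R ^+ d.-1 <= C1 / beta0 * L.
  rewrite -mulrA ler_pM2l// mulrC ler_pdivlMr// mulrC /L.
  apply: ler_pM; rewrite ?(ltW b0) ?(ltW bb) ?exprn_ge0//.
  by rewrite lerXn2r ?nnegrE// ltW.
have e3 : C1 * t / w%:R ^+ 2 <= C1 * 4 / c ^+ 2 * L.
  have rw : r ^+ 2 <= (2 * w%:R / c) ^+ 2.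
    rewrite lerXn2r ?nnegrE ?(ltW r0) ?divr_ge0 ?mulr_ge0 ?(ltW c0)//.
    by rewrite ler_pdivlMr// mulrC ltW.
  rewrite ler_pdivrMr ?exprn_gt0// tL.
  rewrite (_ : _ * w%:R ^+ 2 = C1 * (L * (2 * w%:R / c) ^+ 2)); first by rewrite !ler_pM2l.
  by field; rewrite gt_eqF.
rewrite mulNr -opprD lerN2 !(mulrDl _ _ L) mul1r.
by move: e1 e2 e3 L1; clear; lra.
Qed.

(** * Confinement *)

Lemma cube_seq_coord d (m : nat) (z : 'rV[int]_d.+1) : (0 < m)%N ->
  z \in cube_seq (corner 0 m) (2 * m) -> - m%:Z <= z 0 ord0 <= m%:Z.
Proof.
move=> m0 zD; have zc : cube (corner 0 m) (2 * m) z by rewrite -mem_cube_seq.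
have : corner 0 m 0 ord0 <= z 0 ord0 < corner 0 m 0 ord0 + (2 * m)%N%:Z := zc ord0.
by rewrite cornerE mxE; clear; lia.
Qed.

Lemma confined_weight_bounds (R : realType) d (m : nat) (z : 'rV[int]_d.+1) : (0 < m)%N ->
  z \in cube_seq (corner 0 m) (2 * m) ->
  3 * m%:R ^+ 2 <= (4 * m%:R ^+ 2 - (z 0 ord0)%:~R ^+ 2 : R) <= 4 * m%:R ^+ 2.
Proof.
move=> m0 /(cube_seq_coord m0) /andP[l u].
have {}l : - m%:R <= (z 0 ord0)%:~R :> R by rewrite -(ler_int R) rmorphN/= in l.
have {}u : (z 0 ord0)%:~R <= m%:R :> R by rewrite -(ler_int R) in u.
by move: l u; move: (_%:~R : R) (m%:R : R) => a b l u; apply/andP; split; nra.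
Qed.

(** [psi] depends on one coordinate, has Laplacian -2 and lies between [3 m^2] and [4 m^2] on the
    cube. A time step gains [2 h] to first order; after the factor [exp (-u)] and the multiple
    jumps, whose error is summed over [D], at least [h / 2] is left, that is, the fraction
    [h / (8 m^2)] of [psi]. *)
Lemma killed_kernel_le (R : realType) d (m : nat) (h : R) (D := cube_seq (corner 0 m) (2 * m))
    (psi := fun z : 'rV[int]_d.+1 => 4 * m%:R ^+ 2 - (z 0 ord0)%:~R ^+ 2 : R) (x : 'rV[int]_d.+1) :
  (0 < m)%N -> 0 < h -> 4 * d.+1%:R * h <= 1 ->
  64 * d.+1%:R ^+ 2 * m%:R ^+ 2 * (size D)%:R * h <= 1 ->
  x \in D ->
  \sum_(z <- undup D) heat_kernel h x z * psi z <= expR (- (h / (8 * m%:R ^+ 2))) * psi x.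
Proof.
move=> m0 h0 hd hD xD; set S := undup D; have uS : uniq S := undup_uniq _.
have m1 : 1 <= m%:R :> R by rewrite ler1n.
have psiD := @confined_weight_bounds R d m ^~ m0.
(* Killing replaces [psi] by 0 outside the cube. This only lowers the sum over neighbours, since
   [psi] is still nonnegative one step beyond the cube. *)
pose f (z : 'rV[int]_d.+1) : R := if z \in S then psi z else 0.
have fD z : z \notin S -> f z = 0 by move=> zS; rewrite /f (negbTE zS).
have xS : x \in S by rewrite mem_undup.
set u := 2 * d.+1%:R * h.
have u0 : 0 <= u by rewrite !mulr_ge0// ltW.
have u1 : u <= 2^-1 by rewrite /u; move: hd; clear; lra.
have [px1 px2] : 3 * m%:R ^+ 2 <= psi x /\ psi x <= 4 * m%:R ^+ 2 := andP (psiD x xD).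
have near (z : 'rV[int]_d.+1) : `|z 0 ord0 - x 0 ord0| <= 1 -> f z <= psi z.
  move=> zx; rewrite /f; case: ifP => // _; rewrite /psi subr_ge0.
  have : `|(z 0 ord0)%:~R - (x 0 ord0)%:~R| <= 1 :> R.
    by rewrite -intrB -intr_norm -(ler_int R) in zx *.
  rewrite ler_norml => /andP[l1 l2]; have /andP[l3 l4] := cube_seq_coord m0 xD.
  rewrite -(ler_int R) rmorphN/= in l3; rewrite -(ler_int R) in l4.
  move: l1 l2 l3 l4 m1; clear; set a : R := (z 0 ord0)%:~R; set b : R := (x 0 ord0)%:~R.
  by set c : R := m%:R; nra.
have adj : \sum_(z <- S) adj_kernel R x z * f z <= 2 * d.+1%:R * psi x - 2.
  rewrite sum_adj_kernel// big_ord_recl/=.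
  apply: (@le_trans _ _ ((2 * psi x - 2) + \sum_(i < d) 2 * psi x)).
    apply: lerD.
      have := near (x + delta_mx 0 ord0); have := near (x - delta_mx 0 ord0).
      rewrite !mxE !eqxx/= /psi !mxE eqxx/= (addrC (x 0 ord0)) addrK addrAC subrr add0r normrN normr1.
      move=> /(_ isT) h1 /(_ isT) h2; apply: le_trans (lerD h2 h1) _.
      rewrite !intrD; clear; set a : R := (x 0 ord0)%:~R; lra.
    apply: ler_sum => i _.
    have := near (x + delta_mx 0 (lift ord0 i)); have := near (x - delta_mx 0 (lift ord0 i)).
    rewrite /psi !mxE/= ?subr0 ?addr0 subrr normr0.
    move=> /(_ isT) h1 /(_ isT) h2; apply: le_trans (lerD h2 h1) _.
    by rewrite [leRHS]mulr_natl mulr2n.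
  by rewrite sumr_const card_ord -[d.+1%:R]natr1 -mulr_natr; clear; lra.
have kern z : z \in S -> heat_kernel h x z * psi z <=
    expR (- u) * ((x == z)%:R * f z + h * (adj_kernel R x z * f z)) + u ^+ 2 * (4 * m%:R ^+ 2).
  move=> zS; have zD : z \in D by rewrite -mem_undup.
  have [p1 p2] : 3 * m%:R ^+ 2 <= psi z /\ psi z <= 4 * m%:R ^+ 2 := andP (psiD z zD).
  have p0 : 0 <= psi z by apply: le_trans p1; rewrite mulr_ge0 ?exprn_ge0.
  have /andP[_] := heat_kernel_bounds x z (isT : (0 < d.+1)%N) (ltW h0).
  rewrite -/u lerBlDl /f zS => hk.
  apply: le_trans (ler_wpM2r p0 hk) _; rewrite mulrDl lerD//; last by rewrite ler_wpM2l ?sqr_ge0.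
  by rewrite -mulrA mulrDl mulrA.
rewrite big_seq; apply: (le_trans (ler_sum _ kern)); rewrite -big_seq.
rewrite big_split/= -mulr_sumr big_split/= -mulr_sumr sum_delta_kernel//.
rewrite big_const_seq count_predT iter_addr_0 -mulr_natr.
have -> : f x = psi x by rewrite /f xS.
have szS : (size S)%:R <= (size D)%:R :> R by rewrite ler_nat size_undup.
have m20 : 0 < 8 * m%:R ^+ 2 :> R by rewrite mulr_gt0 ?exprn_gt0 ?ltr0n.
apply: (@le_trans _ _ (psi x - h / 2)); last first.
  apply: (@le_trans _ _ ((1 - h / (8 * m%:R ^+ 2)) * psi x)).
    rewrite mulrBl mul1r lerD2l lerN2 mulrAC ler_pdivrMr//.
    by move: px2 h0; move: (psi x) (m%:R ^+ 2) => p q; clear; nra.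
  rewrite ler_wpM2r//; first by apply: le_trans px1; rewrite mulr_ge0 ?exprn_ge0.
  exact: expR_ge1Dx.
have e1 : (1 + u) * expR (- u) <= 1.
  rewrite -[leRHS](expRxMexpNx_1 u) ler_wpM2r ?expR_ge0//; exact: expR_ge1Dx.
have e2 : 2^-1 <= expR (- u) by apply: le_trans (expR_ge1Dx _); move: u1; clear; lra.
have lin : expR (- u) * (psi x + h * \sum_(z <- S) adj_kernel R x z * f z) <= psi x - h.
  apply: (@le_trans _ _ (expR (- u) * ((1 + u) * psi x - 2 * h))).
    rewrite ler_wpM2l ?expR_ge0//; move: (ler_wpM2l (ltW h0) adj); rewrite /u.
    by move: (\sum_(z <- S) _) (psi x) => s p; clear; lra.
  have p0 : 0 <= psi x by apply: le_trans px1; rewrite mulr_ge0 ?exprn_ge0.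
  move: (ler_wpM2r p0 e1) (ler_wpM2r (ltW h0) e2); rewrite mul1r.
  by move: (expR (- u)) (psi x) => e p; clear; lra.
have quad : u ^+ 2 * (4 * m%:R ^+ 2) * (size S)%:R <= h / 2.
  apply: (@le_trans _ _ (u ^+ 2 * (4 * m%:R ^+ 2) * (size D)%:R)).
    by apply: ler_wpM2l szS; rewrite mulr_ge0 ?sqr_ge0// mulr_ge0 ?sqr_ge0.
  rewrite (_ : _ * _ = h / 4 * (64 * d.+1%:R ^+ 2 * m%:R ^+ 2 * (size D)%:R * h)); last first.
    by rewrite /u; field.
  apply: (@le_trans _ _ (h / 4)); last by move: h0; clear; lra.
  by rewrite ler_piMr// divr_ge0// ltW.
by move: lin quad; clear; lra.
Qed.

Lemma path_value_confined (R : realType) d (m : nat) (h : R) (D := cube_seq (corner 0 m) (2 * m)) n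
    (x : 'rV[int]_d.+1) :
  (0 < m)%N -> 0 < h -> 4 * d.+1%:R * h <= 1 ->
  64 * d.+1%:R ^+ 2 * m%:R ^+ 2 * (size D)%:R * h <= 1 -> x \in D ->
  3 * m%:R ^+ 2 * path_value (@heat_kernel R d.+1 h) (undup D) n x set0 <=
  expR (- (h / (8 * m%:R ^+ 2))) ^+ n * (4 * m%:R ^+ 2 - (x 0 ord0)%:~R ^+ 2).
Proof.
move=> m0 h0 hd hD; elim: n x => [|n IH] x xD /=.
  have /andP[le3 _] := confined_weight_bounds R m0 xD.
  rewrite expr0 mul1r; apply: le_trans le3; rewrite ler_piMr ?mulr_ge0 ?exprn_ge0//.
  by rewrite lern1 leq_b1.
rewrite mem_undup xD mul1r (_ : set0 `\ x = set0); last by rewrite set0D.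
rewrite mulr_sumr.
apply: (@le_trans _ _ (expR (- (h / (8 * m%:R ^+ 2))) ^+ n *
  \sum_(z <- undup D) heat_kernel h x z * (4 * m%:R ^+ 2 - (z 0 ord0)%:~R ^+ 2))).
  rewrite mulr_sumr big_seq [leRHS]big_seq; apply: ler_sum => z; rewrite mem_undup => zD.
  by rewrite mulrCA [leRHS]mulrCA ler_wpM2l ?heat_kernel_ge0 ?IH// ltW.
by rewrite [_ ^+ n.+1]exprSr -[leRHS]mulrA ler_wpM2l ?exprn_ge0 ?expR_ge0// killed_kernel_le.
Qed.

(** For an upper bound a single fine mesh suffices, as confinement at all times implies confinement
    at the grid times. *)
Lemma srw_confined (R : realType) d (P : probability (path_space R d) R) (t : {nonneg R})
    (m : nat) (B : set (path_space R d)) :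
  is_srw_law P -> (0 < d)%N -> (0 < m)%N -> 0 < t%:num -> measurable B ->
  (forall w, B w -> forall s, s%:num <= t%:num ->
     cube (start w + corner 0 m) (2 * m) (path_fun w s)) ->
  (P B <= (2 * expR (- (t%:num / (8 * m%:R ^+ 2))))%:E)%E.
Proof.
case: d P B => // d P B PL _ m0 t0 mB HB.
pose D : seq 'rV[int]_d.+1 := cube_seq (corner 0 m) (2 * m).
pose K : R := 4 * d.+1%:R + 64 * d.+1%:R ^+ 2 * m%:R ^+ 2 * (size D)%:R.
have m0R : 0 < m%:R :> R by rewrite ltr0n.
have K1 : 0 < 4 * d.+1%:R :> R by rewrite mulr_gt0.
have K2 : 0 <= 64 * d.+1%:R ^+ 2 * m%:R ^+ 2 * (size D)%:R :> R.
  by rewrite !mulr_ge0// exprn_ge0.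
have K0 : 0 < K by rewrite ltr_pwDl.
have Ki0 : 0 < K^-1 by rewrite invr_gt0.
have [k /(_ k (leqnn k))] := dyadic_mesh_lt t Ki0.
set h := dyadic_mesh t k => hK.
have h0 : 0 < h%:num by rewrite /h /= divr_gt0// exprn_gt0.
have hK1 : h%:num * K < 1 by rewrite -ltr_pdivlMr// mul1r.
have hd : 4 * d.+1%:R * h%:num <= 1.
  by apply: le_trans (ltW hK1); rewrite [leRHS]mulrC ler_wpM2r ?(ltW h0)// lerDl.
have hD : 64 * d.+1%:R ^+ 2 * m%:R ^+ 2 * (size D)%:R * h%:num <= 1.
  by apply: le_trans (ltW hK1); rewrite [leRHS]mulrC ler_wpM2r ?(ltW h0)// lerDr ltW.
have sub : B `<=` grid_cover h (undup D) (2 ^ k) set0 `|`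
    [set w : path_space R d.+1 | start w <> 0].
  move=> w Bw; have [w0|] := pselect (start w = 0); last by right.
  left; split=> // i ik; rewrite mem_undup.
  have /(HB w Bw) : (grid h i)%:num <= t%:num.
    by rewrite -(dyadic_mesh_last t k) /= ler_wpM2r// ler_nat.
  by rewrite w0 add0r -mem_cube_seq.
have mG := measurable_grid_cover h (undup D) (2 ^ k) set0.
have mZ : measurable [set w : path_space R d.+1 | start w <> 0].
  by apply: measurableC; exact: measurable_site.
apply: (@le_trans _ _ (P (grid_cover h (undup D) (2 ^ k) set0))).
  apply: (@le_trans _ _ (P (grid_cover h (undup D) (2 ^ k) set0 `|`
    [set w : path_space R d.+1 | start w <> 0]))).
    by apply: le_measure; rewrite ?inE//; exact: measurableU.
  apply: le_trans (measureU2 _ _ _) _ => //.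
  by rewrite [X in (_ + X)%E](_ : _ = 0%E) ?adde0; last exact: srw_starts_at_origin.
rewrite grid_cover_law ?undup_uniq// lee_fin.
have zD : 0 \in D.
  suff : [set` D] 0 by [].
  by rewrite mem_cube_seq => i; rewrite cornerE mxE; move: m0; clear; lia.
have := path_value_confined (2 ^ k) m0 h0 hd hD zD.
rewrite mxE expr0n/= subr0 -expRM_natl mulrN [(2 ^ k)%N%:R * _]mulrA.
have -> : (2 ^ k)%N%:R * h%:num = t%:num := dyadic_mesh_last t k.
have m2 : 0 < m%:R ^+ 2 :> R by rewrite exprn_gt0.
rewrite -ler_pdivlMl ?mulr_gt0// => /le_trans; apply.
(* The ratio of [psi] at the origin to its minimum over the cube is at most 4/3, which is below the
   factor 2. *)
rewrite ler_pdivrMl ?mulr_gt0// mulrC.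
by move: (mulr_gt0 m2 (expR_gt0 (- (t%:num / (8 * m%:R ^+ 2))))); clear; lra.
Qed.

(** * The boundary of the range *)

Lemma has_ubound_finite (R : realType) (A : set R) : finite_set A -> has_ubound A.
Proof.
move=> fA; exists (\sum_(a <- fset_set A) `|a|) => x Ax.
have xA : x \in fset_set A by rewrite in_fset_set// inE.
rewrite (bigD1_seq x)//=; last exact: fset_uniq.
by apply: le_trans (ler_norm x) _; rewrite lerDl sumr_ge0.
Qed.

Lemma dist_le_diam (R : realType) d (G : set 'rV[int]_d) x y :
  finite_set G -> G x -> G y -> euclidean_dist R x y <= diam R G.
Proof.
move=> fG Gx Gy; apply: ub_le_sup; last by exists (x, y).
by apply: has_ubound_finite; apply: finite_image; exact: finite_setX.
Qed.

Lemma diam_le (R : realType) d (G : set 'rV[int]_d) x (b : R) : G x ->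
  (forall y z, G y -> G z -> euclidean_dist R y z <= b) -> diam R G <= b.
Proof.
move=> Gx H; apply: ge_sup; first by exists (euclidean_dist R x x); exists (x, x).
by move=> _ [[y z] [/= Gy Gz] <-]; exact: H.
Qed.

Lemma coord_le_dist (R : realType) d (x y : 'rV[int]_d) (i : 'I_d) :
  `|x 0 i - y 0 i|%:~R <= euclidean_dist R x y.
Proof.
rewrite -(ler_pXn2r (n := 2))// ?nnegrE ?sqrtr_ge0 ?ler0z ?normr_ge0//.
rewrite sqr_sqrtr; last by apply: sumr_ge0 => j _; exact: sqr_ge0.
rewrite intr_norm real_normK ?num_real// (bigD1 i)//= lerDl.
by apply: sumr_ge0 => j _; exact: sqr_ge0.
Qed.

Lemma dist_le_sum (R : realType) d (x y : 'rV[int]_d) :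
  euclidean_dist R x y <= \sum_(i < d) `|x 0 i - y 0 i|%:~R.
Proof.
have s0 (I : seq 'I_d) : 0 <= \sum_(i <- I) `|x 0 i - y 0 i|%:~R :> R.
  by apply: sumr_ge0 => i _; rewrite ler0z normr_ge0.
rewrite -(ler_pXn2r (n := 2))// ?nnegrE ?sqrtr_ge0 ?s0//.
rewrite sqr_sqrtr; last by apply: sumr_ge0 => j _; exact: sqr_ge0.
elim: (index_enum _) => [|i I IH]; first by rewrite !big_nil expr0n.
have i0 : 0 <= `|x 0 i - y 0 i|%:~R :> R by rewrite ler0z normr_ge0.
rewrite !big_cons sqrrD; move: (s0 I) IH.
have -> : (x 0 i - y 0 i)%:~R ^+ 2 = `|x 0 i - y 0 i|%:~R ^+ 2 :> R.
  by rewrite intr_norm real_normK ?num_real.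
move: (\sum_(j <- I) _) (\sum_(j <- I) _) (`|x 0 i - y 0 i|%:~R : R) i0 => a b c c0 b0 ab.
by move: (mulr_ge0 c0 b0) ab; rewrite -mulr_natl; clear; lra.
Qed.

(* The supremum of the times up to which the path has stayed in [S] is a time
   at which it is still in [S], since a jump out of [S] would hit [T]. *)
Lemma nn_path_stays (R : realType) d (w : walk_path R d) (S T : set 'rV[int]_d) (s s' : {nonneg R}) :
  (forall x y, S x -> Defs.adjacent x y -> S y \/ T y) -> s%:num <= s'%:num -> S (w s) ->
  (forall u : {nonneg R}, s%:num <= u%:num <= s'%:num -> ~ T (w u)) -> S (w s').
Proof.
move=> ST ss' Ss nT; have [rc ll] := path_nn w.
pose A := [set a : R | s%:num <= a <= s'%:num /\
  forall u : {nonneg R}, s%:num <= u%:num <= a -> S (w u)].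
have As : A s%:num.
  split=> [|u us]; first by rewrite lexx.
  by rewrite (_ : u = s)//; apply/val_inj/le_anti; rewrite andbC.
have hA : has_sup A by split; [exists s%:num|exists s'%:num => a [/andP[]]].
have sA : s%:num <= sup A by exact: ub_le_sup hA.2 _ As.
have As' : sup A <= s'%:num by apply: ge_sup; [exact: hA.1|move=> a [/andP[]]].
have b0 : 0 <= sup A by apply: le_trans sA.
pose b : {nonneg R} := NngNum b0.
have Sb : S (w b).
  move: sA; rewrite le_eqVlt => /orP[/eqP sE|sA].
    by rewrite (_ : b = s)//; exact/val_inj.
  have bpos : 0 < b%:num by apply: le_lt_trans sA.
  have [e e0 [x xb wx]] := ll b bpos.
  have [a [/andP[sa as'] Sa] ea] := sup_adherent e0 hA.
  have ab : a <= sup A := ub_le_sup hA.2 (conj (introT andP (conj sa as')) Sa).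
  have a0 : 0 <= a by apply: le_trans sa.
  have [ab'|ba] := ltP a (sup A); last first.
    by apply: Sa; apply/andP; split; first exact: ltW.
  have Sx : S x.
    by rewrite -(wx (NngNum a0)) /= ?ea ?ab'//; apply: Sa; rewrite /= sa lexx.
  case: xb => [<-//|/(ST _ _ Sx)[//|/nT]]; case.
  by rewrite /= ltW.
have [e e0 we] := rc b.
pose c := Num.min (sup A + e / 2) s'%:num.
have Ac : A c.
  split=> [|u /andP[su uc]].
    by rewrite /c ge_min lexx orbT andbT le_min ss' andbT (le_trans sA)// lerDl divr_ge0// ltW.
  have [ub|bu] := ltP u%:num (sup A).
    have ub' : 0 < sup A - u%:num by rewrite subr_gt0.
    have [a [_ Sa]] := sup_adherent ub' hA; rewrite opprB addrC subrK => ua.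
    by apply: Sa; rewrite su ltW.
  rewrite we// bu/=; apply: (le_lt_trans uc); rewrite /c gt_min ltrD2l; apply/orP; left.
  by rewrite ltr_pdivrMr// ltr_pMr// ltr1n.
have cb : c <= sup A by exact: (ub_le_sup hA.2 Ac).
have cs : c = s'%:num.
  move: cb; rewrite /c; case: (leP (sup A + e / 2) s'%:num) => // _.
  by rewrite gerDl leNgt divr_gt0.
by apply: (Ac.2 s'); rewrite ss' cs lexx.
Qed.

(** A discrete intermediate value property: a jump changes a coordinate by at most one, so the path
    cannot pass from one side of level [k] to the other without visiting it. *)
Lemma walk_range_level (R : realType) d (w : walk_path R d) (t : R) (i : 'I_d) (x y : 'rV[int]_d) (k : int) :
  walk_range w t x -> walk_range w t y -> x 0 i <= k <= y 0 i ->
  exists2 z, walk_range w t z & z 0 i = k.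
Proof.
move=> [s st <-] [s' st' <-] /andP[l u]; apply: contrapT => H.
have nT (v : {nonneg R}) : v%:num <= t -> w v 0 i <> k.
  by move=> vt E; apply: H; exists (w v) => //; exists v.
have step (a b : 'rV[int]_d) : Defs.adjacent a b -> `|a 0 i - b 0 i| <= 1 := @adjacent_coord d a b i.
have := nT s st; have := nT s' st' => n1 n2.
have [ss'|ss'] := leP s%:num s'%:num.
  suff : w s' 0 i < k by move: u; clear; lia.
  apply: (@nn_path_stays R d w [set a | a 0 i < k] [set a | a 0 i = k] s s') => //=.
  - by move=> a b ak /step; move: ak; clear; lia.
  - by move: l n2; clear; lia.
  - by move=> v /andP[_ vs]; apply: nT; apply: le_trans st'.
suff : k < w s 0 i by move: l; clear; lia.
apply: (@nn_path_stays R d w [set a | k < a 0 i] [set a | a 0 i = k] s' s) => //=.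
- by move=> a b ak /step; move: ak; clear; lia.
- exact: ltW.
- by move: u n1; clear; lia.
- by move=> v /andP[_ vs]; apply: nT; apply: le_trans st.
Qed.

Lemma adjacent_delta d (x : 'rV[int]_d) (i : 'I_d) : Defs.adjacent x (x + delta_mx 0 i).
Proof.
apply/eqP; rewrite (bigD1 i)//= big1 ?addr0 => [|j ji].
  by rewrite !mxE !eqxx/= opprD addrA subrr add0r normrN normr1.
by rewrite !mxE (negbTE ji) andbF addr0 subrr normr0.
Qed.

Lemma ray_meets_boundary d (G : set 'rV[int]_d) (x : 'rV[int]_d) (j : 'I_d) :
  finite_set G -> G x -> exists n : nat, inner_boundary G (x + delta_mx 0 j *+ n).
Proof.
move=> fG Gx; apply: contrapT => H.
have Gn n : G (x + delta_mx 0 j *+ n).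
  elim: n => [|n IH]; first by rewrite mulr0n addr0.
  apply: contrapT => nG; apply: H; exists n; split=> //.
  exists (x + delta_mx 0 j *+ n.+1) => //.
  by rewrite mulrSr addrA; exact: adjacent_delta.
have : finite_set [set: nat].
  apply: sub_finite_set (finite_preimage _ fG) => [n _|]; first exact: Gn.
  move=> m n _ _ /addrI/rowP/(_ j); rewrite !mulmxnE !mxE !eqxx/= => /eqP.
  by rewrite eqr_nat => /eqP.
exact: infinite_nat.
Qed.

Lemma leq_card_set (R : realType) d (G : set 'rV[int]_d) (s : seq 'rV[int]_d) :
  finite_set G -> uniq s -> [set` s] `<=` G -> (size s)%:R <= card_set R G.
Proof.
move=> fG us sG; rewrite ler_nat; apply: uniq_leq_size => // x xs.
by rewrite in_fset_set// inE; exact: sG.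
Qed.

Lemma finite_inner_boundary d (G : set 'rV[int]_d) : finite_set G -> finite_set (inner_boundary G).
Proof. by move=> fG; apply: sub_finite_set fG => x []. Qed.

(** Every level between the two coordinates contains a site of the range. Moving from it in a second
    direction [j], which preserves the level, leads to a boundary site, and different levels give
    different boundary sites. *)
Lemma coord_le_boundary (R : realType) d (w : walk_path R d) (t : R) (i : 'I_d) (x y : 'rV[int]_d) :
  (2 <= d)%N -> walk_range w t x -> walk_range w t y -> 
  (y 0 i - x 0 i)%:~R <= card_set R (inner_boundary (walk_range w t)).
Proof.
move=> d2 wx wy; have [yx|xy] := leP (y 0 i) (x 0 i).
  by apply: (@le_trans _ _ 0); rewrite ?ler0n// lerz0 subr_le0.
have [j ji] : exists j : 'I_d, j != i.
  have : (1 < #|'I_d|)%N by rewrite card_ord.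
  by case/card_gt1P => a [b [_ _ ab]]; have [ai|] := eqVneq a i; [exists b; rewrite -ai eq_sym|exists a].
set G := walk_range w t; have fG : finite_set G := finite_walk_range w t.
pose n := absz (y 0 i - x 0 i)%R.
have nE : n%:Z = y 0 i - x 0 i by rewrite gez0_abs// subr_ge0 ltW.
have level k : exists z : 'rV[int]_d, (k <= n)%N -> inner_boundary G z /\ z 0 i = x 0 i + k%:Z.
  have [kn|] := leqP k n; last by exists 0.
  have [|z Gz zk] := @walk_range_level R d w t i x y (x 0 i + k%:Z) wx wy.
    by rewrite lerDl/= -lerBrDl -nE lez_nat.
  have [l Gl] := @ray_meets_boundary d G z j fG Gz.
  exists (z + delta_mx 0 j *+ l) => _; split => //.
  by rewrite -zk mxE mulmxnE mxE eq_sym (negbTE ji) andbF mul0rn addr0.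
have [f Hf] := choice level.
pose s := [seq f k | k <- iota 0 n].
have sk k : k \in iota 0 n -> (k <= n)%N by rewrite mem_iota => /andP[_ /ltnW].
have <- : (size s)%:R = (y 0 i - x 0 i)%:~R :> R by rewrite size_map size_iota -nE.
apply: leq_card_set; first exact: finite_inner_boundary.
  rewrite map_inj_in_uniq ?iota_uniq// => a b /sk an /sk bn fab.
  have [_ fa] := Hf a an; have [_ fb] := Hf b bn.
  by move: fa; rewrite fab fb => /addrI[].
by move=> z /= /mapP[k /sk kn ->]; have [] := Hf k kn.
Qed.

Lemma diam_le_boundary (R : realType) d (w : walk_path R d) (t : R) : (2 <= d)%N -> 0 <= t ->
  diam R (walk_range w t) <= d%:R * card_set R (inner_boundary (walk_range w t)).
Proof.
move=> d2 t0; apply: (@diam_le _ _ _ (path_fun w (NngNum (lexx 0)))).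
  exists (NngNum (lexx 0)) => //=.
move=> y z wy wz; apply: le_trans (dist_le_sum _ _ _) _.
apply: (@le_trans _ _ (\sum_(i < d) card_set R (inner_boundary (walk_range w t)))).
  apply: ler_sum => i _; have [zy|yz] := leP 0 (y 0 i - z 0 i).
    by rewrite ger0_norm//; exact: coord_le_boundary.
  by rewrite ltr0_norm// opprB; exact: coord_le_boundary.
by rewrite sumr_const card_ord mulr_natl.
Qed.

Lemma srw_small_diam (R : realType) d (P : probability (path_space R d) R) (t : {nonneg R}) (rho : R) :
  is_srw_law P -> (0 < d)%N -> 1 <= rho -> 0 < t%:num ->
  (P [set w : path_space R d | (diam R (walk_range w t%:num) < rho)%R]
    <= (2 * expR (- (t%:num / (32 * rho ^+ 2))))%:E)%E.
Proof.
move=> PL d0 rho1 t0; have rho0 : 0 < rho := lt_le_trans ltr01 rho1.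
(* Rounding up to an integer at most doubles the radius, since [rho >= 1]; this turns the 8 of
   [srw_confined] into 32. *)
pose m := (Num.truncn rho).+1.
have /andP[m1 m2] := truncn_itv (ltW rho0); rewrite -/m in m2.
have m0 : 0 < m%:R :> R := lt_trans rho0 m2.
have mE : m%:R <= 2 * rho.
  by rewrite /m -[_.+1%:R]natr1; move: m1 rho1; clear; lra.
apply: (@le_trans _ _ (2 * expR (- (t%:num / (8 * m%:R ^+ 2))))%:E); last first.
  rewrite lee_fin ler_pM2l// ler_expR lerN2 ler_pM2l// lef_pV2 ?posrE ?mulr_gt0 ?exprn_gt0//.
  rewrite (_ : 32 * rho ^+ 2 = 8 * (2 * rho) ^+ 2); last by ring.
  by rewrite ler_pM2l// lerXn2r ?nnegrE ?mulr_ge0// ltW.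
apply: srw_confined => //.
  exact: (@measurable_range R d t (fun S => diam R S < rho)).
move=> w /= wrho s st i; rewrite mxE cornerE mxE.
have fG : finite_set (walk_range w t%:num) := finite_walk_range w t%:num.
have : `|path_fun w s 0 i - start w 0 i| < m%:Z.
  rewrite -(ltr_int R); apply: le_lt_trans (coord_le_dist _ _ _ _) (lt_trans _ m2).
  apply: le_lt_trans wrho; apply: dist_le_diam => //; first by exists s.
  exists (NngNum (lexx 0)) => //=.
by move: (path_fun w s 0 i) (start w 0 i) (m) => a b c; clear; lia.
Qed.

(** * Isoperimetry by counting translates *)

Definition escapes d (s : seq 'rV[int]_d) (v : 'rV[int]_d) : nat :=
  count (fun x => x + v \notin s) s.

(** A site that leaves [s] under [u + v] either leaves it under [u], or is carried by [u] to a site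
    of [s] that leaves it under [v]; translation by [u] is injective. *)
Lemma escapesD d (s : seq 'rV[int]_d) (u v : 'rV[int]_d) : uniq s ->
  (escapes s (u + v)%R <= escapes s u + escapes s v)%N.
Proof.
move=> us.
pose late x := (x + u \in s) && (x + u + v \notin s).
apply: (@leq_trans (escapes s u + count late s)%N).
  rewrite -count_predUI; apply: (leq_trans _ (leq_addr _ _)).
  by apply: sub_count => x /=; rewrite /late addrA => ->; case: (x + u \in s).
rewrite leq_add2l /escapes -!size_filter -(size_map (fun x => x + u)).
apply: uniq_leq_size; first by rewrite (map_inj_uniq (addIr u)) filter_uniq.
move=> y /mapP[x]; rewrite !mem_filter => /andP[/andP[xu xuv] _] ->.
by rewrite xuv.
Qed.

Lemma escapes_orthant d (s : seq 'rV[int]_d) (n : 'I_d -> nat) (b : nat) : uniq s ->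
  (forall i, (escapes s (delta_mx 0 i)%R <= b)%N) ->
  (escapes s (\sum_i delta_mx 0 i *+ n i)%R <= (\sum_i n i) * b)%N.
Proof.
move=> us sb.
have s0 : escapes s 0 = 0%N.
  by apply/eqP; rewrite -leqn0 leqNgt -has_count; apply/hasPn => x xs; rewrite addr0 xs.
have mulb i k : (escapes s (delta_mx 0 i *+ k)%R <= k * b)%N.
  elim: k => [|k IH]; first by rewrite mulr0n s0.
  by rewrite mulrS mulSn (leq_trans (escapesD _ _ us)) ?leq_add.
apply: (big_ind2 (fun v k => (escapes s v <= k * b)%N)) => //; first by rewrite s0.
by move=> u k v l uk vl; rewrite mulnDl (leq_trans (escapesD _ _ us)) ?leq_add.
Qed.

(* A set of [g] sites cannot contain half of the translates of a site by the
   vectors of [[0, l)^d] when [l ^ d >= 2 g]. *)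
Lemma boundary_counting d (s : seq 'rV[int]_d) (l b : nat) : uniq s ->
  (forall i, (escapes s (delta_mx 0 i)%R <= b)%N) -> (2 * size s <= l ^ d)%N ->
  (size s <= 2 * d * l * b)%N.
Proof.
move=> us sb sl.
pose v (f : {ffun 'I_d -> 'I_l}) : 'rV[int]_d := \sum_i delta_mx 0 i *+ f i.
have vE f i : v f 0 i = (f i)%:Z.
  rewrite /v summxE (bigD1 i)//= big1 ?addr0 => [|j ji]; rewrite mulmxnE mxE.
    by rewrite !eqxx; exact: natz.
  by rewrite eqxx eq_sym (negbTE ji) mul0rn.
have vi : injective v.
  move=> f g /rowP fg; apply/ffunP => i; apply/val_inj.
  by have := fg i; rewrite !vE => -[].
have cE : #|{ffun 'I_d -> 'I_l}| = (l ^ d)%N by rewrite card_ffun !card_ord.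
have up : (\sum_f escapes s (v f) <= l ^ d * (d * l * b))%N.
  apply: (@leq_trans (\sum_(f : {ffun 'I_d -> 'I_l}) d * l * b)%N); last first.
    by rewrite sum_nat_const cE.
  apply: leq_sum => f _; apply: leq_trans (escapes_orthant _ us sb) _.
  rewrite leq_mul2r; apply/orP; right.
  apply: (@leq_trans (\sum_(i < d) l)%N); first by apply: leq_sum => i _; exact: ltnW.
  by rewrite sum_nat_const card_ord.
pose out (x : 'rV[int]_d) := [pred f | x + v f \notin s].
have out_half x : (l ^ d <= 2 * #|out x|)%N.
  have : (#|[predC out x]| <= size s)%N.
    rewrite cardE -(size_map (fun f => x + v f)); apply: uniq_leq_size.
      by rewrite map_inj_uniq ?enum_uniq// => f g /addrI/vi.
    by move=> y /mapP[f]; rewrite mem_enum !inE negbK => fs ->.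
  by have := cardC (out x); rewrite cE; move: #|out x| #|[predC out x]| (l ^ d)%N sl => m n k; clear; lia.
(* Double counting of pairs of a site and a translation: at most [size s] translations keep a given
   site in [s], so at least half of the [l ^ d] drive it out. On the other hand, a translation is a
   sum of at most [d * l] unit steps, each of which drives out at most [b] sites. *)
have lo : (size s * l ^ d <= 2 * \sum_f escapes s (v f))%N.
  have -> : (\sum_f escapes s (v f) = \sum_(x <- s) #|out x|)%N.
    rewrite /escapes; under eq_bigr do rewrite -sum1_count big_mkcond.
    rewrite exchange_big/=; apply: eq_bigr => x _; rewrite -big_mkcond sum1_card; exact: eq_card.
  elim: (s) => [|x r IH]; first by rewrite big_nil.
  by rewrite big_cons mulnDr /= [leqLHS]mulSn leq_add ?out_half.
have [l0|l0] := posnP (l ^ d).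
  by move: sl; rewrite l0; clear; lia.
rewrite -(leq_pmul2r l0); apply: (leq_trans lo).
by rewrite -!mulnA leq_mul2l (leq_trans up)// mulnC !mulnA.
Qed.

Lemma boundary_isoperimetry (R : realType) d (G : set 'rV[int]_d) (rho : R) :
  (0 < d)%N -> finite_set G -> 0 < rho -> rho ^+ d <= card_set R G ->
  rho ^+ d.-1 <= 8 * d%:R * card_set R (inner_boundary G).
Proof.
move=> d0 fG rho0 rhoG.
pose s : seq 'rV[int]_d := fset_set G.
have us : uniq s by exact: fset_uniq.
have sE x : (x \in s) = `[< G x >] by rewrite in_fset_set// inE.
have fB := finite_inner_boundary fG.
pose b := size (fset_set (inner_boundary G)).
have bE : card_set R (inner_boundary G) = b%:R by [].
have esc i : (escapes s (delta_mx 0 i)%R <= b)%N.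
  rewrite /escapes -size_filter; apply: uniq_leq_size; first by rewrite filter_uniq.
  move=> x; rewrite mem_filter !sE in_fset_set// inE => /andP[/asboolPn nG /asboolP Gx].
  by split=> //; exists (x + delta_mx 0 i) => //; exact: adjacent_delta.
have sR : (size s)%:R = card_set R G by [].
pose g := card_set R G `^ d%:R^-1.
have G0 : 0 < card_set R G by apply: lt_le_trans rhoG; rewrite exprn_gt0.
have d0R : d%:R != 0 :> R by rewrite pnatr_eq0 -lt0n.
have g0 : 0 <= g by exact: powR_ge0.
have gE : g ^+ d = card_set R G.
  by rewrite -powR_mulrn// -powRrM mulVf// powRr1// ltW.
have rg : rho <= g by rewrite -(ler_pXn2r d0) ?nnegrE ?(ltW rho0)// gE.
have g1 : 1 <= g.
  rewrite -(ler_pXn2r d0) ?nnegrE// gE expr1n -sR ler1n lt0n.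
  by apply: contraTneq G0 => s0; rewrite -sR s0 ltxx.
(* [l > 2 g] ensures [l^d >= 2 |G|], and rounding costs at most [g] because [g >= 1]; the count then
   reads [g^d <= 6 d g b]. *)
pose l := (Num.truncn (2 * g)).+1.
have /andP[l1 l2] := truncn_itv (mulr_ge0 (ler0n R 2) g0); rewrite -/l in l2.
have lE : l%:R <= 3 * g by rewrite /l -[_.+1%:R]natr1; move: l1 g1; clear; lra.
have sl : (2 * size s <= l ^ d)%N.
  rewrite -(ler_nat R) natrM natrX sR -gE.
  apply: (@le_trans _ _ ((2 * g) ^+ d)); last by rewrite lerXn2r ?nnegrE ?mulr_ge0// ltW.
  by rewrite exprMn ler_wpM2r ?exprn_ge0// ler_eXnr// ler1n.
have := boundary_counting us esc sl; rewrite -(ler_nat R) !natrM sR -bE -gE.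
have -> : g ^+ d = g ^+ d.-1 * g by rewrite -exprSr prednK.
move=> H.
apply: (@le_trans _ _ (g ^+ d.-1)); first by rewrite lerXn2r ?nnegrE ?(ltW rho0).
rewrite -(ler_pM2r (lt_le_trans ltr01 g1)); apply: (le_trans H); rewrite bE.
have := ler_wpM2r (mulr_ge0 (ler0n R d) (ler0n R b)) lE.
have := mulr_ge0 (mulr_ge0 (ler0n R d) (ler0n R b)) g0.
by move: (d%:R : R) (b%:R : R) (l%:R : R) => x y z; clear; lra.
Qed.

(** * Concentration *)

Lemma scale_large (R : realType) d (beta M : R) : 0 < beta ->
  \forall t \near +oo, M <= (t / beta) `^ (d.+1%:R^-1).
Proof.
move=> b0; pose N := Num.max M 0.
have N0 : 0 <= N by rewrite /N le_max lexx orbT.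
exists (N ^+ d.+1 * beta); split=> [|t tN]; first exact: num_real.
apply: (@le_trans _ _ N); first by rewrite /N le_max lexx.
have -> : N = (N ^+ d.+1) `^ (d.+1%:R^-1).
  by rewrite -powR_mulrn// -powRrM mulfV// powRr1.
have Nt : N ^+ d.+1 <= t / beta by rewrite ler_pdivlMr// ltW.
by rewrite ge0_ler_powR ?nnegrE ?invr_ge0 ?exprn_ge0// (le_trans _ Nt)// exprn_ge0.
Qed.

Lemma scale_exp (R : realType) d (beta t : R) : 0 < beta -> 0 < t ->
  beta * ((t / beta) `^ (d.+1%:R^-1)) ^+ d.+1 = t.
Proof.
move=> b0 t0; rewrite -powR_mulrn ?powR_ge0// -powRrM mulVf// powRr1; last first.
  by rewrite divr_ge0// ltW.
by rewrite mulrC divfK// gt_eqF.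
Qed.

(** [Phi] is any property of the range implied by the two deterministic bounds, so that all
    dimensions share the probabilistic part. The failure probability is at most [3 exp (- L)] with
    [L >= beta0 r], which tends to infinity. *)
Lemma range_concentration (R : realType) d (beta0 : R) : (2 <= d)%N -> 0 < beta0 ->
  exists c C : R, [/\ 0 < c, 0 < C & forall (P : probability (path_space R d) R) (beta : R)
    (Phi : R -> set 'rV[int]_d -> Prop), is_srw_law P -> beta0 < beta ->
    (forall (w : path_space R d) (t : R), 0 < t ->
      c * (t / beta) `^ (d.+1%:R^-1) <= diam R (walk_range w t) ->
      card_set R (inner_boundary (walk_range w t)) <= C * ((t / beta) `^ (d.+1%:R^-1)) ^+ d.-1 ->
      Phi t (walk_range w t)) ->
    gibbs P beta t [set w | Phi t (walk_range w t)] @[t --> +oo] --> 1%E].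
Proof.
move=> d2 b0; have [C [K [C0 HZ]]] := @partition_function_lower R d beta0 d2 b0.
(* The confinement exponent [t / (32 (c r)^2)] equals [L / (32 c^2)]. It is at least [(C + 1) L]
   because [32 (C + 1) c = 1] and [c <= 1]. *)
pose c : R := (32 * (C + 1))^-1.
have C1 : 0 < C + 1 by rewrite addr_gt0.
have c0 : 0 < c by rewrite invr_gt0 mulr_gt0.
have c1 : c <= 1.
  rewrite invf_le1 ?mulr_gt0//; move: C0; clear; lra.
exists c, (C + 1); split=> // P beta Phi PL bb HPhi.
have be0 : 0 < beta := lt_trans b0 bb.
pose r t := (t / beta) `^ (d.+1%:R^-1).
have lower t : 0 < t -> 1 <= r t -> K <= r t -> 1 <= c * r t ->
    ((1 - 3 * expR (- (beta0 * r t)))%:E <=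
      gibbs P beta t [set w | Phi t (walk_range w t)] <= 1)%E.
  move=> t0 r1 rK cr1; have r0 : 0 < r t := lt_le_trans ltr01 r1.
  have tE : beta * r t ^+ d.+1 = t by exact: scale_exp.
  pose L := beta * r t ^+ d.-1.
  have LZ : expR (- (C * L)) <= partition_function P beta t.
    by rewrite -[in leRHS]tE; exact: HZ.
  have Z0 : 0 < partition_function P beta t := lt_le_trans (expR_gt0 _) LZ.
  have d1 : (1 <= d)%N by exact: leq_trans d2.
  have tL : t = L * r t ^+ 2 by rewrite -{1}tE /L -mulrA -exprD addn2 prednK.
  have Lr : beta0 * r t <= L.
    apply: ler_pM; rewrite ?(ltW b0) ?(ltW bb) ?(ltW r0)//.
    by rewrite ler_eXnr//; move: d2; clear; lia.
  pose om := expR (- ((C + 1) * L)).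
  pose B := [set w : path_space R d | diam R (walk_range w t) < c * r t].
  have mPhi (Psi : set 'rV[int]_d -> Prop) :
      measurable [set w : path_space R d | Psi (walk_range w t)].
    exact: (@measurable_range R d (NngNum (ltW t0)) Psi).
  have PB : (P B <= (2 * om)%:E)%E.
    apply: le_trans (@srw_small_diam R d P (NngNum (ltW t0)) _ PL d1 cr1 t0) _.
    rewrite lee_fin ler_pM2l// ler_expR lerN2 /=.
    rewrite ler_pdivlMr ?mulr_gt0 ?exprn_gt0// ?mulr_gt0// [in leRHS]tL.
    have -> : (C + 1) * L * (32 * (c * r t) ^+ 2) = (32 * (C + 1) * c) * c * (L * r t ^+ 2).
      by ring.
    rewrite mulfV ?mul1r ?gt_eqF ?mulr_gt0// ler_piMl// -tL; exact: ltW.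
  pose A := [set w : path_space R d | Phi t (walk_range w t)].
  have HB w : ~ A w -> ~ B w -> gibbs_weight beta t w <= om.
    move=> nPhi /negP; rewrite -leNgt => wd.
    have : (C + 1) * r t ^+ d.-1 < card_set R (inner_boundary (walk_range w t)).
      by rewrite ltNge; apply/negP => wb; apply: nPhi; exact: HPhi.
    rewrite -(ltr_pM2l be0) => /ltW wb.
    by rewrite /gibbs_weight /om ler_expR mulNr lerN2 mulrCA.
  have /andP[lo hi] := gibbs_concentration (ltW be0) t0 Z0 (expR_ge0 _) (mPhi (Phi t))
    (mPhi (fun S => diam R S < c * r t)) PB HB.
  rewrite hi andbT; apply: le_trans lo; rewrite lee_fin lerD2l lerN2.
  rewrite mulrC ler_pdivrMr//.
  have -> : 2 * om + om = 3 * (expR (- L) * expR (- (C * L))).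
    have -> : om = expR (- L) * expR (- (C * L)) by rewrite -expRD -opprD /om mulrDl mul1r addrC.
    by ring.
  rewrite -mulrA ler_pM2l//; apply: ler_pM; rewrite ?expR_ge0//.
  by rewrite ler_expR lerN2.
apply: (@squeeze_cvge _ _ _ _ (fun t => (1 - 3 * expR (- (beta0 * r t)))%:E) _ (fun=> 1%E)).
- near=> t; apply: lower; near: t.
  + exact: nbhs_pinfty_gt.
  + exact: scale_large.
  + exact: scale_large.
  + near=> t; rewrite mulrC -ler_pdivrMr//; near: t; exact: scale_large.
- apply: cvg_EFin; first by near=> t.
  apply/cvgrPdist_le => e e0; near=> t.
  rewrite opprB addrC subrK ger0_norm ?mulr_ge0 ?expR_ge0//.
  have rt : 3 / e <= beta0 * r t.
    rewrite [leRHS]mulrC -ler_pdivrMr//; near: t; exact: scale_large.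
  have x0 : 0 < beta0 * r t by apply: lt_le_trans rt; rewrite divr_gt0.
  rewrite expRN ler_pdivrMr ?expR_gt0//; apply: (@le_trans _ _ (e * (beta0 * r t))).
    by rewrite mulrC -ler_pdivrMr.
  rewrite ler_pM2l//; apply: le_trans (expR_ge1Dx _); by rewrite lerDr.
- exact: cvg_cst.
Unshelve. all: by end_near. Qed.

Lemma volume_le_of_boundary_le (R : realType) d (C : R) : (2 <= d)%N -> 0 < C ->
  exists2 c : R, 0 < c & forall (G : set 'rV[int]_d) (r : R), finite_set G -> 0 < r ->
    card_set R (inner_boundary G) <= C * r ^+ d.-1 -> card_set R G <= c * r ^+ d.
Proof.
(* A volume above [(rho r)^d] would give [rho^(d-1) <= 8 d C] by isoperimetry, whereas
   [rho^(d-1) >= rho > 8 d C]. *)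
move=> d2 C0; pose rho := 1 + 8 * d%:R * C.
have d0 : (0 < d)%N by exact: leq_trans d2.
have dC : 0 < 8 * d%:R * C by rewrite !mulr_gt0// ltr0n.
have rho1 : 1 <= rho by rewrite lerDl ltW.
have rho0 : 0 < rho by exact: lt_le_trans rho1.
exists (rho ^+ d) => [|G r fG r0 bG]; first exact: exprn_gt0.
rewrite leNgt -exprMn; apply/negP => /ltW H.
have := boundary_isoperimetry d0 fG (mulr_gt0 rho0 r0) H.
rewrite leNgt => /negP; apply; apply: (@le_lt_trans _ _ (8 * d%:R * (C * r ^+ d.-1))).
  by rewrite ler_wpM2l.
rewrite exprMn mulrA ltr_pM2r ?exprn_gt0//; apply: (@lt_le_trans _ _ rho); first by rewrite ltrDr.
by rewrite ler_eXnr//; move: d2; clear; lia.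
Qed.

Theorem theorem1p1 (R : realType) :
  (forall beta0 : R, 0 < beta0 ->
     exists c1 c2 : R, [/\ 0 < c1, 0 < c2 &
       forall P : probability (path_space R 2) R, is_srw_law P ->
       forall beta : R, beta0 < beta ->
         gibbs P beta t
           [set w | c1 * (t / beta) `^ (3%:R^-1) <= diam R (walk_range w t)
                    /\ diam R (walk_range w t) <= c2 * (t / beta) `^ (3%:R^-1)]
         @[t --> +oo] --> 1%E]) /\
  (forall d : nat, (3 <= d)%N ->
   forall beta0 : R, 0 < beta0 ->
     exists c1 c2 : R, [/\ 0 < c1, 0 < c2 &
       forall P : probability (path_space R d) R, is_srw_law P ->
       forall beta : R, beta0 < beta ->
         gibbs P beta t
           [set w | c1 * (t / beta) `^ (d.+1%:R^-1) <= diam R (walk_range w t)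
                    /\ card_set R (walk_range w t)
                       <= c2 * (t / beta) `^ (d%:R / d.+1%:R)]
         @[t --> +oo] --> 1%E]).
Proof.
split=> [beta0 b0|d d3 beta0 b0].
  have [c [C [c0 C0 H]]] := @range_concentration R 2 beta0 isT b0.
  (* The factor 2 is the dimension in [diam_le_boundary], and for d = 2 the surface scale [r^(d-1)]
     is the length scale [r] itself. *)
  exists c, (2 * C); split=> [||P PL beta bb] //; first by rewrite mulr_gt0.
  apply: (H P beta (fun t S => c * (t / beta) `^ (3%:R^-1) <= diam R S /\
    diam R S <= 2 * C * (t / beta) `^ (3%:R^-1)) PL bb) => w t t0 lo bd; split=> //.
  apply: le_trans (diam_le_boundary w isT (ltW t0)) _.
  by rewrite -mulrA ler_pM2l.
have d2 : (2 <= d)%N by exact: ltnW.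
have [c [C [c0 C0 H]]] := @range_concentration R d beta0 d2 b0.
have [c2 c20 Hvol] := volume_le_of_boundary_le d2 C0.
exists c, c2; split=> // P PL beta bb.
apply: (H P beta (fun t S => c * (t / beta) `^ (d.+1%:R^-1) <= diam R S /\
  card_set R S <= c2 * (t / beta) `^ (d%:R / d.+1%:R)) PL bb) => w t t0 lo bd; split=> //.
have r0 : 0 < t / beta by rewrite divr_gt0// (lt_trans b0).
rewrite [d%:R / _]mulrC powRrM powR_mulrn ?powR_ge0//.
by apply: Hvol bd; [exact: finite_walk_range|exact: powR_gt0].
Qed.
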